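(* Let $0<\delta<1$ and let $f:\Omega\times\Omega\to\mathbb{R}$ be a continuous function with $\Omega=[a,b]$ and $-\infty<a<b<\infty$, where $f$ can be written as $f=f_1-f_2$ for some continuous positive semidefinite functions $f_1,f_2:\Omega\times\Omega\to\mathbb{R}$. Let $m\ge 96\log(4/\delta)$ be an integer. Let $H_m(f)$ be the continuous Hutchinson's estimate of $\mathrm{tr}(f)$ with $m$ probe functions drawn from $\mathcal{GP}(0,K)$ for some continuous positive semidefinite covariance kernel $K:\Omega\times\Omega\to\mathbb{R}$. Then, with probability $\ge 1-\delta$, $$\left|H_m(f)-\mathbb{E}[H_m(f)]\right|\le\|K\|_{op}\|f\|_{L^2}\sqrt{\frac{96\log(4/\delta)}{m}}.$$
   Context: A function $h:\Omega\times\Omega\to\mathbb{R}$ is positive semidefinite (PSD) if for any $x_1,\dots,x_n\in\Omega$ the matrix $(h(x_i,x_j))_{i,j}$ is positive semidefinite. $\mathrm{tr}(f)=\int_\Omega f(x,x)\,dx$; $\|f\|_{L^2}$ is the norm of $L^2(\Omega\times\Omega)$; $\|K\|_{op}$ is the operator norm on $L^2(\Omega)$ of the integral operator with kernel $K$. $g\sim\mathcal{GP}(0,K)$ denotes a centered Gaussian process on $\Omega$ with covariance $\mathbb{E}[g(x)g(y)]=K(x,y)$. The continuous Hutchinson's estimate with $m$ probe functions drawn from $\mathcal{GP}(0,K)$ is $H_m(f)=\frac1m\sum_{i=1}^m\int_\Omega\int_\Omega g_i(x)f(x,y)g_i(y)\,dx\,dy$, where $g_1,\dots,g_m$ are independent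 draws from $\mathcal{GP}(0,K)$. *)

(* Defs.v *)
From HB Require Import structures.
From mathcomp Require Import all_boot all_order all_algebra.
From mathcomp Require Import all_classical all_reals all_analysis.

Set Implicit Arguments.
Unset Strict Implicit.
Unset Printing Implicit Defensive.

Import Order.TTheory GRing.Theory Num.Theory.
Import numFieldNormedType.Exports.

Local Open Scope classical_set_scope.
Local Open Scope ring_scope.

(* Below, [D] is the domain and the values of kernels and processes outside
   [D] are never used. *)

Definition psdmx (R : realType) (n : nat) (A : 'M[R]_n) : Prop :=
  A^T = A /\ forall v : 'rV[R]_n, 0 <= (v *m A *m v^T) ord0 ord0.

Definition psd_kernel (R : realType) (D : set R) (h : R -> R -> R) : Prop :=
  forall (n : nat) (x : 'I_n -> R), (forall i, D (x i)) ->
    psdmx (\matrix_(i, j) h (x i) (x j)).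

Definition continuous_kernel (R : realType) (D : set R) (h : R -> R -> R) :
    Prop :=
  {within D `*` D, continuous (fun p : R * R => h p.1 p.2)}.

Definition L2norm (R : realType) (D : set R) (u : R -> R) : \bar R :=
  ('N[@lebesgue_measure R]_2%:E [(EFin \o u) \_ D])%E.

Definition kernel_L2norm (R : realType) (D : set R) (h : R -> R -> R) :
    \bar R :=
  ('N[(@lebesgue_measure R \x @lebesgue_measure R)]_2%:E
     [(fun p : R * R => (h p.1 p.2)%:E) \_ (D `*` D)])%E.

Definition integral_operator (R : realType) (D : set R) (K : R -> R -> R)
    (u : R -> R) : R -> R :=
  fun x => \int[@lebesgue_measure R]_(y in D) (K x y * u y).

Definition op_norm (R : realType) (D : set R) (K : R -> R -> R) : \bar R :=
  ereal_sup [set L2norm D (integral_operator D K u) |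
    u in [set u | measurable_fun D u /\ (L2norm D u <= 1)%E]].

(* [normal_prob mu 0] is the uniform law on [0, 1], hence the separate
   degenerate case. *)
Definition normal_law (R : realType) (mu sigma : R) (B : set R) : \bar R :=
  if sigma == 0 then \d_mu B else normal_prob mu sigma B.

Definition gaussian_rv (d : measure_display) (T : measurableType d)
    (R : realType) (P : probability T R) (X : T -> R) : Prop :=
  measurable_fun setT X /\
  exists mu sigma : R, forall B : set R, measurable B ->
    P (X @^-1` B) = normal_law mu sigma B.

(* The finite-dimensional marginals are (possibly degenerate) multivariate
   Gaussians, i.e. all their linear combinations are Gaussian.  Joint
   measurability is what gives a meaning to the integrals of the sample
   paths; every continuous covariance kernel admits such a process. *)
Record gaussian_process (d : measure_display) (T : measurableType d)
    (R : realType) (P : probability T R) (D : set R) (K : R -> R -> R)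
    (g : R -> T -> R) : Prop := GaussianProcess {
  gp_measurable : measurable_fun (D `*` [set: T])
    (fun p : R * T => g p.1 p.2) ;
  gp_gaussian : forall (n : nat) (x c : 'I_n -> R), (forall i, D (x i)) ->
    gaussian_rv P (fun w => \sum_(i < n) c i * g (x i) w) ;
  gp_centered : forall x, D x -> ('E_P[g x] = 0)%E ;
  gp_covariance : forall x y, D x -> D y ->
    ('E_P[fun w => (g x w * g y w)%R] = (K x y)%:E)%E }.

Definition process_sigma (d : measure_display) (T : measurableType d)
    (R : realType) (D : set R) (g : R -> T -> R) : set (set T) :=
  <<s [set A | exists x, exists B : set R,
         [/\ D x, measurable B & A = (g x @^-1` B)]] >>.

Definition independent_processes (d : measure_display) (T : measurableType d)
    (R : realType) (P : probability T R) (D : set R) (m : nat)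
    (g : 'I_m -> R -> T -> R) : Prop :=
  forall (J : {set 'I_m}) (A : 'I_m -> set T),
    (forall i, i \in J -> process_sigma D (g i) (A i)) ->
    P (\bigcap_(i in [set` J]) A i) = (\prod_(i in J) P (A i))%E.

Definition hutchinson (T : Type) (R : realType) (D : set R) (m : nat)
    (g : 'I_m -> R -> T -> R) (f : R -> R -> R) (w : T) : R :=
  m%:R^-1 * \sum_(i < m)
    \int[@lebesgue_measure R]_(y in D) \int[@lebesgue_measure R]_(x in D)
      (g i x w * f x y * g i y w).

(* Main.v *)
Require Import Defs.
From mathcomp Require Import all_boot all_order all_algebra.
From mathcomp Require Import all_classical all_reals all_analysis.
From mathcomp Require Import measurable_realfun zify ring lra.

Import Order.TTheory GRing.Theory Num.Theory.
Import numFieldNormedType.Exports.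

Local Open Scope classical_set_scope.
Local Open Scope ring_scope.

Set Implicit Arguments.
Unset Strict Implicit.
Unset Printing Implicit Defensive.

(** A probe is sampled on a fine partition of [a, b], which replaces its
    quadratic functional by v^T A v for a Gaussian vector v with covariance S.
    For an independent copy v', Jensen's inequality bounds the centred
    exponential moment of v^T A v by that of v^T A v - v'^T A v', which equals
    (v - v')^T A (v + v').  The pair (v - v', v + v') has the same mixed moments
    as sqrt 2 (v, v'), since those are determined by the laws of the linear
    combinations (polarization), so all moments of the difference are those of
    the decoupled form 2 v^T A v'.  Given v', the latter is Gaussian, and a
    weighted Jensen inequality bounds its moments by powers of tr(ASAS).  This
    yields E exp(t (Q - E Q)) <= exp(8 t^2 F) whenever F > tr(ASAS) and
    8 t^2 F <= 1.  Testing the operator with kernel K on step functions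
    shows that tr(ASAS) is at most the square of the operator norm of K times the
    L^2 norm of f, up to the modulus of continuity of f and K, while the
    discretisation error tends to 0 in mean.  Independence of the probes and the
    Chernoff bound conclude; the constant 96 leaves room for all the limits. *)

(** Diagonalising the covariance would reduce the claim to weighted chi-square variables, at the
    price of an eigenbasis. Decoupling and moments use only the laws of single linear combinations,
    so singular covariance matrices cause no difficulty. Discretisation also carries the
    independence: it is given on events generated by point evaluations, which contain any event
    about finitely many samples, whereas an integral over a whole path is not visibly of that kind.
    Constants: moments bounded by (2k)! (4F)^k make the exponential series geometric with ratio x =
    4 t^2 F, and 1/(1-x) <= exp(2x) for x <= 1/2 yields 8 t^2 F. With F = B^2 and c^2 = 96
    log(4/delta)/m, minimising 8 t^2 B^2 - t B c gives -c^2/32 per probe, hence -3 log(4/delta) for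
    m probes. The two-sided tail 2 (delta/4)^3 is below delta/2; the other half of delta pays, by
    Markov, for the discretisation. The lower bound on m says c <= 1, which makes this t
    admissible. *)

(** * Polarization and comparison of power expansions *)

(** Expand each power over the maps h from J to J. The alternating sum over the sets S containing
    the image of h vanishes unless h is surjective, and each of the #|J|! permutations contributes
    the same product. *)
Lemma polarization (A : comNzRingType) (J : finType) (x : J -> A) :
  \sum_(S : {set J}) (-1) ^+ #|~: S| * (\sum_(l in S) x l) ^+ #|J| =
  (#|J|)`!%:R * \prod_l x l.
Proof.
have expand (S : {set J}) : (\sum_(l in S) x l) ^+ #|J| =
    \sum_(h : {ffun J -> J}) [forall i, h i \in S]%:R * \prod_i x (h i).
  rewrite -prodr_const bigA_distr_big big_mkcond /=.
  apply: eq_bigr => h _; case: ffun_onP => [hS|hS].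
    by rewrite (_ : [forall i, _]) ?mul1r//; apply/forallP.
  by case: forallP => [//|_]; rewrite mul0r.
have alt (h : {ffun J -> J}) :
    \sum_(S : {set J}) (-1) ^+ #|~: S| * ([forall i, h i \in S]%:R : A) =
    (injectiveb h)%:R.
  (* Choosing S is choosing, for each l, the factor 1 (l in S) or the second summand (l outside S),
     which is 0 on the image of h because such an l must lie in S. *)
  transitivity (\prod_(l : J) (1 + (if l \in codom h then 0 else -1 : A))).
    rewrite bigA_distr; apply: eq_bigr => S _.
    rewrite (bigID (mem S)) /= big1 ?mul1r; last by move=> i ->.
    rewrite (eq_bigr (fun l => if l \in codom h then 0 else -1)); last first.
      by move=> i /negbTE ->.
    case: forallP => [hS|hS]; rewrite ?mulr1 ?mulr0.
      rewrite -prodr_const; apply: eq_big => [i|i]; first by rewrite inE.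
      move=> /setCP iS; case: ifPn => // /codomP[j ij].
      by case: iS; rewrite ij.
    have [i hiS] : exists i, h i \notin S.
      by apply/existsP; rewrite -negb_forall; apply/forallP.
    by rewrite (bigD1 (h i)) //= codom_f mul0r.
  case: injectiveP => [ih|nih].
    rewrite big1// => l _; suff -> : l \in codom h by rewrite addr0.
    exact: (inj_card_onto ih).
  have [l lh] : exists l, l \notin codom h.
    apply/existsP; rewrite -negb_forall; apply/negP => /forallP cod.
    apply: nih; apply/injectiveP; rewrite /injectiveb /dinjectiveb.
    apply/card_uniqP; rewrite size_map -cardE -[RHS]/(#|J|).
    by apply: eq_card => i; rewrite cod.
  by rewrite (bigD1 l) //= (negbTE lh) subrr mul0r.
transitivity (\sum_(h : {ffun J -> J}) \sum_(S : {set J})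
   (-1) ^+ #|~: S| * [forall i, h i \in S]%:R * \prod_i x (h i)).
  rewrite exchange_big; apply: eq_bigr => S _.
  by rewrite expand mulr_sumr; apply: eq_bigr => h _; rewrite mulrA.
transitivity (\sum_(h : {ffun J -> J}) (injectiveb h)%:R * \prod_i x (h i)).
  by apply: eq_bigr => h _; rewrite -(alt h) mulr_suml.
transitivity (\sum_(h : {ffun J -> J} | injectiveb h) \prod_l x l).
  rewrite [RHS]big_mkcond; apply: eq_bigr => h _.
  case: injectiveP => [ih|_]; last by rewrite mul0r.
  by rewrite mul1r [RHS](reindex_inj ih).
rewrite sumr_const mulr_natl; congr (_ *+ _).
by rewrite -ffactnn -card_inj_ffuns cardsE.
Qed.

(** Letting l tend to 0 isolates the constant coefficient; once it vanishes, one power of l is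
    divided out and the induction continues. Serves to identify moments by comparing two expansions
    in l. *)
Lemma sum_coef_small (R : realType) (n : nat) (c : nat -> R) (C : R) :
  (forall l, 0 < l -> l <= 1 -> `|\sum_(j < n) c j * l ^+ j| <= C * l ^+ n) ->
  forall j, (j < n)%N -> c j = 0.
Proof.
elim: n c => [//|n ih] c hc.
have c0 : c 0%N = 0.
  set M := C + \sum_(j < n) `|c j.+1|.
  have M0 : 0 <= M.
    have := hc 1 ltr01 (lexx _); rewrite expr1n mulr1 => h.
    by rewrite addr_ge0 ?sumr_ge0// (le_trans _ h).
  have hM l : 0 < l -> l <= 1 -> `|c 0%N| <= M * l.
    move=> l0 l1; have := hc l l0 l1; rewrite big_ord_recl /= expr0 mulr1 => h.
    have lk k : l ^+ k.+1 <= l by rewrite exprS ler_piMr ?exprn_ile1// ltW.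
    have -> : c 0%N = (c 0%N + \sum_(i < n) c (bump 0 i) * l ^+ bump 0 i)
                - \sum_(i < n) c (bump 0 i) * l ^+ bump 0 i by rewrite addrK.
    rewrite (le_trans (ler_normB _ _))// mulrDl lerD//.
      rewrite (le_trans h)// ler_wpM2l//.
      have := hc 1 ltr01 (lexx _); rewrite expr1n mulr1 => h1.
      exact: le_trans h1.
    rewrite (le_trans (ler_norm_sum _ _ _))// mulr_suml; apply: ler_sum => i _.
    by rewrite normrM ler_wpM2l// ger0_norm ?exprn_ge0 ?(ltW l0)//; exact: lk.
  apply/eqP; rewrite -normr_le0 leNgt; apply/negP => c0.
  have M1 : 0 < M + `|c 0%N| + 1 by have := normr_ge0 (c 0%N); lra.
  (* This l lies in (0, 1], and the bound [M * l] at it would force |c 0| (|c 0| + 1) <= 0. *)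
  have := hM (`|c 0%N| / (M + `|c 0%N| + 1)).
  rewrite divr_gt0// ler_pdivrMr// mul1r mulrA ler_pdivlMr// => /(_ isT).
  move=> /(_ ltac:(lra)) h; have : `|c 0%N| * (`|c 0%N| + 1) <= 0 by lra.
  by apply/negP; rewrite -ltNge mulr_gt0//; lra.
move=> [//|j] jn; apply: (ih (c \o succn)) => // l l0 l1.
have := hc l l0 l1; rewrite big_ord_recl c0 mul0r add0r /=.
have -> : \sum_(i < n) c (bump 0 i) * l ^+ bump 0 i =
   l * \sum_(i < n) c i.+1 * l ^+ i.
  by rewrite mulr_sumr; apply: eq_bigr => i _; rewrite /bump add1n exprS mulrCA.
by rewrite normrM gtr0_norm// exprS [in X in _ <= X]mulrCA ler_pM2l.
Qed.

(** In the tail, (n+j)! >= j! lets |y|^n factor out and leaves a partial sum of exp |y|. The bound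
    is shown for partial sums and passes to the limit. *)
Lemma exp_taylor_bound (R : realType) (y : R) (n : nat) :
  `|expR y - \sum_(j < n) y ^+ j / j`!%:R| <= `|y| ^+ n * expR `|y|.
Proof.
have cv z : series (exp_coeff z) @ \oo --> (expR z : R).
  exact: is_cvg_series_exp_coeff.
have le_part (z : R) m : 0 <= z -> \sum_(j < m) z ^+ j / j`!%:R <= expR z.
  move=> z0; rewrite /expR -(big_mkord xpredT (fun j => z ^+ j / j`!%:R)).
  apply: nondecreasing_cvgn_le; last exact: is_cvg_series_exp_coeff.
  by apply: nondecreasing_series => k _ _; exact: exp_coeff_ge0.
have part m : `|\sum_(j < n + m) y ^+ j / j`!%:R - \sum_(j < n) y ^+ j / j`!%:R|
    <= `|y| ^+ n * expR `|y|.
  rewrite big_split_ord /= addrAC subrr add0r.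
  rewrite (le_trans (ler_norm_sum _ _ _))//.
  apply: (@le_trans _ _ (`|y| ^+ n * \sum_(j < m) `|y| ^+ j / j`!%:R)); last first.
    by rewrite ler_wpM2l ?exprn_ge0// le_part.
  rewrite mulr_sumr; apply: ler_sum => i _.
  rewrite normrM normrX exprD -mulrA ler_wpM2l ?exprn_ge0//.
  rewrite ler_wpM2l ?exprn_ge0// ger0_norm ?invr_ge0//.
  rewrite lef_pV2 ?posrE ?ltr0n ?fact_gt0// ler_nat.
  by rewrite leq_fact// leq_addl.
have cv2 : (fun m => `|series (exp_coeff y) (m + n)%N
    - \sum_(j < n) y ^+ j / j`!%:R|)
    @ \oo --> `|expR y - \sum_(j < n) y ^+ j / j`!%:R|.
  apply: cvg_norm; apply: cvgB; last exact: cvg_cst.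
  by have := cv y; rewrite -(cvg_shiftn n).
rewrite -(cvg_lim _ cv2)//; apply: limr_le; first by apply/cvg_ex; eexists; exact: cv2.
apply: nearW => m; rewrite addnC; apply: le_trans (part m).
by rewrite /series /= big_mkord.
Qed.

(** * Integration tools, and moments read off from a generating function *)

Section integral_tools.
Context {d : measure_display} {T : measurableType d} {R : realType}.
Variable mu : {measure set T -> \bar R}.

Lemma integrable_sumR (I : Type) (s : seq I) (h : I -> T -> R) (D : set T) :
  measurable D -> (forall i, mu.-integrable D (EFin \o h i)) ->
  mu.-integrable D (EFin \o (fun x => \sum_(i <- s) h i x)).
Proof.
move=> mD ih.
have := @integrable_sum _ _ _ mu D mD I s xpredT (fun i => EFin \o h i).
move=> /(_ (fun i _ => ih i)); congr (_.-integrable _ _).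
by apply/funext => x /=; rewrite sumEFin.
Qed.

Lemma Rintegral_sum (I : Type) (s : seq I) (h : I -> T -> R) (D : set T) :
  measurable D -> (forall i, mu.-integrable D (EFin \o h i)) ->
  \int[mu]_(x in D) (\sum_(i <- s) h i x) =
  \sum_(i <- s) \int[mu]_(x in D) h i x.
Proof.
move=> mD ih; elim: s => [|i s IH].
  rewrite big_nil; under eq_Rintegral do rewrite big_nil.
  by rewrite /Rintegral integral0.
under eq_Rintegral do rewrite big_cons.
rewrite RintegralD//; first by rewrite IH big_cons.
exact: integrable_sumR.
Qed.

Lemma integrable_le (f g : T -> R) : measurable_fun setT f ->
  mu.-integrable setT (EFin \o g) -> (forall x, `|f x| <= g x) ->
  mu.-integrable setT (EFin \o f).
Proof.
move=> mf ig fg; apply: (le_integrable _ _ _ ig) => //.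
  exact/measurable_EFinP.
by move=> x _ /=; rewrite lee_fin (le_trans (fg x))// ler_norm.
Qed.

Lemma EFin_Rintegral (f : T -> R) : mu.-integrable setT (EFin \o f) ->
  (\int[mu]_x f x)%:E = (\int[mu]_x (f x)%:E)%E.
Proof. by move=> fi; rewrite /Rintegral fineK//; exact: integrable_fin_num. Qed.

Lemma ge0_integrable_lty (f : T -> R) : measurable_fun setT f ->
  (forall x, 0 <= f x) -> (\int[mu]_x (f x)%:E < +oo)%E ->
  mu.-integrable setT (EFin \o f).
Proof.
move=> mf f0 fy; apply/integrableP; split; first exact/measurable_EFinP.
by under eq_integral => x _ do rewrite /= ger0_norm//.
Qed.

End integral_tools.

(** k! times the coefficient of l^k in exp(l^2 v / 2), that is (k-1)!! v^(k/2) for even k. *)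
Definition gauss_moment (R : realType) (k : nat) (v : R) : R :=
  if odd k then 0 else k`!%:R * ((v / 2) ^+ k./2 / (k./2)`!%:R).

(** The centred Gaussian law of variance v in a form that treats v = 0 like any other value and adds
    up directly over independent copies. *)
Definition gauss_mgf (d : measure_display) (T : measurableType d)
    (R : realType) (P : probability T R) (X : T -> R) (v : R) : Prop :=
  measurable_fun setT X /\
  forall l : R, (\int[P]_w (expR (l * X w))%:E)%E = (expR (l ^+ 2 * (v / 2)))%:E.

Section gauss_mgf_moments.
Context {d : measure_display} {T : measurableType d} {R : realType}.
Variables (P : probability T R) (X : T -> R) (v : R).
Hypothesis gX : gauss_mgf P X v.

Let mX : measurable_fun setT X. Proof. exact: gX.1. Qed.

Lemma gauss_mgf_integrable_exp (l : R) :
  P.-integrable setT (EFin \o (fun w => expR (l * X w))).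
Proof.
apply: ge0_integrable_lty => [|w|]; [|exact: expR_ge0|by rewrite gX.2 ltry].
by apply: measurableT_comp => //; exact: measurable_funM.
Qed.

(** From x^n <= n! exp x for x >= 0, the integrand is at most n! (exp(2X) + exp(-2X)). It dominates
    the Taylor remainder of exp(lX) at order n, uniformly for 0 < l <= 1. *)
Lemma gauss_mgf_integrable_normX_exp (n : nat) :
  P.-integrable setT (EFin \o (fun w => `|X w| ^+ n * expR `|X w|)).
Proof.
have xn (x : R) : 0 <= x -> x ^+ n <= n`!%:R * expR x.
  move=> x0; rewrite mulrC -ler_pdivrMr ?ltr0n ?fact_gt0//.
  apply: (@le_trans _ _ (series (exp_coeff x) n.+1)).
    by rewrite /series /= big_nat_recr//= lerDr sumr_ge0// => i _; rewrite exp_coeff_ge0.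
  apply: nondecreasing_cvgn_le; last exact: is_cvg_series_exp_coeff.
  by apply: nondecreasing_series => k _ _; exact: exp_coeff_ge0.
apply: (@integrable_le _ _ _ _ _ (fun w => n`!%:R * (expR (2 * X w) + expR (- 2 * X w)))).
- apply: measurable_funM.
    by apply: measurable_funX; exact: measurableT_comp.
  by apply: measurableT_comp => //; exact: measurableT_comp.
- have := @integrableZl _ _ _ P setT measurableT n`!%:R
    (EFin \o (fun w => expR (2 * X w) + expR (- 2 * X w))).
  apply.
  have := integrableD measurableT (gauss_mgf_integrable_exp 2)
    (gauss_mgf_integrable_exp (-2)).
  by [].
- move=> w /=; rewrite ger0_norm ?mulr_ge0 ?exprn_ge0 ?expR_ge0//.
  rewrite (le_trans (ler_wpM2r (expR_ge0 _) (xn _ (normr_ge0 _))))//.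
  rewrite -mulrA -expRD ler_wpM2l// -mulr2n; move: (X w) => y.
  rewrite -[leLHS]/(expR (_ *+ 2)) -[X in expR X <= _]mulr_natl.
  have [x0|x0] := ger0P y.
    by rewrite lerDl expR_ge0.
  by rewrite mulrN -mulNr lerDr expR_ge0.
Qed.

Lemma gauss_mgf_integrableX (n : nat) :
  P.-integrable setT (EFin \o (fun w => X w ^+ n)).
Proof.
apply: (integrable_le (g := fun w => `|X w| ^+ n * expR `|X w|)).
- exact: measurable_funX.
- exact: gauss_mgf_integrable_normX_exp.
- move=> w; rewrite normrX ler_peMr ?exprn_ge0//.
  by rewrite -[leLHS]expR0 ler_expR.
Qed.

(** Both sides of the generating-function identity are expanded in l with remainder O(l^(2n)) on (0,
    1], so their coefficients [a] and [b] agree below order 2n. *)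
Lemma gauss_mgf_moment (k : nat) : \int[P]_w (X w ^+ k) = gauss_moment k v.
Proof.
pose a (j : nat) : R := (\int[P]_w (X w ^+ j)) / j`!%:R.
pose b (j : nat) : R := if odd j then 0 else (v / 2) ^+ j./2 / (j./2)`!%:R.
suff ab : a k - b k = 0.
  move/eqP: ab; rewrite subr_eq0 /a => /eqP ab.
  rewrite /gauss_moment; move: ab; rewrite /b; case: ifP => _ /(canRL (mulfVK _)).
    by rewrite mul0r; apply; rewrite pnatr_eq0 -lt0n fact_gt0.
  by move=> ->; rewrite ?pnatr_eq0 -?lt0n ?fact_gt0// mulrC.
(* The even order 2n exceeds k, and truncating in l at 2n is truncating the exponential series in
   l^2 v / 2 at n terms. *)
pose n := k.+1.
have bE i l : \sum_(j < i.*2) b j * l ^+ j =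
    \sum_(j < i) (l ^+ 2 * (v / 2)) ^+ j / j`!%:R.
  elim: i => [|i IH]; first by rewrite !big_ord0.
  rewrite doubleS !big_ord_recr/= IH /b /= odd_double/= mul0r addr0.
  by rewrite doubleK [(l ^+ 2 * _) ^+ i]exprMn -exprM mul2n; congr (_ + _); rewrite mulrC mulrA.
pose C := \int[P]_w (`|X w| ^+ n.*2 * expR `|X w|) +
  `|v / 2| ^+ n * expR `|v / 2|.
have iX := gauss_mgf_integrableX.
have iXl l j : P.-integrable setT (EFin \o (fun w => (l * X w) ^+ j / j`!%:R)).
  have := @integrableZl _ _ _ P setT measurableT (l ^+ j / j`!%:R)
    (EFin \o (fun w => X w ^+ j)) (iX j).
  by congr (_.-integrable _ _); apply/funext => w /=; rewrite -EFinM exprMn mulrAC.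
apply: (@sum_coef_small R n.*2 (fun j => a j - b j) C); last first.
  by rewrite /n doubleS ltnS -addnn ltnW// ltnS leq_addr.
move=> l l0 l1.
have -> : \sum_(j < n.*2) (a j - b j) * l ^+ j =
   (expR (l ^+ 2 * (v / 2)) - \sum_(j < n.*2) b j * l ^+ j)
   - (\int[P]_w (expR (l * X w)) - \sum_(j < n.*2) a j * l ^+ j).
  rewrite {1}/Rintegral gX.2 /= opprB addrC addrA subrK -sumrB.
  by apply: eq_bigr => j _; rewrite mulrBl.
rewrite (le_trans (ler_normB _ _))// /C mulrDl addrC lerD//.
  have -> : \sum_(j < n.*2) a j * l ^+ j =
      \int[P]_w (\sum_(j < n.*2) (l * X w) ^+ j / j`!%:R).
    rewrite Rintegral_sum//; apply: eq_bigr => j _.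
    rewrite mulrAC -mulrA mulrC -RintegralZl//.
    by apply: eq_Rintegral => w _; rewrite exprMn mulrAC.
  have iE := gauss_mgf_integrable_exp l.
  have iS := @integrable_sumR _ _ _ P _ (index_enum 'I_n.*2)
    (fun j w => (l * X w) ^+ (j : nat) / (j : nat)`!%:R) setT measurableT (fun j => iXl l j).
  rewrite -RintegralB// (le_trans (le_normr_Rintegral _ _))//.
    have := integrableB measurableT iE iS.
    by congr (_.-integrable _ _).
  rewrite mulrC -RintegralZl//; last exact: gauss_mgf_integrable_normX_exp.
  apply: le_Rintegral => //.
  - have := integrable_norm (integrableB measurableT iE iS).
    by congr (_.-integrable _ _).
  - have := integrableZl measurableT (l ^+ n.*2) (gauss_mgf_integrable_normX_exp n.*2).
    by congr (_.-integrable _ _).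
  - move=> w _; rewrite (le_trans (exp_taylor_bound _ _))//.
    rewrite normrM exprMn (gtr0_norm l0) -mulrA ler_wpM2l ?exprn_ge0 ?(ltW l0)//.
    rewrite ler_wpM2l ?exprn_ge0// ler_expR ler_piMl//.
rewrite bE (le_trans (exp_taylor_bound _ _))//.
rewrite normrM exprMn ger0_norm ?exprn_ge0 ?(ltW l0)// -exprM mul2n.
rewrite [leRHS]mulrC -mulrA ler_wpM2l ?exprn_ge0 ?(ltW l0)//.
rewrite ler_wpM2l ?exprn_ge0// ler_expR ler_piMl//.
by rewrite exprn_ile1// ltW.
Qed.

End gauss_mgf_moments.

(** * Layer-cake transfer between measures, and Gaussian laws in generating-function form *)

(** Tonelli on the region under the graph of X. The weight W lets one formula serve both for a
    density and, later, for the product of the other independent factors. *)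
Lemma layer_cake (d : measure_display) (T : measurableType d) (R : realType)
    (mu : {sigma_finite_measure set T -> \bar R}) (X W : T -> R) :
  measurable_fun setT X -> measurable_fun setT W ->
  (forall w, 0 <= X w) -> (forall w, 0 <= W w) ->
  (\int[mu]_w (X w * W w)%:E =
   \int[@lebesgue_measure R]_(s in `[0%R, +oo[)
     \int[mu]_(w in [set w | (s < X w)%R]) (W w)%:E)%E.
Proof.
move=> mX mW X0 W0.
pose GR := measurableTypeR R.
pose A : set (T * GR) := [set p | 0 <= p.2 /\ p.2 < X p.1].
have mA : measurable A.
  rewrite (_ : A = (fun p : T * GR => 0 <= p.2) @^-1` [set true] `&`
      (fun p : T * GR => p.2 < X p.1) @^-1` [set true]); last first.
    by apply/seteqP; split => p /=.
  apply: measurableI.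
  - have : measurable_fun setT (fun p : T * GR => (0 : R) <= p.2).
      exact: measurable_fun_ler.
    by move=> /(_ measurableT [set true]); rewrite setTI; exact.
  - have : measurable_fun setT (fun p : T * GR => (p.2 : R) < X p.1).
      by apply: measurable_fun_ltr => //; exact: measurableT_comp.
    by move=> /(_ measurableT [set true]); rewrite setTI; exact.
have lebX w : @lebesgue_measure R `[0%R, X w[%classic = (X w)%:E.
  rewrite lebesgue_measure_itv/= lte_fin.
  by case: ltgtP (X0 w) => // [_ _|<- _]; rewrite ?oppr0 ?adde0.
transitivity (\int[mu]_w \int[@lebesgue_measure R]_s (\1_A (w, s) * W w)%:E)%E.
  apply: eq_integral => w _.
  transitivity (\int[@lebesgue_measure R]_s ((\1_`[0%R, X w[ s)%:E * (W w)%:E))%E; last first.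
    apply: eq_integral => s _; rewrite -EFinM; congr ((_ * _)%:E).
    by rewrite !indicE; congr (nat_of_bool _)%:R; apply/idP/idP; rewrite !inE/= in_itv/= => /andP.
  rewrite ge0_integralZr//=.
  - by rewrite integral_indic// setIT EFinM -lebX.
  - exact/measurable_EFinP/measurable_indic.
  - by rewrite lee_fin.
rewrite (fubini_tonelli (fun p : T * GR => (\1_A p * W p.1)%:E))//=; last 2 first.
- apply/measurable_EFinP/measurable_funM; first exact: measurable_indic.
  exact: measurableT_comp.
- by move=> p; rewrite lee_fin mulr_ge0.
rewrite [RHS]integral_mkcond; apply: eq_integral => s _.
rewrite patchE; case: ifPn => [|].
  rewrite inE/= in_itv/= andbT => s0.
  rewrite [RHS]integral_mkcond; apply: eq_integral => w _.
  rewrite patchE indicE; case: ifPn => [|]; rewrite ?inE ?notin_setE/= => h.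
    by rewrite mem_set ?mul1r.
  by rewrite memNset ?mul0r// => -[].
rewrite notin_setE/= in_itv/= andbT => /negP s0.
rewrite integral0_eq// => w _; rewrite indicE memNset ?mul0r//.
by move=> -[/=]; move/negP : s0.
Qed.

Lemma eq_layer_integral (d1 d2 : measure_display) (T1 : measurableType d1)
    (T2 : measurableType d2) (R : realType)
    (mu1 : {sigma_finite_measure set T1 -> \bar R})
    (mu2 : {sigma_finite_measure set T2 -> \bar R})
    (X1 W1 : T1 -> R) (X2 W2 : T2 -> R) :
  measurable_fun setT X1 -> measurable_fun setT W1 ->
  measurable_fun setT X2 -> measurable_fun setT W2 ->
  (forall w, 0 <= X1 w) -> (forall w, 0 <= W1 w) ->
  (forall w, 0 <= X2 w) -> (forall w, 0 <= W2 w) ->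
  (forall s, (0 <= s)%R -> \int[mu1]_(w in [set w | (s < X1 w)%R]) (W1 w)%:E =
            \int[mu2]_(w in [set w | (s < X2 w)%R]) (W2 w)%:E)%E ->
  (\int[mu1]_w (X1 w * W1 w)%:E = \int[mu2]_w (X2 w * W2 w)%:E)%E.
Proof.
move=> mX1 mW1 mX2 mW2 X10 W10 X20 W20 h; rewrite !layer_cake//.
by apply: eq_integral => s; rewrite inE/= in_itv/= andbT => s0; exact: h.
Qed.

Section gaussian_rv_mgf.
Context {d : measure_display} {T : measurableType d} {R : realType}.
Variable P : probability T R.

Lemma measurable_gtr_set (X : T -> R) (s : R) :
  measurable_fun setT X -> measurable [set w | s < X w].
Proof.
move=> mX; have : measurable_fun setT (fun w => s < X w).
  exact: measurable_fun_ltr.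
by move=> /(_ measurableT [set true]); rewrite setTI; exact.
Qed.

Lemma normal_law_mgf (X : T -> R) (m s : R) : measurable_fun setT X ->
  (forall B, measurable B -> P (X @^-1` B) = normal_law m s B) ->
  forall l, (\int[P]_w (expR (l * X w))%:E =
    (expR (l * m + l ^+ 2 * (s ^+ 2 / 2)))%:E)%E.
Proof.
move=> mX lawX l.
have mE : measurable_fun setT (fun x : R => expR (l * x)).
  by apply: measurableT_comp => //; exact: measurable_funM.
have mEX : measurable_fun setT (fun w => expR (l * X w)).
  exact: (measurableT_comp mE mX).
transitivity (\int[P]_w (expR (l * X w) * 1)%:E)%E.
  by apply: eq_integral => w _; rewrite mulr1.
have PX r : (\int[P]_(w in [set w | (r < expR (l * X w))%R]) 1%:E =
    normal_law m s [set x | (r < expR (l * x))%R])%E.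
  rewrite integral_cst ?mul1e; last exact: measurable_gtr_set.
  rewrite -lawX//; have : measurable_fun setT (fun x : R => r < expR (l * x)).
    exact: measurable_fun_ltr.
  by move=> /(_ measurableT [set true]); rewrite setTI; exact.
have [s0|s0] := eqVneq s 0.
  (* A Dirac mass at m gives superlevel sets the same probabilities as the constant variable exp(l
     m) on the same space. *)
  rewrite (@eq_layer_integral _ _ _ _ _ P P _ (cst 1)
    (cst (expR (l * m))) (cst 1))//.
  - rewrite (eq_integral (cst (expR (l * m))%:E)) => [|w _]; last by rewrite mulr1.
    rewrite integral_cst//= probability_setT mule1.
    by rewrite s0 expr0n/= mul0r mulr0 addr0.
  - by move=> w; exact: expR_ge0.
  - move=> r r0; rewrite [LHS]PX /normal_law s0 eqxx.
    transitivity (P [set w : T | r < expR (l * m)]); last first.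
      by rewrite /= integral_cst ?mul1e//; exact: measurable_gtr_set.
    rewrite diracE; case: (ltP r (expR (l * m))) => h.
      rewrite mem_set//= -[LHS](@probability_setT _ _ _ P); congr (P _).
      by apply/seteqP; split.
    rewrite memNset/= ?ltNge ?h// -[LHS](@measure0 _ _ _ P); congr (P _).
    by apply/seteqP; split.
rewrite (@eq_layer_integral _ _ _ (measurableTypeR R) _ P (@lebesgue_measure R)
   _ (cst 1) (fun x => expR (l * x)) (normal_pdf m s))//.
(* Completing the square: tilting the density by exp(l x) shifts its mean by l s^2 and leaves the
   generating function as a factor. *)
- transitivity (\int[@lebesgue_measure R]_x ((expR (l * m + l ^+ 2 * (s ^+ 2 / 2)))%:E *
     (normal_pdf (m + l * s ^+ 2) s x)%:E))%E.
    apply: eq_integral => x _; rewrite -EFinM !normal_pdfE//; congr EFin.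
    rewrite mulrCA [RHS]mulrCA; congr *%R; rewrite /normal_fun -!expRD; congr expR.
    by field.
  rewrite ge0_integralZl_EFin//=.
  - by rewrite integral_normal_pdf mule1.
  - by move=> x _; rewrite lee_fin normal_pdf_ge0.
  - by apply/measurable_EFinP; exact: measurable_normal_pdf.
- exact: measurable_normal_pdf.
- by move=> w; rewrite normal_pdf_ge0.
- by move=> r r0; rewrite [LHS]PX /normal_law (negbTE s0).
Qed.

Lemma gaussian_rv_integrable (X : T -> R) : gaussian_rv P X ->
  P.-integrable setT (EFin \o X).
Proof.
move=> [mX [m [s lawX]]]; have mgf := normal_law_mgf mX lawX.
have iE l : P.-integrable setT (EFin \o (fun w => expR (l * X w))).
  apply: ge0_integrable_lty => [|w|]; [|exact: expR_ge0|by rewrite mgf ltry].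
  by apply: measurableT_comp => //; exact: measurable_funM.
apply: (integrable_le (g := fun w => expR (1 * X w) + expR (- 1 * X w))) => //.
  have := integrableD measurableT (iE 1) (iE (-1)).
  by congr (_.-integrable _ _).
move=> w; have := expR_ge1Dx (1 * X w); have := expR_ge1Dx (-1 * X w).
have := expR_ge0 (1 * X w); have := expR_ge0 (-1 * X w).
by have [] := ger0P (X w); lra.
Qed.

(** The parameters of the law are only known to exist. Convexity gives E exp(lX) >= 1 + l E X = 1,
    so l m + l^2 s^2 / 2 >= 0 for every l, which forces m = 0; the second moment then identifies
    s^2. *)
Lemma gaussian_rv_gauss_mgf (X : T -> R) : gaussian_rv P X ->
  \int[P]_w X w = 0 -> gauss_mgf P X (\int[P]_w (X w ^+ 2)).
Proof.
move=> gX EX0; have iX := gaussian_rv_integrable gX.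
have [mX [m [s lawX]]] := gX; have mgf := normal_law_mgf mX lawX.
have m0 l : 0 <= l * m + l ^+ 2 * (s ^+ 2 / 2).
  rewrite -ler_expR expR0 -lee_fin -mgf.
  have i1 : P.-integrable setT (EFin \o cst 1) by exact: finite_measure_integrable_cst.
  have ilX : P.-integrable setT (EFin \o (fun w => l * X w)).
    have := integrableZl measurableT l iX.
    by congr (_.-integrable _ _).
  have <- : (\int[P]_w (1 + l * X w)%:E = 1%:E)%E.
    rewrite integralD_EFin// integral_cst//= probability_setT mul1e.
    rewrite -EFin_Rintegral// RintegralZl// EX0 mulr0.
    by rewrite adde0.
  apply: le_integral => //.
  - have := integrableD measurableT i1 ilX.
    by congr (_.-integrable _ _).
  - apply: ge0_integrable_lty => [|w|]; [|exact: expR_ge0|by rewrite mgf ltry].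
    by apply: measurableT_comp => //; exact: measurable_funM.
  - by move=> w _; rewrite lee_fin expR_ge1Dx.
have {}m0 : m = 0.
  set c := s ^+ 2 / 2 in m0; have c1 : 0 < c + 1 by have := sqr_ge0 s; rewrite /c; lra.
  (* At this l the form equals -(m/(c+1))^2; dividing by c + 1 rather than c covers s = 0. *)
  have := m0 (- m / (c + 1)).
  rewrite (_ : _ + _ = - (m / (c + 1)) ^+ 2); last by field; rewrite gt_eqF.
  rewrite oppr_ge0 => h; have /eqP : (m / (c + 1)) ^+ 2 = 0 by apply/eqP; rewrite eq_le h sqr_ge0.
  by rewrite sqrf_eq0 mulf_eq0 invr_eq0 (gt_eqF c1) orbF => /eqP.
have gXs : gauss_mgf P X (s ^+ 2).
  by split=> // l; rewrite mgf m0 mulr0 add0r.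
by rewrite (gauss_mgf_moment gXs) /gauss_moment /= expr1 divr1 mulrC divfK.
Qed.

End gaussian_rv_mgf.

(** * Mixed Gaussian moments and decoupling *)

(** Polarization writes the product as a combination of powers of sums, each a Gaussian combination
    whose coefficients count how often an index is hit. The value involves [q] alone, so families
    with the same [q] share all mixed moments, with no mention of a joint law. *)
Lemma gauss_mixed_moment (d : measure_display) (T : measurableType d)
    (R : realType) (P : probability T R) (I : finType) (X : I -> T -> R)
    (q : (I -> R) -> R) :
  (forall c, gauss_mgf P (fun w => \sum_i c i * X i w) (q c)) ->
  forall (J : finType) (s : J -> I),
  P.-integrable setT (EFin \o (fun w => \prod_l X (s l) w)) /\
  \int[P]_w (\prod_l X (s l) w) =
  ((#|J|)`!%:R)^-1 * \sum_(S : {set J}) (-1) ^+ #|~: S| *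
     gauss_moment #|J| (q (fun i => \sum_(l in S | s l == i) 1)).
Proof.
move=> gX J s; pose c (S : {set J}) i : R := \sum_(l in S | s l == i) 1.
have prodE w : \prod_l X (s l) w = ((#|J|)`!%:R)^-1 * \sum_(S : {set J})
    (-1) ^+ #|~: S| * (\sum_i c S i * X i w) ^+ #|J|.
  have fn0 : ((#|J|)`!%:R : R) != 0 by rewrite pnatr_eq0 -lt0n fact_gt0.
  apply: (mulfI fn0); rewrite mulrA mulfV// mul1r -polarization.
  apply: eq_bigr => S _; congr (_ * _ ^+ _).
  rewrite (partition_big s xpredT)//=; apply: eq_bigr => i _.
  by rewrite mulr_suml; apply: eq_bigr => l /andP[_ /eqP ->]; rewrite mul1r.
have iS S : P.-integrable setT (EFin \o (fun w =>
    (-1) ^+ #|~: S| * (\sum_i c S i * X i w) ^+ #|J|)).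
  have := integrableZl measurableT ((-1) ^+ #|~: S|)
    (gauss_mgf_integrableX (gX (c S)) #|J|).
  by congr (_.-integrable _ _).
have iSS := @integrable_sumR _ _ _ P _ (index_enum {set J}) _ setT measurableT iS.
rewrite (funext prodE).
split.
  have := integrableZl measurableT ((#|J|)`!%:R)^-1 iSS.
  by congr (_.-integrable _ _).
rewrite RintegralZl// Rintegral_sum//; congr (_ * _); apply: eq_bigr => S _.
rewrite RintegralZl//; last exact: gauss_mgf_integrableX (gX _) _.
by rewrite (gauss_mgf_moment (gX _)).
Qed.

Lemma gauss_mgf_prod (d1 d2 : measure_display) (T1 : measurableType d1)
    (T2 : measurableType d2) (R : realType) (P1 : probability T1 R)
    (P2 : probability T2 R) (X : T1 -> R) (Y : T2 -> R) (a b : R) :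
  gauss_mgf P1 X a -> gauss_mgf P2 Y b ->
  gauss_mgf (P1 \x P2)%E (fun p => X p.1 + Y p.2) (a + b).
Proof.
move=> [mX hX] [mY hY]; split.
  by apply: measurable_funD; exact: measurableT_comp.
move=> l.
have mE : measurable_fun setT (fun p : T1 * T2 => expR (l * (X p.1 + Y p.2))).
  apply: measurableT_comp => //; apply: measurable_funM => //.
  by apply: measurable_funD; exact: measurableT_comp.
rewrite fubini_tonelli1/=; last 2 first.
- exact/measurable_EFinP.
- by move=> p; rewrite lee_fin expR_ge0.
rewrite /fubini_F/=.
have h x : (\int[P2]_y (expR (l * (X x + Y y)))%:E =
   (expR (l * X x))%:E * (expR (l ^+ 2 * (b / 2)))%:E)%E.
  rewrite -hY -ge0_integralZl_EFin//=; last first.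
    by apply/measurable_EFinP; apply: measurableT_comp => //; exact: measurable_funM.
  by apply: eq_integral => y _; rewrite mulrDr expRD EFinM.
under eq_integral do rewrite h.
rewrite ge0_integralZr//=.
- by rewrite hX -EFinM -expRD; congr (expR _)%:E; ring.
- by apply/measurable_EFinP; apply: measurableT_comp => //; exact: measurable_funM.
Qed.

Section decoupling.
Context {d : measure_display} {T : measurableType d} {R : realType}.
Variables (P : probability T R) (I : finType) (v : I -> T -> R).
Variables (S A : I -> I -> R).

Definition quad_form (B : I -> I -> R) (c e : I -> R) : R :=
  \sum_i \sum_j B i j * (c i * e j).

(** Left and right factors are gathered in one product over ['I_k + 'I_k], the shape that
    [gauss_mixed_moment] takes. *)
Lemma bilinear_power (x y : I -> R) (k : nat) :
  quad_form A x y ^+ k = \sum_(h : {ffun 'I_k -> I * I})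
    (\prod_l A (h l).1 (h l).2) *
    \prod_(l : 'I_k + 'I_k) (match l with inl l => x (h l).1 | inr l => y (h l).2 end).
Proof.
rewrite /quad_form pair_big /= -[k in LHS]card_ord -prodr_const.
rewrite (bigA_distr_bigA (fun=> _)) /=; apply: eq_bigr => h _.
by rewrite big_sumType /= -!big_split/=; apply: eq_bigr => l _.
Qed.

Hypothesis gv : forall c : I -> R,
  gauss_mgf P (fun w => \sum_i c i * v i w) (quad_form S c c).
Hypothesis symA : forall i j, A i j = A j i.

Let Q (w : T) := quad_form A (v ^~ w) (v ^~ w).
Let W (p : T * T) := quad_form A (v ^~ p.1) (v ^~ p.2).

(** [Y] is [X] rotated by 45 degrees: its halves are v - v' and v + v'. The rotation preserves the
    form [q]. *)
Let X (k : I + I) (p : T * T) : R := match k with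
  inl i => Num.sqrt 2 * v i p.1 | inr i => Num.sqrt 2 * v i p.2 end.
Let Y (k : I + I) (p : T * T) : R := match k with
  inl i => v i p.1 - v i p.2 | inr i => v i p.1 + v i p.2 end.
Let q (c : I + I -> R) : R :=
  2 * quad_form S (c \o inl) (c \o inl) + 2 * quad_form S (c \o inr) (c \o inr).

Let gX (c : I + I -> R) :
  gauss_mgf (P \x P)%E (fun p => \sum_k c k * X k p) (q c).
Proof.
have -> : (fun p => \sum_k c k * X k p) = (fun p : T * T =>
   \sum_i (Num.sqrt 2 * c (inl i)) * v i p.1 +
   \sum_i (Num.sqrt 2 * c (inr i)) * v i p.2).
  by apply/funext => p; rewrite big_sumType /=; congr (_ + _); apply: eq_bigr => i _; rewrite mulrCA mulrA.
have := gauss_mgf_prod (gv (fun i => Num.sqrt 2 * c (inl i)))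
  (gv (fun i => Num.sqrt 2 * c (inr i))).
congr (gauss_mgf _ _ _); rewrite /q /quad_form !mulr_sumr.
have s2 : Num.sqrt 2 ^+ 2 = 2 :> R by rewrite sqr_sqrtr.
congr (_ + _); apply: eq_bigr => i _; rewrite mulr_sumr; apply: eq_bigr => j _.
- rewrite /= -[in RHS]s2; ring.
- rewrite /= -[in RHS]s2; ring.
Qed.

Let gY (c : I + I -> R) :
  gauss_mgf (P \x P)%E (fun p => \sum_k c k * Y k p) (q c).
Proof.
have -> : (fun p => \sum_k c k * Y k p) = (fun p : T * T =>
   \sum_i (c (inl i) + c (inr i)) * v i p.1 +
   \sum_i (c (inr i) - c (inl i)) * v i p.2).
  apply/funext => p; rewrite big_sumType /= -!big_split/=.
  by apply: eq_bigr => i _; ring.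
have := gauss_mgf_prod (gv (fun i => c (inl i) + c (inr i)))
  (gv (fun i => c (inr i) - c (inl i))).
congr (gauss_mgf _ _ _); rewrite /q /quad_form !mulr_sumr -!big_split/=.
apply: eq_bigr => i _; rewrite !mulr_sumr -!big_split/=.
by apply: eq_bigr => j _; ring.
Qed.

Lemma decoupling (k : nat) :
  (P \x P)%E.-integrable setT (EFin \o (fun p => (Q p.1 - Q p.2) ^+ k)) /\
  \int[(P \x P)%E]_p ((Q p.1 - Q p.2) ^+ k) =
  \int[(P \x P)%E]_p ((2 * W p) ^+ k).
Proof.
have QE p : Q p.1 - Q p.2 = quad_form A (fun i => Y (inl i) p) (fun i => Y (inr i) p).
  rewrite /Q /quad_form -sumrB.
  have -> : \sum_i \sum_j A i j * (Y (inl i) p * Y (inr j) p) =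
    \sum_i (\sum_j A i j * (v i p.1 * v j p.1) - \sum_j A i j * (v i p.2 * v j p.2)) +
    (\sum_i \sum_j A i j * (v i p.1 * v j p.2) - \sum_i \sum_j A i j * (v i p.2 * v j p.1)).
    rewrite -sumrB -big_split/=; apply: eq_bigr => i _; rewrite -!sumrB -big_split/=.
    by apply: eq_bigr => j _; ring.
  (* The cross terms v^T A v' and v'^T A v cancel because A is symmetric. *)
  rewrite [X in _ = _ + X](_ : _ = 0) ?addr0//.
  rewrite [X in _ - X]exchange_big/= -sumrB big1// => i _.
  by rewrite -sumrB big1// => j _; rewrite (symA j i); ring.
have WE p : 2 * W p = quad_form A (fun i => X (inl i) p) (fun i => X (inr i) p).
  rewrite /W /quad_form mulr_sumr; apply: eq_bigr => i _; rewrite mulr_sumr.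
  apply: eq_bigr => j _; rewrite -[in LHS](@sqr_sqrtr R 2)//= ; ring.
pose s (h : {ffun 'I_k -> I * I}) (l : 'I_k + 'I_k) : I + I :=
  match l with inl l => inl (h l).1 | inr l => inr (h l).2 end.
have expand (Z : I + I -> T * T -> R) p :
    quad_form A (fun i => Z (inl i) p) (fun i => Z (inr i) p) ^+ k =
    \sum_(h : {ffun 'I_k -> I * I})
      (\prod_l A (h l).1 (h l).2) * \prod_l Z (s h l) p.
  by rewrite bilinear_power; apply: eq_bigr => h _; congr (_ * _); apply: eq_bigr; case.
have mom (Z : I + I -> T * T -> R) :
    (forall c, gauss_mgf (P \x P)%E (fun p => \sum_k c k * Z k p) (q c)) ->
    (P \x P)%E.-integrable setT (EFin \o (fun p =>
      quad_form A (fun i => Z (inl i) p) (fun i => Z (inr i) p) ^+ k)) /\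
    \int[(P \x P)%E]_p (quad_form A (fun i => Z (inl i) p) (fun i => Z (inr i) p) ^+ k) =
    \sum_(h : {ffun 'I_k -> I * I}) (\prod_l A (h l).1 (h l).2) *
      (((#|{: 'I_k + 'I_k}|)`!%:R)^-1 * \sum_(U : {set 'I_k + 'I_k}) (-1) ^+ #|~: U| *
     gauss_moment #|{: 'I_k + 'I_k}| (q (fun i => \sum_(l in U | s h l == i) 1))).
  move=> gZ; rewrite (funext (expand Z)).
  have ih (h : {ffun 'I_k -> I * I}) : (P \x P)%E.-integrable setT (EFin \o (fun p =>
      (\prod_l A (h l).1 (h l).2) * \prod_l Z (s h l) p)).
    have := integrableZl measurableT (\prod_l A (h l).1 (h l).2)
      (gauss_mixed_moment gZ (s h)).1.
    by congr (_.-integrable _ _).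
  split; first exact: integrable_sumR.
  rewrite Rintegral_sum//; apply: eq_bigr => h _.
  have [iZ eZ] := gauss_mixed_moment gZ (s h).
  by rewrite RintegralZl// eZ.
rewrite (funext (fun p => congr1 (fun y : R => y ^+ k) (QE p))).
rewrite (funext (fun p => congr1 (fun y : R => y ^+ k) (WE p))) /=.
by have [i1 e1] := mom _ gY; have [i2 e2] := mom _ gX; split=> //; rewrite e1 e2.
Qed.

End decoupling.

(** * Moments and exponential moments of a Gaussian quadratic form *)

(** By convexity y^(n+1) lies above its tangent at m. This is the pointwise form of the weighted
    Jensen inequality below. *)
Lemma power_tangent (R : realFieldType) (y m : R) (n : nat) :
  0 <= y -> 0 <= m -> n.+1%:R * m ^+ n * y <= y ^+ n.+1 + n%:R * m ^+ n.+1.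
Proof.
move=> y0 m0; elim: n => [|n IH].
  by rewrite expr0 mulr1 mul1r mul0r addr0 expr1.
(* The next gap is y times the previous one plus (n+1) m^n (y - m)^2. *)
rewrite -subr_ge0; apply: (@le_trans _ _
  (y * (y ^+ n.+1 + n%:R * m ^+ n.+1 - n.+1%:R * m ^+ n * y) +
   n.+1%:R * m ^+ n * (y - m) ^+ 2)).
  by rewrite addr_ge0// mulr_ge0 ?subr_ge0 ?sqr_ge0// mulr_ge0// exprn_ge0.
rewrite le_eqVlt; apply/orP; left; apply/eqP.
by rewrite !exprS -!natr1; ring.
Qed.

(** The central binomial coefficient is at most 4^k. It turns the squared Gaussian moments of the
    decoupled form into (2k)! times a power, so that the exponential series becomes geometric. *)
Lemma fact_double_le (k : nat) : ((k.*2)`! <= k`! ^ 2 * 4 ^ k)%N.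
Proof.
elim: k => // k IH; rewrite doubleS !factS expnMn expnS.
have : ((k.*2.+2 * k.*2.+1) * (k.*2)`! <= k.+1 ^ 2 * 4 * (k`! ^ 2 * 4 ^ k))%N.
  by apply: leq_mul => //; nia.
by rewrite -mulnA => /leq_trans; apply; rewrite mulnACA ?expnS ?expn1 ?expn0 ?muln1 ?mulnA.
Qed.

Section quadratic_moment.
Context {d : measure_display} {T : measurableType d} {R : realType}.
Variables (P : probability T R) (I : finType) (v : I -> T -> R).
Variables (S A : I -> I -> R).
Hypothesis gv : forall c : I -> R,
  gauss_mgf P (fun w => \sum_i c i * v i w) (quad_form S c c).
Hypothesis symA : forall i j, A i j = A j i.

Let Q (w : T) := quad_form A (v ^~ w) (v ^~ w).
Let W (w1 w2 : T) := quad_form A (v ^~ w1) (v ^~ w2).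
Let Av (w : T) (i : I) := \sum_j A i j * v j w.
(** The variance of [W] when its other argument is frozen at w, that is v^T A S A v; its mean is
    tr(ASAS). *)
Let tau (w : T) := quad_form S (Av w) (Av w).
Let G (k : nat) : R := (k.*2)`!%:R / (k`!%:R * 2 ^+ k).

Let gauss_moment_double k (x : R) : gauss_moment k.*2 x = G k * x ^+ k.
Proof.
rewrite /gauss_moment odd_double doubleK /G expr_div_n.
by rewrite invfM !mulrA -!mulrA; congr (_ * _); rewrite mulrC -!mulrA [LHS]mulrCA; congr (_ * _); rewrite mulrC.
Qed.

Let WC w1 w2 : W w1 w2 = W w2 w1.
Proof.
rewrite /W /quad_form exchange_big; apply: eq_bigr => i _; apply: eq_bigr => j _.
by rewrite symA [v j w1 * _]mulrC.
Qed.

Let gW w2 : gauss_mgf P (W ^~ w2) (tau w2).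
Proof.
have -> : W ^~ w2 = fun w => \sum_i Av w2 i * v i w; last exact: gv.
apply/funext => w; rewrite /W /quad_form; apply: eq_bigr => i _.
by rewrite mulr_suml; apply: eq_bigr => j _; ring.
Qed.

Let mv i : measurable_fun setT (v i).
Proof.
have [m _] := gv (fun j => (j == i)%:R).
have -> // : v i = fun w => \sum_j (j == i)%:R * v j w.
apply/funext => w; rewrite (bigD1 i)//= eqxx mul1r big1 ?addr0//.
by move=> j /negbTE ->; rewrite mul0r.
Qed.

Let mAv i : measurable_fun setT (Av ^~ i).
Proof. by apply: measurable_sum => j; exact: measurable_funM. Qed.

Let mtau : measurable_fun setT tau.
Proof.
apply: measurable_sum => i; apply: measurable_sum => j.
by apply: measurable_funM => //; exact: measurable_funM.
Qed.

Let mQ : measurable_fun setT Q.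
Proof.
apply: measurable_sum => i; apply: measurable_sum => j.
by apply: measurable_funM => //; exact: measurable_funM.
Qed.

Let mW : measurable_fun setT (fun p : T * T => W p.1 p.2).
Proof.
apply: measurable_sum => i; apply: measurable_sum => j.
apply: measurable_funM => //; apply: measurable_funM => //.
  exact: (measurableT_comp (mv i) measurable_fst).
exact: (measurableT_comp (mv j) measurable_snd).
Qed.

Let tau_ge0 w : 0 <= tau w.
Proof.
have := gauss_mgf_moment (gW w) 2; rewrite /gauss_moment/= expr1 divr1.
rewrite mulrC divfK// => <-.
by apply: Rintegral_ge0 => w1 _; exact: sqr_ge0.
Qed.

Let G_ge0 k : 0 <= G k.
Proof. by rewrite /G divr_ge0// mulr_ge0// exprn_ge0. Qed.

Let EW k w2 : \int[P]_w (W w w2 ^+ k.*2) = G k * tau w2 ^+ k.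
Proof. by rewrite (gauss_mgf_moment (gW w2)) gauss_moment_double. Qed.

Let integrable_mixed2 i j : P.-integrable setT (EFin \o (fun w => v i w * v j w)).
Proof.
have [] := @gauss_mixed_moment _ _ _ P _ v (fun c => quad_form S c c) gv
  'I_2 (fun l => if l == ord0 then i else j).
move=> + _; congr (_.-integrable _ _); apply/funext => w /=.
by rewrite !big_ord_recl big_ord0 /= mulr1.
Qed.

Let integrable_Q (B : I -> I -> R) :
  P.-integrable setT (EFin \o (fun w => quad_form B (v ^~ w) (v ^~ w))).
Proof.
apply: integrable_sumR => // i; apply: integrable_sumR => // j.
have := integrableZl measurableT (B i j) (integrable_mixed2 i j).
by congr (_.-integrable _ _).
Qed.

Let tauE : tau = fun w => quad_form
  (fun j j' => \sum_i \sum_i' S i i' * (A i j * A i' j')) (v ^~ w) (v ^~ w).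
Proof.
apply/funext => w; rewrite /tau /quad_form.
transitivity (\sum_i \sum_i' \sum_j \sum_j'
   S i i' * (A i j * A i' j') * (v j w * v j' w)).
  apply: eq_bigr => i _; apply: eq_bigr => i' _.
  rewrite /Av mulr_suml mulr_sumr; apply: eq_bigr => j _.
  by rewrite !mulr_sumr; apply: eq_bigr => j' _; ring.
under eq_bigr do rewrite exchange_big/=.
rewrite exchange_big/=; apply: eq_bigr => j _.
under eq_bigr do rewrite exchange_big/=.
rewrite exchange_big/=; apply: eq_bigr => j' _.
by rewrite mulr_suml; apply: eq_bigr => i _; rewrite mulr_suml.
Qed.

Let integrable_tau : P.-integrable setT (EFin \o tau).
Proof. rewrite tauE; exact: integrable_Q. Qed.

Variable F2 : R.
Hypothesis F2_gt : \int[P]_w tau w < F2.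

Let F2_gt0 : 0 < F2.
Proof. by apply: le_lt_trans F2_gt; exact: Rintegral_ge0. Qed.

(** A probability density comparable to tau. The strict gap between F2 and the mean of tau keeps it
    away from 0, so its inverse powers are bounded; it also satisfies tau <= F2 lam. *)
Let lam w := (tau w + (F2 - \int[P]_w tau w)) / F2.

Let lam_gt0 w : 0 < lam w.
Proof. by rewrite divr_gt0// ltr_wpDl// subr_gt0. Qed.

Let mlam : measurable_fun setT lam.
Proof. by apply: measurable_funM => //; exact: measurable_funD. Qed.

Let mlamV : measurable_fun setT (fun w => (lam w)^-1).
Proof.
have -> : (fun w => (lam w)^-1) = fun w => expR (- ln (lam w)).
  by apply/funext => w; rewrite expRN lnK ?posrE.
apply: measurableT_comp => //; apply: measurableT_comp => //.
exact: (measurableT_comp (@measurable_ln R) mlam).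
Qed.

Let integrable_lam : P.-integrable setT (EFin \o lam).
Proof.
have i1 : P.-integrable setT (EFin \o cst (F2 - \int[P]_w tau w)).
  exact: finite_measure_integrable_cst.
have := integrableZl measurableT F2^-1 (integrableD measurableT integrable_tau i1).
by congr (_.-integrable _ _); apply/funext => w /=; rewrite -EFinD -EFinM mulrC.
Qed.

Let int_lam : \int[P]_w lam w = 1.
Proof.
have i1 : P.-integrable setT (EFin \o cst (F2 - \int[P]_w tau w)).
  exact: finite_measure_integrable_cst.
have i2 := integrableD measurableT integrable_tau i1.
rewrite /lam RintegralZr//.
have P1 : fine (P setT) = 1 by rewrite probability_setT.
rewrite RintegralD// Rintegral_cst// P1 mulr1.
by rewrite addrC subrK mulfV// gt_eqF.
Qed.

Let integrable_lamW n w2 : P.-integrable setT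
  (EFin \o (fun w => (lam w)^-1 ^+ n * W w w2 ^+ n.+1.*2)).
Proof.
pose C := F2 / (F2 - \int[P]_w tau w).
apply: (integrable_le (g := fun w => C ^+ n * W w w2 ^+ n.+1.*2)).
- by apply: measurable_funM; apply: measurable_funX => //; exact: (gW w2).1.
- have := integrableZl measurableT (C ^+ n) (gauss_mgf_integrableX (gW w2) n.+1.*2).
  by congr (_.-integrable _ _).
- move=> w; have W0 : 0 <= W w w2 ^+ n.+1.*2 by rewrite exprn_even_ge0// odd_double.
  rewrite ger0_norm; last by rewrite mulr_ge0// exprn_ge0// invr_ge0 ltW.
  rewrite ler_wpM2r// lerXn2r// ?nnegrE ?invr_ge0 ?(ltW (lam_gt0 _))//.
    by rewrite divr_ge0 ?(ltW F2_gt0)// subr_ge0 ltW.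
  rewrite /lam invf_div ler_wpM2l ?(ltW F2_gt0)//.
  have e0 : 0 < F2 - \int[P]_w tau w by rewrite subr_gt0.
  have e1 : 0 < tau w + (F2 - \int[P]_w tau w) by rewrite ltr_wpDl.
  by rewrite lef_pV2 ?posrE// lerDr.
Qed.

(** Since tau w2 is the mean of W^2, write W^2 = lam (W^2 / lam) and apply Jensen for the density
    [lam]. With weight 1 the bound would return a multiple of tau w2^(n+1), hence no information. *)
Let jensen n w2 : tau w2 ^+ n.+1 <=
  \int[P]_w ((lam w)^-1 ^+ n * W w w2 ^+ n.+1.*2).
Proof.
set m := tau w2; have m0 : 0 <= m by exact: tau_ge0.
have iW2 : P.-integrable setT (EFin \o (fun w => n.+1%:R * m ^+ n * W w w2 ^+ 2)).
  have := integrableZl measurableT (n.+1%:R * m ^+ n) (gauss_mgf_integrableX (gW w2) 2).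
  by congr (_.-integrable _ _).
have il : P.-integrable setT (EFin \o (fun w => n%:R * m ^+ n.+1 * lam w)).
  have := integrableZl measurableT (n%:R * m ^+ n.+1) integrable_lam.
  by congr (_.-integrable _ _).
have : \int[P]_w (n.+1%:R * m ^+ n * W w w2 ^+ 2) <=
   \int[P]_w ((lam w)^-1 ^+ n * W w w2 ^+ n.+1.*2 + n%:R * m ^+ n.+1 * lam w).
  apply: le_Rintegral => //.
    have := integrableD measurableT (integrable_lamW n w2) il.
    by congr (_.-integrable _ _).
  move=> w _; have l0 := lam_gt0 w.
  (* The tangent inequality at m = tau w2 for y = W^2 / lam, multiplied by lam and integrated. *)
  have := power_tangent n (divr_ge0 (sqr_ge0 (W w w2)) (ltW l0)) m0.
  rewrite -(ler_pM2l l0); congr (_ <= _).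
    by field; rewrite gt_eqF.
  rewrite exprMn -exprM mul2n [_^-1 ^+ n.+1]exprS.
  by move: (_^-1 ^+ n) (W w w2 ^+ _) => x y; field; rewrite gt_eqF.
rewrite RintegralZl//; last exact: gauss_mgf_integrableX (gW w2) 2.
rewrite (RintegralD measurableT (integrable_lamW n w2) il).
rewrite RintegralZl// int_lam mulr1 (EW 1) expr1 -/m.
have -> : G 1 = 1.
  by rewrite /G (_ : (1.*2)`! = 2)%N// (_ : 1`! = 1)%N// mul1r expr1 divff// pnatr_eq0.
by rewrite mul1r -mulrA -exprSr -natr1 mulrDl mul1r addrC lerD2r.
Qed.

Let ge0_int_lamW n w : (0 <= (lam w)^-1 ^+ n)%R.
Proof. by rewrite exprn_ge0// invr_ge0 ltW. Qed.

Let W_even_ge0 k w1 w2 : 0 <= W w1 w2 ^+ k.*2.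
Proof. by rewrite exprn_even_ge0// odd_double. Qed.

Let EWe k w2 : (\int[P]_w (W w w2 ^+ k.*2)%:E = (G k * tau w2 ^+ k)%:E)%E.
Proof. by rewrite -EW EFin_Rintegral//; exact: gauss_mgf_integrableX (gW w2) _. Qed.

Let mlamW n : measurable_fun setT
  (fun p : T * T => ((lam p.1)^-1 ^+ n * W p.1 p.2 ^+ n.+1.*2)%:E).
Proof.
apply/measurable_EFinP; apply: measurable_funM; last exact: measurable_funX.
by apply: measurable_funX; exact: (measurableT_comp mlamV measurable_fst).
Qed.

Let lamW_ge0 n (p : T * T) :
  (0 <= ((lam p.1)^-1 ^+ n * W p.1 p.2 ^+ n.+1.*2)%:E)%E.
Proof. by rewrite lee_fin mulr_ge0. Qed.

Let tau_le_lam n w : (lam w)^-1 ^+ n * tau w ^+ n.+1 <= F2 ^+ n.+1 * lam w.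
Proof.
have l0 := lam_gt0 w.
rewrite exprVn mulrC ler_pdivrMr ?exprn_gt0// -mulrA -exprS -exprMn.
rewrite lerXn2r ?nnegrE//; first by rewrite mulr_ge0// ltW.
by rewrite /lam mulrC divfK ?gt_eqF// lerDl subr_ge0 ltW.
Qed.

(** Integrating one copy gives G tau^(n+1). After [jensen] the order of integration is exchanged: by
    symmetry of W the second copy yields G tau^(n+1) / lam^n, now in the variable of the weight, and
    this is at most G F2^(n+1) lam, of mean G F2^(n+1). *)
Let bilinear_moment_bound n :
  (\int[(P \x P)%E]_p (W p.1 p.2 ^+ n.+1.*2)%:E <=
   (G n.+1 ^+ 2 * F2 ^+ n.+1)%:E)%E.
Proof.
have mWn k : measurable_fun setT (fun p : T * T => (W p.1 p.2 ^+ k)%:E).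
  by apply/measurable_EFinP; exact: measurable_funX.
rewrite fubini_tonelli2//=; last by move=> p; rewrite lee_fin.
rewrite /fubini_G /=; under eq_integral do rewrite EWe.
apply: (@le_trans _ _ (\int[P]_w2 ((G n.+1)%:E *
   \int[P]_w1 ((lam w1)^-1 ^+ n * W w1 w2 ^+ n.+1.*2)%:E))%E).
  apply: ge0_le_integral => //=.
  - by move=> w _; rewrite lee_fin mulr_ge0// exprn_ge0.
  - apply/measurable_EFinP; apply: measurable_funM => //.
    exact: measurable_funX.
  - apply: emeasurable_funM => //.
    exact: (@measurable_fun_fubini_tonelli_G _ _ _ _ _ P _ (mlamW n)).
  - by move=> w _; rewrite -EFin_Rintegral// -EFinM lee_fin ler_wpM2l// jensen.
rewrite ge0_integralZl//=; last first.
- by rewrite lee_fin.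
- by move=> w _; apply: integral_ge0 => w1 _; rewrite lee_fin mulr_ge0.
- exact: (@measurable_fun_fubini_tonelli_G _ _ _ _ _ P _ (mlamW n)).
rewrite -(@fubini_tonelli _ _ _ _ _ P P _ (mlamW n))//=.
have -> : (G n.+1 ^+ 2 * F2 ^+ n.+1)%:E =
   ((G n.+1)%:E * \int[P]_w (G n.+1 * F2 ^+ n.+1 * lam w)%:E)%E.
  rewrite -EFin_Rintegral; last first.
    have := integrableZl measurableT (G n.+1 * F2 ^+ n.+1) integrable_lam.
    by congr (_.-integrable _ _).
  by rewrite RintegralZl// int_lam mulr1 -EFinM mulrA.
rewrite lee_wpmul2l ?lee_fin//.
apply: ge0_le_integral => //=.
- by move=> w _; apply: integral_ge0 => w1 _; rewrite lee_fin mulr_ge0.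
- exact: (@measurable_fun_fubini_tonelli_F _ _ _ _ _ P _ (mlamW n)).
- by apply/measurable_EFinP; exact: measurable_funM.
move=> w _; under eq_integral do rewrite EFinM.
rewrite ge0_integralZl//=; last first.
- by rewrite lee_fin.
- by move=> w1 _; rewrite lee_fin.
- by apply/measurable_EFinP; apply: measurable_funX; rewrite (funext (WC w)); exact: (gW w).1.
under eq_integral do rewrite WC.
by rewrite EWe -EFinM lee_fin mulrCA -mulrA ler_wpM2l// tau_le_lam.
Qed.

Let moment_bound k :
  \int[(P \x P)%E]_p ((2 * W p.1 p.2) ^+ k.*2) <= (k.*2)`!%:R * (4 * F2) ^+ k.
Proof.
case: k => [|n].
  under eq_Rintegral do rewrite expr0.
  rewrite Rintegral_cst// !expr0 fact0 !mul1r.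
  by have -> : fine ((P \x P)%E setT) = 1 by rewrite probability_setT.
have iW : (P \x P)%E.-integrable setT (EFin \o (fun p => W p.1 p.2 ^+ n.+1.*2)).
  apply: ge0_integrable_lty => [|//|]; first exact: measurable_funX.
  by apply: le_lt_trans (bilinear_moment_bound n) _; rewrite ltry.
under eq_Rintegral do rewrite exprMn.
rewrite RintegralZl//.
apply: (@le_trans _ _ (2 ^+ n.+1.*2 * (G n.+1 ^+ 2 * F2 ^+ n.+1))).
  rewrite ler_wpM2l ?exprn_ge0//.
  by rewrite -lee_fin EFin_Rintegral// bilinear_moment_bound.
rewrite [(4 * F2) ^+ _]exprMn [leLHS]mulrA [leRHS]mulrA ler_wpM2r ?exprn_ge0 ?(ltW F2_gt0)//.
have f0 : (n.+1`!%:R : R) != 0 by rewrite pnatr_eq0 -lt0n fact_gt0.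
(* The powers of 2 cancel those in G, leaving (2k)! times the central binomial coefficient. *)
have -> : 2 ^+ n.+1.*2 * G n.+1 ^+ 2 =
    (n.+1.*2)`!%:R * ((n.+1.*2)`!%:R / n.+1`!%:R ^+ 2).
  rewrite /G -muln2 exprM; have : (2 ^+ n.+1 : R) != 0 by rewrite expf_neq0.
  by move: (2 ^+ n.+1) => x x0; field; rewrite f0 x0.
rewrite ler_wpM2l// ler_pdivrMr ?exprn_gt0 ?ltr0n ?fact_gt0//.
have := fact_double_le n.+1; rewrite -(ler_nat R) => /le_trans; apply.
by rewrite natrM !natrX mulrC.
Qed.

Let even_geometric_le (x : R) N : 0 <= x -> x < 1 ->
  \sum_(n < N) (if odd n then 0 else x ^+ n./2) <= (1 - x)^-1.
Proof.
move=> x0 x1; apply: (@le_trans _ _ ((1 - x ^+ uphalf N) / (1 - x))).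
  elim: N => [|N IH]; first by rewrite big_ord0 expr0 subrr mul0r.
  rewrite big_ord_recr/=; move: IH; rewrite uphalf_half.
  case: (odd N) => /=; first by rewrite addr0 add1n.
  rewrite add0n => IH; rewrite (le_trans (lerD IH (lexx _)))//.
  rewrite exprS le_eqVlt; apply/orP; left; apply/eqP; field.
  by rewrite subr_eq0 gt_eqF.
rewrite -[leRHS]mul1r ler_wpM2r ?invr_ge0 ?subr_ge0 ?(ltW x1)//.
by rewrite lerBlDr lerDl exprn_ge0.
Qed.

Let mexp (t : R) : measurable_fun setT (fun w => expR (t * Q w)).
Proof. by apply: measurableT_comp => //; exact: measurable_funM. Qed.

Let mQ2 : measurable_fun setT (fun p : T * T => Q p.1 - Q p.2).
Proof. by apply: measurable_funB; exact: measurableT_comp. Qed.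

Let mgf_prod (t : R) :
  (\int[(P \x P)%E]_p (expR (t * (Q p.1 - Q p.2)))%:E =
   \int[P]_w (expR (t * Q w))%:E * \int[P]_w (expR (- t * Q w))%:E)%E.
Proof.
rewrite fubini_tonelli1//=; last first.
  by apply/measurable_EFinP; apply: measurableT_comp => //; exact: measurable_funM.
rewrite /fubini_F/= -ge0_integralZr//=; last 2 first.
- exact/measurable_EFinP.
- by apply: integral_ge0 => w _; rewrite lee_fin expR_ge0.
apply: eq_integral => w _; rewrite -ge0_integralZl//=; last first.
- exact/measurable_EFinP.
by apply: eq_integral => w1 _; rewrite -EFinM -expRD mulNr mulrBr.
Qed.

Let exp_pair_series (y : R) :
  ((expR y + expR (- y))%:E =
   \sum_(0 <= n <oo) ((y ^+ n + (- y) ^+ n) / n`!%:R)%:E)%E.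
Proof.
have cv z : series (exp_coeff z) @ \oo --> (expR z : R).
  exact: is_cvg_series_exp_coeff.
apply/esym/cvg_lim => //.
rewrite (_ : (fun n => _) = (fun n => (series (exp_coeff y) n + series (exp_coeff (- y)) n)%:E)).
  by apply: cvg_EFin; [exact: nearW|apply: cvgD; exact: cv].
apply/funext => n; rewrite sumEFin; congr EFin.
by rewrite /series /= -big_split/=; apply: eq_bigr => i _; rewrite mulrDl.
Qed.

(** Pairing exp y with exp(-y) makes every term of the series nonnegative, so sum and integral
    exchange without domination. *)
Let exp_pair_bound (t : R) : 8 * t ^+ 2 * F2 <= 1 ->
  (\int[(P \x P)%E]_p
     (expR (t * (Q p.1 - Q p.2)) + expR (- (t * (Q p.1 - Q p.2))))%:E <=
   (2 * expR (8 * t ^+ 2 * F2))%:E)%E.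
Proof.
move=> ht; set x := 4 * t ^+ 2 * F2.
have x0 : 0 <= x by rewrite mulr_ge0 ?(ltW F2_gt0)// mulr_ge0// sqr_ge0.
have x12 : x <= 2^-1 by rewrite /x; lra.
under eq_integral do rewrite exp_pair_series.
have pw_ge0 n (y : R) : 0 <= (y ^+ n + (- y) ^+ n) / n`!%:R.
  rewrite divr_ge0//; case/boolP: (odd n) => on.
    by rewrite exprNn -signr_odd on mulN1r subrr.
  by rewrite exprNn -signr_odd (negbTE on) mul1r addr_ge0// exprn_even_ge0.
rewrite integral_nneseries//=; last 2 first.
- move=> n; apply/measurable_EFinP; apply: measurable_funM => //.
  by apply: measurable_funD; apply: measurable_funX; [|apply: measurableT_comp => //]; exact: measurable_funM.
- by move=> n p _; rewrite lee_fin.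
apply: lime_le.
  apply: is_cvg_ereal_nneg_natsum => n _.
  by apply: integral_ge0 => p _; rewrite lee_fin.
apply: nearW => N.
have term n : (\int[(P \x P)%E]_p
    (((t * (Q p.1 - Q p.2)) ^+ n + (- (t * (Q p.1 - Q p.2))) ^+ n) / n`!%:R)%:E <=
    (2 * (if odd n then 0 else x ^+ n./2))%:E)%E.
  case: ifPn => on.
    rewrite (eq_integral (cst 0%E)) ?integral0 ?mulr0// => p _.
    by rewrite [(- _) ^+ _]exprNn -signr_odd on mulN1r subrr mul0r.
  have nk : n = n./2.*2 by rewrite -[LHS]odd_double_half (negbTE on).
  have [iD eD] := decoupling gv symA n.
  rewrite (eq_integral (fun p => (2 * t ^+ n / n`!%:R)%:E * ((Q p.1 - Q p.2) ^+ n)%:E)%E); last first.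
    move=> p _; rewrite [(- _) ^+ _]exprNn -signr_odd (negbTE on) mul1r -EFinM exprMn.
    by congr EFin; ring.
  rewrite integralZl// -EFin_Rintegral// -EFinM lee_fin eD.
  have tn : 0 <= t ^+ n by rewrite exprn_even_ge0.
  apply: (@le_trans _ _ (2 * t ^+ n / n`!%:R * (n`!%:R * (4 * F2) ^+ n./2))).
    rewrite ler_wpM2l//; first by rewrite divr_ge0// mulr_ge0.
    by rewrite nk /= doubleK; exact: moment_bound.
  rewrite mulrA divfK ?pnatr_eq0 -?lt0n ?fact_gt0// -mulrA ler_wpM2l//.
  by rewrite [in X in t ^+ X]nk -mul2n exprM -exprMn /x mulrCA mulrA.
apply: (@le_trans _ _ (\sum_(0 <= n < N) (2 * (if odd n then 0 else x ^+ n./2))%:E)%E).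
  by apply: lee_sum => n _; exact: term.
rewrite sumEFin lee_fin -mulr_sumr ler_wpM2l// big_mkord.
have x1 : x < 1 by lra.
rewrite (le_trans (even_geometric_le N x0 x1))//.
(* 1/(1-x) <= exp(2x) follows from (1-x)(1+2x) = 1 + x(1-2x) >= 1 for 0 <= x <= 1/2. *)
have -> : 8 * t ^+ 2 * F2 = 2 * x by rewrite /x; ring.
rewrite -[leLHS]mul1r ler_pdivrMr ?subr_gt0//.
apply: le_trans (ler_wpM2r _ (expR_ge1Dx (2 * x))); last by rewrite subr_ge0 ltW.
by rewrite -subr_ge0 (_ : _ - _ = x * (1 - 2 * x)); [rewrite mulr_ge0//; lra|ring].
Qed.

(** Exchanging the two copies shows that both halves of the pair equal E exp(tQ) E exp(-tQ). Jensen
    bounds the second factor below by exp(-t E Q), which centres the first. *)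
Lemma quadratic_mgf_bound (t : R) : 8 * t ^+ 2 * F2 <= 1 ->
  (\int[P]_w (expR (t * (Q w - \int[P]_w Q w)))%:E <=
   (expR (8 * t ^+ 2 * F2))%:E)%E.
Proof.
move=> ht; have iQ : P.-integrable setT (EFin \o Q) by exact: integrable_Q.
set m := \int[P]_w Q w; set C := expR _.
have E0 (s : R) : (0 <= \int[P]_w (expR (s * Q w))%:E)%E.
  by apply: integral_ge0 => w _; rewrite lee_fin expR_ge0.
have prod_le : (\int[P]_w (expR (t * Q w))%:E * \int[P]_w (expR (- t * Q w))%:E
    <= C%:E)%E.
  have := exp_pair_bound ht.
  under eq_integral do rewrite EFinD.
  have mE s : measurable_fun setT (fun p : T * T => (expR (s * (Q p.1 - Q p.2)))%:E).
    by apply/measurable_EFinP; apply: measurableT_comp => //; exact: measurable_funM.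
  rewrite ge0_integralD//=; last first.
  - by under eq_fun do rewrite -mulNr; exact: mE.
  rewrite mgf_prod; under [X in (_ + X)%E]eq_integral do rewrite -mulNr.
  rewrite mgf_prod opprK [X in (_ + X)%E]muleC.
  rewrite -mule2n -mule_natl EFinM lee_pmul2l//.
have jensen_exp : ((expR (- t * m))%:E <= \int[P]_w (expR (- t * Q w))%:E)%E.
  have i1 : P.-integrable setT (EFin \o cst (1 + t * m)).
    exact: finite_measure_integrable_cst.
  have i2 : P.-integrable setT (EFin \o (fun w => - t * Q w)).
    have := integrableZl measurableT (- t) iQ.
    by congr (_.-integrable _ _).
  have i3 : P.-integrable setT (EFin \o (fun w => expR (- t * m) * (1 + t * m + - t * Q w))).
    have := integrableZl measurableT (expR (- t * m)) (integrableD measurableT i1 i2).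
    by congr (_.-integrable _ _).
  have -> : expR (- t * m) = \int[P]_w (expR (- t * m) * (1 + t * m + - t * Q w)).
    rewrite RintegralZl//; last first.
      have := integrableD measurableT i1 i2.
      by congr (_.-integrable _ _).
    rewrite RintegralD// Rintegral_cst// RintegralZl// -/m.
    have -> : fine (P setT) = 1 by rewrite probability_setT.
    by ring.
  rewrite EFin_Rintegral//.
  (* The integral of exp(-tQ) is not known to be finite here; if it is infinite the inequality is
     immediate. *)
  have [iy|iy] := ltP (\int[P]_w (expR (- t * Q w))%:E)%E +oo%E; last first.
    by apply: le_trans iy; exact: leey.
  apply: le_integral => //.
    by apply: ge0_integrable_lty => // w; exact: expR_ge0.
  move=> w _; rewrite lee_fin.
  have := ler_wpM2l (expR_ge0 (- t * m)) (expR_ge1Dx (t * m + - t * Q w)).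
  by rewrite -expRD !addrA [- t * m]mulNr addNr add0r.
apply: le_trans prod_le; apply: (@le_trans _ _
  ((expR (- t * m))%:E * \int[P]_w (expR (t * Q w))%:E)%E).
  rewrite -ge0_integralZl//=; last first.
  - exact/measurable_EFinP.
  rewrite le_eqVlt; apply/orP; left; apply/eqP; apply: eq_integral => w _.
  by rewrite -EFinM -expRD; congr (expR _)%:E; ring.
by rewrite muleC lee_wpmul2l.
Qed.

End quadratic_moment.

(** Expanding the mean of the conditional variance v^T A S A v against the covariance S gives
    tr((AS)^2). *)
Lemma quadratic_chernoff_mgf (d : measure_display) (T : measurableType d)
    (R : realType) (P : probability T R) (I : finType) (v : I -> T -> R)
    (S A : I -> I -> R) (F2 t : R) :
  (forall c, gauss_mgf P (fun w => \sum_i c i * v i w) (quad_form S c c)) ->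
  (forall i j, P.-integrable setT (EFin \o (fun w => v i w * v j w)) /\
     \int[P]_w (v i w * v j w) = S i j) ->
  (forall i j, A i j = A j i) ->
  \sum_i \sum_j (\sum_k A i k * S k j) * (\sum_k A j k * S k i) < F2 ->
  8 * t ^+ 2 * F2 <= 1 ->
  let Q w := quad_form A (v ^~ w) (v ^~ w) in
  (\int[P]_w (expR (t * (Q w - \int[P]_w Q w)))%:E <=
   (expR (8 * t ^+ 2 * F2))%:E)%E.
Proof.
move=> gv covS symA hF ht; apply: (quadratic_mgf_bound gv symA) => //.
apply: le_lt_trans hF.
have symS i j : S i j = S j i.
  by rewrite -(covS i j).2 -(covS j i).2; apply: eq_Rintegral => w _; rewrite mulrC.
pose M i j := \sum_k A i k * S k j.
have -> : \int[P]_w quad_form S (fun i => \sum_j A i j * v j w)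
    (fun i => \sum_j A i j * v j w) = \sum_i \sum_i' M i i' * M i' i.
  have -> : (fun w => quad_form S (fun i => \sum_j A i j * v j w)
    (fun i => \sum_j A i j * v j w)) = fun w =>
     \sum_(k : I * I * (I * I)) S k.1.1 k.1.2 * (A k.1.1 k.2.1 * A k.1.2 k.2.2) *
        (v k.2.1 w * v k.2.2 w).
    apply/funext => w; rewrite -(pair_big xpredT xpredT (fun k l =>
      S k.1 k.2 * (A k.1 l.1 * A k.2 l.2) * (v l.1 w * v l.2 w)))/=.
    rewrite /quad_form pair_big/=; apply: eq_bigr => -[i i'] _ /=.
    rewrite mulr_suml mulr_sumr -(pair_big xpredT xpredT (fun j j' =>
      S i i' * (A i j * A i' j') * (v j w * v j' w)))/=.
    apply: eq_bigr => j _; rewrite !mulr_sumr; apply: eq_bigr => j' _; ring.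
  rewrite Rintegral_sum//; last first.
    move=> k; have := integrableZl measurableT
      (S k.1.1 k.1.2 * (A k.1.1 k.2.1 * A k.1.2 k.2.2)) (covS k.2.1 k.2.2).1.
    by congr (_.-integrable _ _).
  rewrite -(pair_big xpredT xpredT (fun k l =>
    \int[P]_w (S k.1 k.2 * (A k.1 l.1 * A k.2 l.2) * (v l.1 w * v l.2 w))))/=.
  rewrite -(pair_big xpredT xpredT (fun i i' => \sum_(l : I * I)
    \int[P]_w (S i i' * (A i l.1 * A i' l.2) * (v l.1 w * v l.2 w))))/=.
  apply: eq_bigr => i _; transitivity (\sum_i' \sum_j \sum_j'
      (S i i' * (A i j * A i' j') * S j j')).
    apply: eq_bigr => i' _; rewrite -(pair_big xpredT xpredT (fun j j' =>
      \int[P]_w (S i i' * (A i j * A i' j') * (v j w * v j' w))))/=.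
    apply: eq_bigr => j _; apply: eq_bigr => j' _.
    by have [ij eij] := covS j j'; rewrite RintegralZl// eij.
  transitivity (\sum_i' \sum_j' \sum_j (S i i' * (A i j * A i' j') * S j j')).
    by apply: eq_bigr => i' _; rewrite exchange_big.
  rewrite exchange_big; apply: eq_bigr => j' _ /=.
  rewrite exchange_big /M mulr_suml; apply: eq_bigr => j _ /=.
  rewrite mulr_sumr; apply: eq_bigr => i' _.
  by rewrite (symS i i') (symA i' j'); ring.
by [].
Qed.

(** * Independence and the Chernoff bound *)

(** Independence speaks of events only. Indicators are replaced by the variables one at a time, and
    the layer-cake formula reduces each replacement to superlevel sets, the only events of X
    required to lie in G. *)
Lemma indep_expectation_prod (d : measure_display) (T : measurableType d)
    (R : realType) (P : probability T R) (m : nat) (G : 'I_m -> set (set T))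
    (X : 'I_m -> T -> R) :
  (forall i A, G i A -> measurable A) -> 
  (forall A, (forall i, G i (A i)) -> P (\bigcap_i A i) = (\prod_i P (A i))%E) ->
  (forall i, G i setT) ->
  (forall i s, G i [set w | s < X i w]) ->
  (forall i w, 0 <= X i w) ->
  (forall i, P.-integrable setT (EFin \o X i)) ->
  (\int[P]_w (\prod_i X i w)%:E)%E = (\prod_i \int[P]_w X i w)%:E.
Proof.
move=> mG indep GT GX X0 iX.
have mX i : measurable_fun setT (X i) by apply/measurable_EFinP; exact: measurable_int (iX i).
(* Hybrid products: variables below k, indicators from k on. *)
suff main k : (k <= m)%N -> forall A, (forall i, G i (A i)) ->
    (\int[P]_w (\prod_(i < m) (if (i < k)%N then X i w else \1_(A i) w))%:E)%E =
    (\prod_(i < m) (if (i < k)%N then \int[P]_w X i w else fine (P (A i))))%:E.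
  have h := main m (leqnn m) (fun=> setT) GT.
  transitivity (\int[P]_w (\prod_(i < m) (if (i < m)%N then X i w else \1_setT w))%:E)%E.
    by apply: eq_integral => w _; congr EFin; apply: eq_bigr => i _; rewrite ltn_ord.
  by rewrite h; congr EFin; apply: eq_bigr => i _; rewrite ltn_ord.
elim: k => [_ A GA|k IH km A GA].
  rewrite (eq_integral (EFin \o \1_(\bigcap_i A i))); last first.
    move=> w _ /=; congr EFin; rewrite indicE.
    case: (boolP (w \in _)); rewrite ?inE ?notin_setE => h.
      by rewrite big1// => i _; rewrite indicE mem_set//; exact: h.
    have [i Ai] : exists i, ~ A i w.
      by apply: contrapT => /forallNP h'; apply: h => i _; apply: contrapT; exact: h'.
    by rewrite (bigD1 i)//= indicE memNset// mul0r.
  have mA i : measurable (A i) by exact: (mG _ _ (GA i)).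
  rewrite integral_indic//; last exact: fin_bigcap_measurable.
  rewrite setIT [LHS](indep _ GA).
  rewrite (eq_bigr (fun i => (fine (P (A i)))%:E)); first by rewrite prodEFin.
  by move=> i _; rewrite fineK// fin_num_measure.
pose k0 : 'I_m := Ordinal km.
pose W (w : T) : R := \prod_(i < m | i != k0) (if (i < k)%N then X i w else \1_(A i) w).
pose c : R := \prod_(i < m | i != k0)
  (if (i < k)%N then \int[P]_w X i w else fine (P (A i))).
have mW : measurable_fun setT W.
  rewrite (_ : W = fun w => \prod_(i < m)
    (if i != k0 then if (i < k)%N then X i w else \1_(A i) w else 1)); last first.
    by apply/funext => w; rewrite /W big_mkcond.
  apply: measurable_prod => i _; case: (i != k0) => //; case: (i < k)%N => //.
  by apply: measurable_indic; exact: (mG _ _ (GA i)).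
have W0 w : 0 <= W w.
  by apply: prodr_ge0 => i _; case: ifP => // _.
have c0 : 0 <= c.
  apply: prodr_ge0 => i _; case: ifP => // _; last exact: fine_ge0.
  exact: Rintegral_ge0.
have ltk (i : 'I_m) : i != k0 -> (i < k.+1)%N = (i < k)%N.
  by move=> ik; rewrite ltnS leq_eqVlt -[k]/(nat_of_ord k0) (inj_eq val_inj) (negbTE ik).
have IHk B : G k0 B -> (\int[P]_w (\1_B w * W w)%:E)%E = (fine (P B) * c)%:E.
  move=> GB; pose A' i := if i == k0 then B else A i.
  have GA' i : G i (A' i) by rewrite /A'; case: eqP => // ->.
  have := IH (ltnW km) A' GA'; rewrite (bigD1 k0)//= ltnn /A' eqxx => h.
  transitivity (\int[P]_w (\prod_(i < m) (if (i < k)%N then X i w else \1_(A' i) w))%:E)%E.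
    apply: eq_integral => w _; congr EFin; rewrite (bigD1 k0)//= ltnn /A' eqxx.
    by congr (_ * _); apply: eq_bigr => i /negbTE ik; rewrite ik.
  rewrite h; congr (_ * _)%:E.
  by apply: eq_bigr => i /negbTE ik; rewrite ik.
transitivity (\int[P]_w (X k0 w * W w)%:E)%E.
  apply: eq_integral => w _; congr EFin; rewrite (bigD1 k0)//= ltnSn.
  by congr (_ * _); apply: eq_bigr => i ik; rewrite ltk.
rewrite (bigD1 k0)//= ltnSn.
have -> : \prod_(i < m | i != k0) (if (i < k.+1)%N then \int[P]_w X i w else fine (P (A i))) = c.
  by apply: eq_bigr => i ik; rewrite ltk.
(* On every superlevel set of X k0 the product W of the other factors integrates like the constant
   c, by the induction hypothesis with that set as the event of index k0. *)
rewrite (@eq_layer_integral _ _ _ _ _ P P _ _ (X k0) (cst c))//.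
  under eq_integral do rewrite EFinM.
  rewrite integralZr//; last exact: iX.
  by have e := EFin_Rintegral (iX k0); exact: (esym (congr1 (fun z => z * c%:E)%E e)).
move=> s s0; have Gs := GX k0 s.
transitivity (\int[P]_w (\1_[set w | s < X k0 w] w * W w)%:E)%E.
  rewrite integral_mkcond; apply: eq_integral => w _; rewrite patchE indicE.
  by case: ifP => _; rewrite ?mul1r ?mul0r.
rewrite IHk//= integral_cst; last exact: (mG _ _ Gs).
by rewrite mulrC EFinM fineK// fin_num_measure//; exact: (mG _ _ Gs).
Qed.

Lemma indep_upper_tail (d : measure_display) (T : measurableType d)
    (R : realType) (P : probability T R) (m : nat) (G : 'I_m -> set (set T))
    (Y : 'I_m -> T -> R) (t C a : R) :
  (forall i A, G i A -> measurable A) ->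
  (forall A, (forall i, G i (A i)) -> P (\bigcap_i A i) = (\prod_i P (A i))%E) ->
  (forall i, G i setT) ->
  (forall i, measurable_fun setT (Y i)) ->
  (forall i s, G i [set w | s < expR (t * Y i w)]) ->
  (forall i, \int[P]_w (expR (t * Y i w))%:E <= (expR C)%:E)%E ->
  0 < t ->
  (P [set w | a <= \sum_i Y i w]%R <= (expR (m%:R * C - t * a))%:E)%E.
Proof.
move=> mG indep GT mY GY EY t0.
have mE i : measurable_fun setT (fun w => expR (t * Y i w)).
  by apply: measurableT_comp => //; exact: measurable_funM.
have mS : measurable_fun setT (fun w => \sum_i Y i w) by exact: measurable_sum.
have iE i : P.-integrable setT (EFin \o (fun w => expR (t * Y i w))).
  apply: ge0_integrable_lty => //.
  by apply: le_lt_trans (EY i) _; rewrite ltry.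
have mA : measurable [set w | a <= \sum_i Y i w].
  have : measurable_fun setT (fun w => a <= \sum_i Y i w) by exact: measurable_fun_ler.
  by move=> /(_ measurableT [set true]); rewrite setTI; exact.
have Eprod : (\int[P]_w (expR (t * \sum_i Y i w))%:E <= (expR (m%:R * C))%:E)%E.
  rewrite (eq_integral (fun w => (\prod_i expR (t * Y i w))%:E)); last first.
    by move=> w _; rewrite mulr_sumr expR_sum.
  rewrite (indep_expectation_prod mG indep)//.
  rewrite lee_fin.
  have -> : expR (m%:R * C) = \prod_(i < m) expR C.
    by rewrite prodr_const card_ord -expRM_natl.
  apply: ler_prod => i _; rewrite Rintegral_ge0//=.
  by rewrite -lee_fin EFin_Rintegral.
have mES : measurable_fun setT (fun w => (expR (t * \sum_i Y i w))%:E).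
  by apply/measurable_EFinP; apply: measurableT_comp => //; exact: measurable_funM.
have PA : ((expR (t * a))%:E * P [set w | a <= \sum_i Y i w]%R <= (expR (m%:R * C))%:E)%E.
  apply: le_trans Eprod; rewrite -integral_cst//.
  apply: (@le_trans _ _ (\int[P]_(w in [set w | (a <= \sum_i Y i w)%R])
     (expR (t * \sum_i Y i w))%:E)%E).
    apply: ge0_le_integral => //=.
    - exact: measurable_funTS.
    - by move=> w aw; rewrite lee_fin ler_expR ler_pM2l.
  by apply: ge0_subset_integral => //=.
move: PA; rewrite -[P _]fineK ?fin_num_measure// -EFinM !lee_fin => PA.
by rewrite expRD expRN ler_pdivlMr ?expR_gt0// mulrC.
Qed.

Lemma indep_two_sided_tail (d : measure_display) (T : measurableType d)
    (R : realType) (P : probability T R) (m : nat) (G : 'I_m -> set (set T))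
    (Y : 'I_m -> T -> R) (t C a : R) :
  (forall i A, G i A -> measurable A) ->
  (forall A, (forall i, G i (A i)) -> P (\bigcap_i A i) = (\prod_i P (A i))%E) ->
  (forall i, G i setT) ->
  (forall i, measurable_fun setT (Y i)) ->
  (forall i u s, G i [set w | s < expR (u * Y i w)]) ->
  (forall i, \int[P]_w (expR (t * Y i w))%:E <= (expR C)%:E)%E ->
  (forall i, \int[P]_w (expR (- t * Y i w))%:E <= (expR C)%:E)%E ->
  0 < t ->
  (P [set w | a <= `|\sum_i Y i w|]%R <= (2 * expR (m%:R * C - t * a))%:E)%E.
Proof.
move=> mG indep GT mY GY EY ENY t0.
have mS : measurable_fun setT (fun w => \sum_i Y i w) by exact: measurable_sum.
have mA (Z : T -> R) : measurable_fun setT Z -> measurable [set w | a <= Z w].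
  move=> mZ; have : measurable_fun setT (fun w => a <= Z w) by exact: measurable_fun_ler.
  by move=> /(_ measurableT [set true]); rewrite setTI; exact.
have U := indep_upper_tail a mG indep GT mY (fun i => GY i t) EY t0.
have mNY i : measurable_fun setT (fun w => - Y i w) by exact: measurableT_comp.
have V : (P [set w | a <= \sum_i - Y i w]%R <= (expR (m%:R * C - t * a))%:E)%E.
  apply: (indep_upper_tail _ mG indep GT mNY) => // [i s|i].
    by have := GY i (- t) s; under eq_fun do rewrite mulNr -mulrN.
  by have := ENY i; under eq_integral do rewrite mulNr -mulrN.
apply: (@le_trans _ _ (P ([set w | a <= \sum_i Y i w] `|` [set w | a <= \sum_i - Y i w]))).
  rewrite le_measure ?inE//=.
  - by apply: mA; exact: measurableT_comp.
  - by apply: measurableU; apply: mA => //; exact: measurable_sum.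
  - move=> w /=; rewrite sumrN; case: ger0P => _ h; [by left|by right].
have mA1 := mA _ mS.
have mA2 : measurable [set w | a <= \sum_i - Y i w].
  by apply: mA; exact: measurable_sum.
apply: (@le_trans _ _ (P [set w | a <= \sum_i Y i w]%R + P [set w | a <= \sum_i - Y i w]%R)%E).
  exact: measureU2.
by rewrite mulr_natl mulr2n EFinD leeD.
Qed.

(** * Continuous kernels and step functions on a fine partition *)

Lemma kernel_unif_continuous (R : realType) (D : set R) (f : R -> R -> R) :
  compact D -> continuous_kernel D f -> forall eps, 0 < eps ->
  exists2 del, 0 < del & forall x x' y y', D x -> D x' -> D y -> D y' ->
    `|x - x'| < del -> `|y - y'| < del -> `|f x y - f x' y'| < eps.
Proof.
move=> cD /subspace_continuousP cf eps e0.
have /compact_near_coveringP cov := compact_setX cD cD.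
pose Pr (del : R) (p : R * R) := (D `*` D) p -> forall q : R * R, (D `*` D) q ->
  `|p.1 - q.1| < del -> `|p.2 - q.2| < del -> `|f p.1 p.2 - f q.1 q.2| < eps.
have H : \forall del \near (0 : R)^'+, (D `*` D) `<=` Pr del.
  apply: cov => p0 Dp0; have /= := cf p0 Dp0.
  move=> /cvgrPdist_lt /(_ (eps / 2)); rewrite divr_gt0// => /(_ isT).
  rewrite /within => /nbhs_ballP[e /= e_gt0 be].
  (* Half radii keep every q close to p inside the ball of radius e around p0. *)
  exists (ball p0 (e / 2), [set del | del < e / 2]).
    split => /=; first by apply: nbhsx_ballx; rewrite divr_gt0.
    by apply: nbhs_right_lt; rewrite divr_gt0.
  move=> [p del] /= [[bp1 bp2] dele] Dp q Dq pq1 pq2.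
  have fp : `|f p0.1 p0.2 - f p.1 p.2| < eps / 2.
    apply: be => //; split; [apply: le_ball bp1|apply: le_ball bp2];
    by rewrite ler_pdivrMr// ler_peMr ?(ltW e_gt0)// ler1n.
  have fq : `|f p0.1 p0.2 - f q.1 q.2| < eps / 2.
    apply: be => //; split; rewrite /ball /=.
      move: bp1; rewrite /ball /= => bp1.
      rewrite (splitr e) (le_lt_trans (ler_distD p.1 _ _))// ltrD// (lt_trans pq1)//.
    move: bp2; rewrite /ball /= => bp2.
    rewrite (splitr e) (le_lt_trans (ler_distD p.2 _ _))// ltrD// (lt_trans pq2)//.
  rewrite (splitr eps) (le_lt_trans (ler_distD (f p0.1 p0.2) _ _))// ltrD//.
  by rewrite distrC.
have [del [d0 Hd]] : exists del, 0 < del /\ (D `*` D) `<=` Pr del.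
  near (0 : R)^'+ => del; exists del; split; first by near: del; exact: nbhs_right_gt.
  by near: del; exact: H.
exists del => // x x' y y' Dx Dx' Dy Dy' xx' yy'.
by have := Hd (x, y) (conj Dx Dy) (conj Dx Dy) (x', y') (conj Dx' Dy') xx' yy'.
Unshelve. all: by end_near.
Qed.

Lemma kernel_bounded (R : realType) (D : set R) (f : R -> R -> R) :
  compact D -> continuous_kernel D f ->
  exists2 M, 1 <= M & forall x y, D x -> D y -> `|f x y| <= M.
Proof.
move=> cD cf; have := continuous_compact cf (compact_setX cD cD).
move=> /compact_bounded [M [Mreal HM]].
exists (`|M| + 1); first by rewrite lerDr.
move=> x y Dx Dy; apply: (HM (`|M| + 1)).
  by rewrite (le_lt_trans (ler_norm M))// ltrDl.
by exists (x, y).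
Qed.

Section partitions.
Context {R : realType}.
Variables (a b : R).
Hypothesis ltab : a < b.
Local Notation D := (`[a, b]%classic).
Local Notation mu := (@lebesgue_measure R).

Lemma fine_partition (h : R) : 0 < h ->
  exists (N : nat) (idx : R -> 'I_N) (pt : 'I_N -> R),
  [/\ forall j, D (pt j), forall x, D x -> `|x - pt (idx x)| < h &
    forall j, measurable (D `&` idx @^-1` [set j])].
Proof.
move=> h0; pose N := (Num.trunc ((b - a) / h)).
pose pt (j : 'I_N.+1) := a + h * (j : nat)%:R.
pose idx (x : R) : 'I_N.+1 := inord (Num.trunc ((x - a) / h)).
have tr x : D x -> 0 <= (x - a) / h.
  by rewrite /= in_itv/= => /andP[ax xb]; rewrite divr_ge0 ?subr_ge0// ltW.
have Db : D b by rewrite /= in_itv/= lexx ltW.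
have idxE x : D x -> (idx x : nat) = Num.trunc ((x - a) / h).
  move=> Dx; rewrite inordK// ltnS; apply: le_truncn.
  by rewrite ler_pM2r ?invr_gt0// lerD2r; move: Dx; rewrite /= in_itv/= => /andP[].
exists N.+1, idx, pt; split.
- move=> j; rewrite /= in_itv/= /pt lerDl mulr_ge0 ?(ltW h0)//=.
  rewrite -lerBrDl mulrC -ler_pdivlMr// -truncn_ge_nat ?tr//.
  by rewrite -ltnS.
- move=> x Dx; rewrite /pt idxE// -{1}(subrK a x).
  have /andP[l u] := truncn_itv (tr x Dx).
  move: l u; set k := Num.trunc _; rewrite ler_pdivlMr// ltr_pdivrMr// -natr1 => l u.
  rewrite ger0_norm; lra.
- move=> j.
  have -> : D `&` idx @^-1` [set j] = D `&` `[pt j, pt j + h[.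
    apply/seteqP; split => x [Dx /= xj]; split => //.
      have /andP[l u] := truncn_itv (tr x Dx).
      rewrite in_itv/= /pt -xj idxE//.
      move: l u; set k := Num.trunc _; rewrite ler_pdivlMr// ltr_pdivrMr// -natr1 => l u.
      by apply/andP; split; lra.
    apply/val_inj; rewrite /= idxE//; apply: truncn_def.
    move: xj; rewrite in_itv/= /pt => /andP[l u].
    rewrite ler_pdivlMr// ltr_pdivrMr// -natr1; apply/andP; split; lra.
  exact: measurableI.
Qed.

Let mD : measurable D. Proof. exact: measurable_itv. Qed.

Section step_functions.
Variables (N : nat) (idx : R -> 'I_N).
Hypothesis mI : forall j, measurable (D `&` idx @^-1` [set j]).

Definition cell_weight (j : 'I_N) : R := fine (mu (D `&` idx @^-1` [set j])).

Lemma cell_weight_ge0 j : 0 <= cell_weight j.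
Proof. exact: fine_ge0. Qed.

Let cell_indic (phi : 'I_N -> R) x : D x ->
  phi (idx x) = \sum_j phi j * \1_(D `&` idx @^-1` [set j]) x.
Proof.
move=> Dx; rewrite (bigD1 (idx x))//= indicE mem_set// mulr1 big1 ?addr0//.
by move=> j jx; rewrite indicE memNset ?mulr0// => -[_ /= e]; rewrite e eqxx in jx.
Qed.

Lemma measurable_step (phi : 'I_N -> R) : measurable_fun D (phi \o idx).
Proof.
apply: (eq_measurable_fun (fun x => \sum_j phi j * \1_(D `&` idx @^-1` [set j]) x)).
  by move=> x; rewrite inE => Dx; rewrite /= cell_indic.
apply: measurable_funTS; apply: measurable_sum => j; apply: measurable_funM => //.
Qed.

Lemma measurable_step2 (phi : 'I_N -> 'I_N -> R) :
  measurable_fun (D `*` D) (fun p : R * R => phi (idx p.1) (idx p.2)).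
Proof.
apply: (eq_measurable_fun (fun p : R * R => \sum_j \sum_k phi j k *
   (\1_(D `&` idx @^-1` [set j]) p.1 * \1_(D `&` idx @^-1` [set k]) p.2))).
  move=> p; rewrite inE => -[D1 D2]; rewrite (cell_indic (phi ^~ (idx p.2)))//.
  apply: eq_bigr => j _; rewrite (cell_indic (phi j))// mulr_suml.
  by apply: eq_bigr => k _; ring.
apply: measurable_funTS; apply: measurable_sum => j; apply: measurable_sum => k.
apply: measurable_funM => //; apply: measurable_funM.
  by apply: (@measurableT_comp _ _ _ _ _ _ (\1_(D `&` idx @^-1` [set j]) : R -> R) _ fst);
    [exact: measurable_indic|exact: measurable_fst].
by apply: (@measurableT_comp _ _ _ _ _ _ (\1_(D `&` idx @^-1` [set k]) : R -> R) _ snd);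
  [exact: measurable_indic|exact: measurable_snd].
Qed.

Lemma step_integral (phi : 'I_N -> R) :
  mu.-integrable D (EFin \o (phi \o idx)) /\
  \int[mu]_(x in D) phi (idx x) = \sum_j cell_weight j * phi j.
Proof.
have muI j : (mu (D `&` idx @^-1` [set j]) < +oo)%E.
  apply: (@le_lt_trans _ _ (mu D)).
    by apply: le_measure; rewrite ?inE//; exact: mI.
  by rewrite lebesgue_measure_itv/= lte_fin ltab -EFinD ltry.
have i1 j : mu.-integrable D (EFin \o (\1_(D `&` idx @^-1` [set j]) : R -> R)).
  apply/integrableP; split.
    by apply/measurable_EFinP; apply: measurable_indic; exact: mI.
  under eq_integral do rewrite /= ger0_norm//.
  rewrite integral_indic//; last exact: mI.
  by rewrite setIAC setIid; exact: muI.
have iI j : mu.-integrable D (EFin \o (fun x => phi j * \1_(D `&` idx @^-1` [set j]) x)).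
  have := @integrableZl _ _ _ mu D mD (phi j) _ (i1 j).
  by congr (_.-integrable _ _).
split.
  apply: (@eq_integrable _ _ _ mu D mD (EFin \o (fun x => \sum_j phi j * \1_(D `&` idx @^-1` [set j]) x))).
    by move=> x; rewrite inE => Dx /=; rewrite (cell_indic phi).
  exact: integrable_sumR.
transitivity (\int[mu]_(x in D) \sum_j phi j * \1_(D `&` idx @^-1` [set j]) x).
  by apply: eq_Rintegral => x; rewrite inE => Dx; rewrite (cell_indic phi).
rewrite Rintegral_sum//; apply: eq_bigr => j _.
rewrite RintegralZl// mulrC /cell_weight; congr (_ * _).
rewrite /Rintegral integral_indic//; last exact: mI.
by rewrite setIAC setIid.
Qed.

End step_functions.

(** Continuity is relative to the square only, so measurability is obtained by writing the kernel as
    a pointwise limit of step kernels on finer and finer partitions. *)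
Lemma continuous_kernel_measurable (f : R -> R -> R) : continuous_kernel D f ->
  measurable_fun (D `*` D) (fun p : R * R => f p.1 p.2).
Proof.
move=> cf; have cD : compact D by exact: segment_compact.
have step n : exists h : R * R -> R, measurable_fun (D `*` D) h /\
    forall p, (D `*` D) p -> `|f p.1 p.2 - h p| < n.+1%:R^-1.
  have n0 : 0 < n.+1%:R^-1 :> R by rewrite invr_gt0.
  have [del d0 fdel] := kernel_unif_continuous cD cf n0.
  have [N [idx [pt [ptD ptx mI]]]] := fine_partition d0.
  exists (fun p => f (pt (idx p.1)) (pt (idx p.2))); split.
    exact: (measurable_step2 mI (fun j k => f (pt j) (pt k))).
  by move=> p [p1 p2]; apply: fdel => //; exact: ptx.
have [h Hh] := choice step.
apply: (measurable_fun_cvg (h := h)) => [n|p Dp]; first exact: (Hh n).1.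
apply/cvgrPdist_lt => e e0; near=> n.
rewrite (lt_trans ((Hh n).2 p Dp))//.
by near: n; exact: near_infty_natSinv_lt (PosNum e0).
Unshelve. all: by end_near.
Qed.

End partitions.

(** * Parameter integrals, L2 norms and the integral operator *)

(** Tonelli applies to the positive and negative parts separately, so no integrability is asked of
    the sections; this matters for sample paths, which are only jointly measurable. *)
Lemma measurable_fun_Rintegral (d1 d2 : measure_display)
    (T1 : measurableType d1) (T2 : measurableType d2) (R : realType)
    (mu : {sigma_finite_measure set T1 -> \bar R}) (A : set T1) (B : set T2)
    (h : T1 -> T2 -> R) :
  measurable A -> measurable B ->
  measurable_fun (A `*` B) (fun p : T1 * T2 => h p.1 p.2) ->
  measurable_fun B (fun y => \int[mu]_(x in A) h x y).
Proof.
move=> mA mB mh.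
pose h' : T1 * T2 -> \bar R := (EFin \o (fun p => h p.1 p.2)) \_ (A `*` B).
have mh' : measurable_fun setT h'.
  have mAB := measurableX mA mB.
  by apply/(measurable_restrictT _ mAB); exact/measurable_EFinP.
apply: (eq_measurable_fun (fun y => fine (\int[mu]_x h' (x, y))%E)).
  move=> y; rewrite inE => By; rewrite /Rintegral; congr fine.
  rewrite [RHS]integral_mkcond; apply: eq_integral => x _.
  rewrite /h' !patchE; case: ifPn; case: ifPn => //; rewrite !inE ?notin_setE/=.
    by move=> nA [].
  by move=> Ax; case.
apply: measurable_funTS; apply: (measurableT_comp (fine_measurable measurableT)).
have -> : (fun y => \int[mu]_x h' (x, y))%E =
    (fun y => \int[mu]_x h'^\+ (x, y) - \int[mu]_x h'^\- (x, y))%E.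
  apply/funext => y; rewrite [LHS]integralE; congr (_ - _)%E; apply: eq_integral => x _.
    by rewrite !funeposE.
  by rewrite !funenegE.
apply: emeasurable_funB.
- by apply: (@measurable_fun_fubini_tonelli_G _ _ _ _ _ mu h'^\+%E) => //; exact: measurable_funepos.
- by apply: (@measurable_fun_fubini_tonelli_G _ _ _ _ _ mu h'^\-%E) => //; exact: measurable_funeneg.
Qed.

Lemma Lnorm2_le (d : measure_display) (T : measurableType d) (R : realType)
    (mu : {measure set T -> \bar R}) (D : set T) (u : T -> R) (c : R) :
  0 <= c ->
  ('N[mu]_2%:E [((EFin \o u) \_ D)%E] <= c%:E)%E <->
  (\int[mu]_(x in D) (u x ^+ 2)%:E <= (c ^+ 2)%:E)%E.
Proof.
move=> c0; set F := ((EFin \o u) \_ D)%E.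
have intF : (\int[mu]_(x in D) (u x ^+ 2)%:E = \int[mu]_x (`|F x| `^ 2))%E.
  rewrite integral_mkcond; apply: eq_integral => x _.
  rewrite /F !patchE; case: ifP => _ /=; last by rewrite normr0 powR0// pnatr_eq0.
  by rewrite -[2]/(2%:R) powR_mulrn// real_normK// num_real.
have NF := Lnorm_ge0 mu 2%:E F.
rewrite intF -poweR_Lnorm; last by rewrite pnatr_eq0.
move: NF; case: ('N[mu]_2%:E [F])%E => [r|_|//].
  rewrite lee_fin => r0; rewrite poweR_EFin !lee_fin.
  by rewrite -[X in powR _ X]/(2%:R) powR_mulrn// ler_pXn2r.
by rewrite poweRyr ?pnatr_eq0// !leye_eq.
Qed.

Section compact_interval.
Context {R : realType}.
Variables (a b : R).
Hypothesis ltab : a < b.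
Local Notation D := (`[a, b]%classic).
Local Notation mu := (@lebesgue_measure R).
Local Notation L := (b - a).

Let mD : measurable D. Proof. exact: measurable_itv. Qed.

Let L0 : 0 < L. Proof. by rewrite subr_gt0. Qed.

Lemma lebesgue_measure_segment : mu D = L%:E.
Proof. by rewrite lebesgue_measure_itv/= lte_fin ltab -EFinD. Qed.

Lemma bounded_integrable (phi : R -> R) (C : R) : measurable_fun D phi ->
  (forall x, D x -> `|phi x| <= C) -> mu.-integrable D (EFin \o phi).
Proof.
move=> mphi hC.
apply: (@le_integrable _ _ _ mu D mD _ (EFin \o cst C)).
- exact/measurable_EFinP.
- by move=> x Dx /=; rewrite lee_fin (le_trans (hC x Dx))// ler_norm.
- apply/integrableP; split; first by apply/measurable_EFinP; exact: measurable_cst.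
  under eq_integral do rewrite /=.
  by rewrite integral_cst// [X in (_ * X)%E](lebesgue_measure_segment) -EFinM ltry.
Qed.

Lemma Rintegral_segment_cst (C : R) : \int[mu]_(x in D) C = C * L.
Proof. by rewrite Rintegral_cst// [X in fine X]lebesgue_measure_segment. Qed.

Lemma Rintegral_segment_dist (phi psi : R -> R) (e : R) :
  mu.-integrable D (EFin \o phi) -> mu.-integrable D (EFin \o psi) ->
  (forall x, D x -> `|phi x - psi x| <= e) ->
  `|\int[mu]_(x in D) phi x - \int[mu]_(x in D) psi x| <= e * L.
Proof.
move=> iphi ipsi he; rewrite -(@RintegralB _ _ _ mu)//.
have iB := @integrableB _ _ _ mu D mD _ _ iphi ipsi.
have iB' : mu.-integrable D (EFin \o (fun x => phi x - psi x)).
  by move: iB; congr (_.-integrable _ _).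
rewrite (le_trans (@le_normr_Rintegral _ _ _ mu D _ mD iB'))//.
rewrite -Rintegral_segment_cst; apply: (@le_Rintegral _ _ _ mu) => //.
- exact: (@integrable_norm _ _ _ mu D _ iB').
- apply: (@bounded_integrable _ `|e|) => //; exact: measurable_cst.
Qed.

Lemma Rintegral_segment_bound (phi : R -> R) (C : R) :
  mu.-integrable D (EFin \o phi) -> (forall x, D x -> `|phi x| <= C) ->
  `|\int[mu]_(x in D) phi x| <= C * L.
Proof.
move=> iphi hC; have i0 : mu.-integrable D (EFin \o (fun=> 0 : R)).
  by apply: (@bounded_integrable _ 0); [exact: measurable_cst|move=> *; rewrite normr0].
have := @Rintegral_segment_dist phi (fun=> 0) C iphi i0.
by rewrite Rintegral_segment_cst mul0r subr0; apply => x Dx; rewrite subr0 hC.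
Qed.

Lemma measurable_kernel_section (h : R -> R -> R) (y : R) : D y ->
  measurable_fun (D `*` D) (fun p : R * R => h p.1 p.2) ->
  measurable_fun D (h y).
Proof.
move=> Dy mh; have := @measurable_comp _ _ _ _ _ _ (D `*` D)
  (fun p : R * R => h p.1 p.2) D (pair y).
apply => //; first exact: measurableX.
  by move=> _ [z Dz <-].
by apply: measurable_funTS; exact: measurable_pair1.
Qed.

Section operator.
Variables (K : R -> R -> R) (kappa : R).
Hypothesis cK : continuous_kernel D K.
Hypothesis symK : forall x y, D x -> D y -> K x y = K y x.
Hypothesis boundK : forall x y, D x -> D y -> `|K x y| <= kappa.

Let mK : measurable_fun (D `*` D) (fun p : R * R => K p.1 p.2).
Proof. exact: continuous_kernel_measurable. Qed.

Let kappa0 : 0 <= kappa.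
Proof.
have Da : D a by rewrite /= in_itv/= lexx ltW.
exact: le_trans (boundK Da Da).
Qed.

Lemma measurable_integral_operator (u : R -> R) : measurable_fun D u ->
  measurable_fun D (integral_operator D K u).
Proof.
move=> mu_; apply: (@measurable_fun_Rintegral _ _ _ _ _ mu D D (fun z y => K y z * u z)) => //.
apply: (eq_measurable_fun (fun p : R * R => K p.1 p.2 * u p.1)).
  by move=> p; rewrite inE => -[p1 p2]; rewrite symK.
apply: measurable_funM => //.
apply: (@measurable_comp _ _ _ _ _ _ D u (D `*` D) fst) => //.
- by move=> _ [p [p1 p2] <-].
- by apply: measurable_funTS; exact: measurable_fst.
Qed.

Lemma integrable_operator_section (u : R -> R) (C y : R) : D y ->
  measurable_fun D u -> (forall x, D x -> `|u x| <= C) ->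
  mu.-integrable D (EFin \o (fun z => K y z * u z)).
Proof.
move=> Dy mu_ uC; apply: (@bounded_integrable _ (kappa * C)).
  by apply: measurable_funM => //; exact: measurable_kernel_section.
by move=> z Dz; rewrite normrM ler_pM// ?boundK ?uC.
Qed.

Lemma op_norm_ge0 : (0 <= op_norm D K)%E.
Proof.
apply: (@le_trans _ _ (L2norm D (integral_operator D K (fun=> 0)))).
  exact: Lnorm_ge0.
apply: ereal_sup_ubound; exists (fun=> 0) => //; split; first exact: measurable_cst.
apply/(Lnorm2_le _ _ _ ler01); under eq_integral do rewrite expr0n/=.
by rewrite integral0 lee_fin expr1n.
Qed.

Lemma op_norm_fin_num : op_norm D K \is a fin_num.
Proof.
have := op_norm_ge0; rewrite fin_numElt => /(lt_le_trans (ltNyr 0)) -> /=.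
(* |u| <= 1 + u^2 replaces Cauchy-Schwarz: over the unit ball it bounds the image of u pointwise by
   C. *)
set C := kappa * (L + 1).
have C0 : 0 <= C by rewrite mulr_ge0// addr_ge0// ltW.
suff : (op_norm D K <= (Num.sqrt (C ^+ 2 * L))%:E)%E.
  by move=> /le_lt_trans; apply; rewrite ltry.
apply: ge_ereal_sup => _ [u [mu_ nu] <-].
have iu2 : mu.-integrable D (EFin \o (fun x => u x ^+ 2)).
  apply/integrableP; split; first by apply/measurable_EFinP; exact: measurable_funX.
  move: nu => /(Lnorm2_le _ _ _ ler01) nu.
  under eq_integral do rewrite /= ger0_norm ?sqr_ge0//.
  by apply: le_lt_trans nu _; rewrite ltry.
have int_u2 : \int[mu]_(x in D) (u x ^+ 2) <= 1.
  move: nu => /(Lnorm2_le _ _ _ ler01); rewrite expr1n -lee_fin /Rintegral fineK//.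
  exact: (@integrable_fin_num _ _ _ mu D mD _ iu2).
have i1 : mu.-integrable D (EFin \o (fun=> 1 : R)).
  by apply: (@bounded_integrable _ 1); [exact: measurable_cst|move=> *; rewrite normr1].
have idom : mu.-integrable D (EFin \o (fun x => kappa * (1 + u x ^+ 2))).
  have := @integrableZl _ _ _ mu D mD kappa _ (@integrableD _ _ _ mu D mD _ _ i1 iu2).
  by congr (_.-integrable _ _).
have leu x y : D x -> D y -> `|K y x * u x| <= kappa * (1 + u x ^+ 2).
  move=> Dx Dy; rewrite normrM ler_pM ?boundK//.
  have := sqr_ge0 (`|u x| - 1); rewrite -(real_normK (num_real (u x))); nra.
have iKu y : D y -> mu.-integrable D (EFin \o (fun z => K y z * u z)).
  move=> Dy; apply: (@le_integrable _ _ _ mu D mD _ _ _ _ idom).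
    apply/measurable_EFinP; apply: measurable_funM => //.
    exact: measurable_kernel_section.
  by move=> x Dx /=; rewrite lee_fin (le_trans (leu x y Dx Dy))// ler_norm.
have KuB y : D y -> `|integral_operator D K u y| <= C.
  move=> Dy; rewrite (le_trans (@le_normr_Rintegral _ _ _ mu D _ mD (iKu y Dy)))//.
  apply: (@le_trans _ _ (\int[mu]_(x in D) (kappa * (1 + u x ^+ 2)))).
    apply: (@le_Rintegral _ _ _ mu) => //.
      exact: (@integrable_norm _ _ _ mu D _ (iKu y Dy)).
    by move=> x Dx; exact: leu.
  have i2 := @integrableD _ _ _ mu D mD _ _ i1 iu2.
  rewrite (@RintegralZl _ _ _ mu)//.
  rewrite ler_wpM2l// (@RintegralD _ _ _ mu)// Rintegral_segment_cst mul1r.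
  by rewrite lerD2l.
apply/(Lnorm2_le _ _ _ (sqrtr_ge0 _)); rewrite sqr_sqrtr; last first.
  exact: mulr_ge0 (sqr_ge0 C) (ltW L0).
apply: (@le_trans _ _ (\int[mu]_(x in D) (C ^+ 2)%:E)%E).
  apply: (@ge0_le_integral _ _ _ mu) => //=.
  - by move=> x _; rewrite lee_fin sqr_ge0.
  - apply/measurable_EFinP; apply: measurable_funX.
    exact: measurable_integral_operator.
  - by move=> x Dx; rewrite lee_fin -(real_normK (num_real _)) lerXn2r ?nnegrE// KuB.
rewrite integral_cst//= [X in (_ * X)%E]lebesgue_measure_segment.
by rewrite EFinM.
Qed.

(** Homogeneity: u / s is in the unit ball. Taking s as a positive upper bound for the norm, rather
    than the norm, allows u = 0. *)
Lemma integral_operator_sq_le (op : R) (u : R -> R) (C s : R) :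
  (op_norm D K <= op%:E)%E -> 0 <= op -> measurable_fun D u ->
  (forall x, D x -> `|u x| <= C) -> 0 < s ->
  \int[mu]_(x in D) (u x ^+ 2) <= s ^+ 2 ->
  \int[mu]_(x in D) (integral_operator D K u x ^+ 2) <= op ^+ 2 * s ^+ 2.
Proof.
move=> hop op0 mu_ uC s0 us.
have C0 : 0 <= C.
  have Da : D a by rewrite /= in_itv/= lexx ltW.
  exact: le_trans (uC _ Da).
have mK_ := measurable_integral_operator mu_.
have sq_int (v : R -> R) (M : R) : measurable_fun D v ->
    (forall x, D x -> `|v x| <= M) -> mu.-integrable D (EFin \o (fun x => v x ^+ 2)).
  move=> mv vM; apply: (@bounded_integrable _ (M ^+ 2)); first exact: measurable_funX.
  move=> x Dx; rewrite normrX lerXn2r ?nnegrE//; last exact: vM.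
  exact: le_trans (vM x Dx).
have EFinR (v : R -> R) : mu.-integrable D (EFin \o v) ->
    (\int[mu]_(x in D) v x)%:E = (\int[mu]_(x in D) (v x)%:E)%E.
  by move=> iv; rewrite /Rintegral fineK//; exact: (@integrable_fin_num _ _ _ mu D mD _ iv).
pose v x := s^-1 * u x.
have mv : measurable_fun D v by exact: measurable_funM.
have nv : (L2norm D v <= 1)%E.
  apply/(Lnorm2_le _ _ _ ler01); rewrite expr1n.
  have -> : (\int[mu]_(x in D) (v x ^+ 2)%:E = (\int[mu]_(x in D) (s^-1 ^+ 2 * u x ^+ 2))%:E)%E.
    rewrite EFinR; first by apply: eq_integral => x _; rewrite /v exprMn.
    have := @integrableZl _ _ _ mu D mD (s^-1 ^+ 2) _ (sq_int u C mu_ uC).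
    by congr (_.-integrable _ _).
  rewrite (@RintegralZl _ _ _ mu)//; last exact: (sq_int u C).
  by rewrite lee_fin exprVn mulrC ler_pdivrMr ?exprn_gt0// mul1r.
have : (L2norm D (integral_operator D K v) <= op%:E)%E.
  apply: le_trans hop; apply: ereal_sup_ubound; exists v => //.
move=> /(Lnorm2_le _ _ _ op0) Kv.
have KvE x : D x -> integral_operator D K v x = s^-1 * integral_operator D K u x.
  move=> Dx; rewrite /integral_operator -(@RintegralZl _ _ _ mu)//.
    by apply: eq_Rintegral => z _; rewrite /v mulrCA.
  exact: integrable_operator_section uC.
have KuB x : D x -> `|integral_operator D K u x| <= kappa * C * L.
  move=> Dx; apply: Rintegral_segment_bound.
    exact: integrable_operator_section uC.
  by move=> z Dz; rewrite normrM ler_pM// ?boundK ?uC.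
have iKu := sq_int _ _ mK_ KuB.
have iKv : mu.-integrable D (EFin \o (fun x => integral_operator D K v x ^+ 2)).
  apply: (sq_int _ (s^-1 * (kappa * C * L))); first exact: measurable_integral_operator.
  move=> x Dx; rewrite KvE// normrM ger0_norm ?invr_ge0 ?(ltW s0)//.
  by rewrite ler_wpM2l ?invr_ge0 ?(ltW s0)// KuB.
have -> : \int[mu]_(x in D) (integral_operator D K u x ^+ 2) =
    s ^+ 2 * \int[mu]_(x in D) (integral_operator D K v x ^+ 2).
  rewrite -(@RintegralZl _ _ _ mu)//; apply: eq_Rintegral => x; rewrite inE => Dx.
  by rewrite KvE//; field; rewrite gt_eqF.
by rewrite mulrC ler_wpM2r ?sqr_ge0// -lee_fin EFinR.
Qed.

End operator.
End compact_interval.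

(** * The discrete trace against the operator norm and the L2 norm *)

Section trace_bound.
Context {R : realType}.
Variables (a b : R).
Hypothesis ltab : a < b.
Local Notation D := (`[a, b]%classic).
Local Notation mu := (@lebesgue_measure R).
Local Notation L := (b - a).

Let mD : measurable D. Proof. exact: measurable_itv. Qed.
Let L0 : 0 < L. Proof. by rewrite subr_gt0. Qed.

Lemma sqr_dist_le (x y M e : R) : `|x| <= M -> `|y| <= M -> `|x - y| <= e ->
  x ^+ 2 <= y ^+ 2 + 2 * M * e.
Proof.
move=> xM yM xye; rewrite -lerBlDl subr_sqr.
rewrite (le_trans (ler_norm _))// normrM mulrC.
rewrite ler_pM// (le_trans (ler_normD _ _))//.
by rewrite mulr_natl mulr2n lerD.
Qed.

Lemma measurable_inner_integral (h : R -> R -> R) :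
  measurable_fun (D `*` D) (fun p : R * R => h p.1 p.2) ->
  measurable_fun D (fun x => \int[mu]_(y in D) h x y).
Proof.
move=> mh.
apply: (@measurable_fun_Rintegral _ _ _ _ _ mu D D (fun y x => h x y)) => //.
apply: (@measurable_comp _ _ _ _ _ _ (D `*` D) (fun p : R * R => h p.1 p.2)
  (D `*` D) (fun p : R * R => (p.2, p.1))) => //.
- exact: measurableX.
- by move=> _ [p [p1 p2] <-].
- by apply: measurable_funTS; exact: measurable_swap.
Qed.

Lemma integrable_inner_sq (f : R -> R -> R) (M : R) :
  continuous_kernel D f -> (forall x y, D x -> D y -> `|f x y| <= M) ->
  (forall x, D x -> mu.-integrable D (EFin \o (fun y => f x y ^+ 2))) /\
  mu.-integrable D (EFin \o (fun x => \int[mu]_(y in D) (f x y ^+ 2))).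
Proof.
move=> cf fM; have mf := continuous_kernel_measurable ltab cf.
have Da : D a by rewrite /= in_itv/= lexx ltW.
have M0 : 0 <= M by exact: le_trans (fM a a Da Da).
have f2 x y : D x -> D y -> `|f x y ^+ 2| <= M ^+ 2.
  by move=> Dx Dy; rewrite normrX lerXn2r ?nnegrE ?fM.
have isec x : D x -> mu.-integrable D (EFin \o (fun y => f x y ^+ 2)).
  move=> Dx; apply: (@bounded_integrable _ _ _ ltab _ (M ^+ 2)).
    by apply: measurable_funX; exact: measurable_kernel_section.
  by move=> y Dy; exact: f2.
split=> //; apply: (@bounded_integrable _ _ _ ltab _ (M ^+ 2 * L)).
  by apply: measurable_inner_integral; exact: measurable_funX.
by move=> x Dx; apply: Rintegral_segment_bound => // [|y Dy]; [exact: isec|exact: f2].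
Qed.

Lemma integral_sq_le_L2norm (f : R -> R -> R) (M fn : R) :
  continuous_kernel D f -> (forall x y, D x -> D y -> `|f x y| <= M) ->
  0 <= fn -> (kernel_L2norm D f <= fn%:E)%E ->
  \int[mu]_(x in D) \int[mu]_(y in D) (f x y ^+ 2) <= fn ^+ 2.
Proof.
move=> cf fM fn0 hfn; have mf := continuous_kernel_measurable ltab cf.
have [isec iint] := integrable_inner_sq cf fM.
have mDD : measurable (D `*` D) by exact: measurableX.
pose F (p : measurableTypeR R * measurableTypeR R) : \bar R :=
  ((fun p : R * R => (f p.1 p.2 ^+ 2)%:E) \_ (D `*` D))%E p.
have mF : measurable_fun setT F.
  by apply/(measurable_restrictT _ mDD)/measurable_EFinP; exact: measurable_funX.
have F0 p : (0 <= F p)%E.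
  by rewrite /F patchE; case: ifP => // _; rewrite lee_fin sqr_ge0.
have Isec x : D x -> (\int[mu]_(y in D) (f x y ^+ 2)%:E =
    (\int[mu]_(y in D) (f x y ^+ 2))%:E)%E.
  move=> Dx; rewrite /Rintegral fineK//.
  exact: (@integrable_fin_num _ _ _ mu D mD _ (isec x Dx)).
have hF : (\int[mu]_x \int[mu]_y F (x, y) <= (fn ^+ 2)%:E)%E.
  rewrite -[leLHS](@fubini_tonelli1 _ _ _ _ _ mu mu F mF F0).
  have [h _] := @Lnorm2_le _ _ R (mu \x mu)%E (D `*` D) (fun p => f p.1 p.2) fn fn0.
  by have := h hfn; rewrite integral_mkcond.
have FE : (\int[mu]_x \int[mu]_y F (x, y) =
    \int[mu]_(x in D) (\int[mu]_(y in D) (f x y ^+ 2))%:E)%E.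
  rewrite [RHS]integral_mkcond; apply: eq_integral => x _.
  rewrite patchE; case: ifPn => [|]; rewrite ?inE ?notin_setE => Dx.
    rewrite -Isec// [RHS]integral_mkcond; apply: eq_integral => y _.
    rewrite /F !patchE; case: ifPn; case: ifPn => //; rewrite !inE ?notin_setE/=.
      by move=> nD [].
    by move=> Dy; case.
  apply: integral0_eq => y _; rewrite /F patchE memNset//.
  by move=> [].
rewrite -lee_fin; apply: le_trans hF; rewrite FE /Rintegral fineK//.
exact: (@integrable_fin_num _ _ _ mu D mD _ iint).
Qed.

Section partition.
Variables (N : nat) (idx : R -> 'I_N) (pt : 'I_N -> R).
Hypothesis mI : forall j, measurable (D `&` idx @^-1` [set j]).
Hypothesis ptD : forall j, D (pt j).
Local Notation w := (cell_weight a b idx).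

Lemma sum_cell_weight : \sum_j w j = L.
Proof.
have [_ h] := step_integral ltab mI (fun=> 1).
rewrite -[RHS]mul1r -(Rintegral_segment_cst ltab) h.
by apply: eq_bigr => j _; rewrite mulr1.
Qed.

Variables (f K : R -> R -> R) (M kappa eta : R).
Hypothesis cf : continuous_kernel D f.
Hypothesis cK : continuous_kernel D K.
Hypothesis symK : forall x y, D x -> D y -> K x y = K y x.
Hypothesis boundf : forall x y, D x -> D y -> `|f x y| <= M.
Hypothesis boundK : forall x y, D x -> D y -> `|K x y| <= kappa.
Hypothesis modf : forall x y, D x -> D y -> `|f x y - f (pt (idx x)) (pt (idx y))| <= eta.
Hypothesis modK : forall x y, D x -> D y -> `|K x y - K (pt (idx x)) (pt (idx y))| <= eta.
Hypothesis eta0 : 0 < eta.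
Variables (op fn : R).
Hypotheses (op0 : 0 <= op) (fn0 : 0 <= fn).
Hypothesis hop : (op_norm D K <= op%:E)%E.
Hypothesis hfn : (kernel_L2norm D f <= fn%:E)%E.

(** If A is the weighted matrix of f and S the covariance at the tags, then (AS)_ij = w_i U_ij. Up
    to a multiple of eta, row i of U is the operator with kernel K applied to the step function
    [u i], which is how the operator norm enters. *)
Let U i j := \sum_k w k * (f (pt i) (pt k) * K (pt k) (pt j)).
Let u i (z : R) := f (pt i) (pt (idx z)).

Let M0 : 0 <= M. Proof. exact: le_trans (boundf (ptD (idx a)) (ptD (idx a))). Qed.
Let kappa0 : 0 <= kappa. Proof. exact: le_trans (boundK (ptD (idx a)) (ptD (idx a))). Qed.

Let mu_ i : measurable_fun D (u i).
Proof. exact: (measurable_step mI (fun k => f (pt i) (pt k))). Qed.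

Let u_le i x : D x -> `|u i x| <= M.
Proof. by move=> _; exact: boundf. Qed.

Let KuU i y : D y -> `|integral_operator D K (u i) y - U i (idx y)| <= (eta * M) * L.
Proof.
move=> Dy.
have [iU eU] := step_integral ltab mI (fun k => f (pt i) (pt k) * K (pt k) (pt (idx y))).
rewrite /U -eU; apply: Rintegral_segment_dist => //.
  by apply: (@integrable_operator_section _ _ _ ltab _ kappa cK boundK (u i) M) => //; exact: u_le.
move=> z Dz /=; rewrite /u mulrC (symK (ptD _) (ptD _)) -mulrBr normrM mulrC.
by rewrite ler_pM// ?boundf// modK.
Qed.

Let Ku_le i y : D y -> `|integral_operator D K (u i) y| <= kappa * M * L.
Proof.
move=> Dy; apply: Rintegral_segment_bound => //.
  by apply: (@integrable_operator_section _ _ _ ltab _ kappa cK boundK (u i) M) => //; exact: u_le.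
by move=> z Dz; rewrite normrM ler_pM// ?boundK ?boundf.
Qed.

Let U_le i j : `|U i j| <= kappa * M * L.
Proof.
rewrite -sum_cell_weight mulr_sumr (le_trans (ler_norm_sum _ _ _))//.
apply: ler_sum => k _; rewrite normrM ger0_norm ?cell_weight_ge0// mulrC.
rewrite ler_wpM2r ?cell_weight_ge0// normrM mulrC.
by rewrite ler_pM// ?boundK ?boundf.
Qed.

Let e1 := 2 * (kappa * M * L) * (eta * M * L).

Let row_bound i : \sum_j w j * U i j ^+ 2 <=
  op ^+ 2 * (\sum_l w l * f (pt i) (pt l) ^+ 2 + eta) + e1 * L.
Proof.
have [iU eU] := step_integral ltab mI (fun j => U i j ^+ 2).
have mK := measurable_integral_operator ltab cK symK (mu_ i).
have iKu : mu.-integrable D (EFin \o (fun y => integral_operator D K (u i) y ^+ 2)).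
  apply: (@bounded_integrable _ _ _ ltab _ ((kappa * M * L) ^+ 2)).
    exact: measurable_funX.
  move=> x Dx; rewrite normrX lerXn2r ?nnegrE// ?Ku_le//.
  exact: le_trans (Ku_le i Dx).
have i1 : mu.-integrable D (EFin \o (fun=> e1)).
  by apply: (@bounded_integrable _ _ _ ltab _ `|e1|); [exact: measurable_cst|].
rewrite -eU; apply: (@le_trans _ _ (\int[mu]_(y in D)
    (integral_operator D K (u i) y ^+ 2 + e1))).
  apply: (@le_Rintegral _ _ _ mu) => //.
    have := @integrableD _ _ _ mu D mD _ _ iKu i1.
    by congr (_.-integrable _ _).
  move=> y Dy; apply: sqr_dist_le; [exact: U_le|exact: Ku_le|].
  by rewrite distrC KuU.
rewrite (@RintegralD _ _ _ mu)// (Rintegral_segment_cst ltab) lerD2r.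
have [iu2 eu2] := step_integral ltab mI (fun l => f (pt i) (pt l) ^+ 2).
set s2 := \sum_l _; have s20 : 0 <= s2.
  by apply: sumr_ge0 => l _; rewrite mulr_ge0 ?cell_weight_ge0 ?sqr_ge0.
(* Adding eta provides the positive radius required by [integral_operator_sq_le] even if the row of
   f vanishes. *)
have e20 : 0 < s2 + eta by rewrite ltr_wpDl.
rewrite -(sqr_sqrtr (ltW e20)).
apply: (integral_operator_sq_le ltab cK symK boundK hop op0 (mu_ i) (u_le i)).
  by rewrite sqrtr_gt0.
by rewrite (sqr_sqrtr (ltW e20)) /u eu2 lerDl ltW.
Qed.

Lemma trace_bound : \sum_i \sum_j w i * w j * U i j ^+ 2 <=
  op ^+ 2 * fn ^+ 2 + eta * (op ^+ 2 * (2 * M * L ^+ 2 + L) +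
     2 * kappa * M ^+ 2 * L ^+ 4).
Proof.
have w0 := cell_weight_ge0 a b idx.
apply: (@le_trans _ _ (\sum_i w i * (op ^+ 2 *
  (\sum_l w l * f (pt i) (pt l) ^+ 2 + eta) + e1 * L))).
  apply: ler_sum => i _; apply: le_trans (ler_wpM2l (w0 i) (row_bound i)).
  by rewrite mulr_sumr; under [leRHS]eq_bigr do rewrite mulrA.
have -> : \sum_i w i * (op ^+ 2 * (\sum_l w l * f (pt i) (pt l) ^+ 2 + eta) + e1 * L) =
   op ^+ 2 * (\sum_i w i * \sum_l w l * f (pt i) (pt l) ^+ 2) + (op ^+ 2 * eta + e1 * L) * L.
  rewrite -[in X in _ + _ * X]sum_cell_weight mulr_sumr mulr_sumr -big_split/=.
  by apply: eq_bigr => i _; ring.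
(* The remaining Riemann sum of f^2 is compared with the squared L2 norm through the modulus of
   continuity. *)
have step2 : \sum_i w i * (\sum_l w l * f (pt i) (pt l) ^+ 2) <=
    fn ^+ 2 + 2 * M * eta * L ^+ 2.
  have [i1 e1_] := step_integral ltab mI (fun i => \sum_l w l * f (pt i) (pt l) ^+ 2).
  have [isec iint] := integrable_inner_sq cf boundf.
  have ic (c : R) : mu.-integrable D (EFin \o (fun=> c)).
    by apply: (@bounded_integrable _ _ _ ltab _ `|c|); [exact: measurable_cst|].
  rewrite -e1_; apply: (@le_trans _ _ (\int[mu]_(x in D)
     (\int[mu]_(y in D) (f x y ^+ 2) + 2 * M * eta * L))).
    apply: (@le_Rintegral _ _ _ mu) => //.
      have := @integrableD _ _ _ mu D mD _ _ iint (ic (2 * M * eta * L)).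
      by congr (_.-integrable _ _).
    move=> x Dx; have [i2 e2] := step_integral ltab mI (fun l => f (pt (idx x)) (pt l) ^+ 2).
    rewrite -e2 -(Rintegral_segment_cst ltab) -(@RintegralD _ _ _ mu)//; last exact: isec.
    apply: (@le_Rintegral _ _ _ mu) => //.
      have := @integrableD _ _ _ mu D mD _ _ (isec x Dx) (ic (2 * M * eta)).
      by congr (_.-integrable _ _).
    move=> y Dy; apply: sqr_dist_le; [exact: boundf|exact: boundf|].
    by rewrite distrC modf.
  rewrite (@RintegralD _ _ _ mu)// (Rintegral_segment_cst ltab) expr2 mulrA lerD2r.
  exact: (integral_sq_le_L2norm cf boundf).
rewrite /e1; have := ler_wpM2l (sqr_ge0 op) step2.
rewrite (_ : eta * (op ^+ 2 * (2 * M * L ^+ 2 + L) + 2 * kappa * M ^+ 2 * L ^+ 4) =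
  op ^+ 2 * (2 * M * eta * L ^+ 2) +
  (op ^+ 2 * eta + 2 * (kappa * M * L) * (eta * M * L) * L) * L); last by ring.
by rewrite addrA lerD2r mulrDr.
Qed.

End partition.
End trace_bound.

(** * Second moments and generating functions of a Gaussian process *)

Lemma psd_kernel_sym (R : realType) (D : set R) (K : R -> R -> R) :
  psd_kernel D K -> forall x y, D x -> D y -> K x y = K y x.
Proof.
move=> psdK x y Dx Dy; pose z (i : 'I_2) := if i == ord0 then x else y.
have Dz i : D (z i) by rewrite /z; case: ifP.
have [/matrixP/(_ ord_max ord0) + _] := psdK 2 z Dz.
by rewrite !mxE /z.
Qed.

Section gaussian_process_moments.
Context {d : measure_display} {T : measurableType d} {R : realType}.
Variables (P : probability T R) (D : set R) (K : R -> R -> R) (g : R -> T -> R).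
Hypothesis gp : gaussian_process P D K g.

Let gp1 x : D x -> gaussian_rv P (g x).
Proof.
move=> Dx; have := gp_gaussian gp (n := 1) (x := fun=> x) (fun=> 1) (fun=> Dx).
by congr gaussian_rv; apply/funext => w; rewrite big_ord1 mul1r.
Qed.

Lemma gp_measurable_sample x : D x -> measurable_fun setT (g x).
Proof. by move=> /gp1[]. Qed.

Let gp_mgf0 (n : nat) (x c : 'I_n -> R) : (forall i, D (x i)) ->
  gauss_mgf P (fun w => \sum_i c i * g (x i) w)
    (\int[P]_w ((\sum_i c i * g (x i) w) ^+ 2)).
Proof.
move=> Dx; apply: gaussian_rv_gauss_mgf; first exact: (gp_gaussian gp).
have ig i : P.-integrable setT (EFin \o g (x i)).
  exact: gaussian_rv_integrable (gp1 (Dx i)).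
have icg i : P.-integrable setT (EFin \o (fun w => c i * g (x i) w)).
  have := integrableZl measurableT (c i) (ig i).
  by congr (_.-integrable _ _).
rewrite Rintegral_sum// big1// => i _; rewrite RintegralZl//.
by have := gp_centered gp (Dx i); rewrite unlock /Rintegral => ->; rewrite mulr0.
Qed.

(** The covariance axiom gives the value of an expectation but not integrability. The latter comes
    from 2uv = (u+v)^2 - u^2 - v^2, squares of Gaussian combinations being integrable. *)
Lemma gp_product x y : D x -> D y ->
  P.-integrable setT (EFin \o (fun w => g x w * g y w)) /\
  \int[P]_w (g x w * g y w) = K x y.
Proof.
move=> Dx Dy; split; last first.
  by have := gp_covariance gp Dx Dy; rewrite unlock /Rintegral => ->.
have i2 (cx cy : R) : P.-integrable setT (EFin \o (fun w => (cx * g x w + cy * g y w) ^+ 2)).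
  pose z (i : 'I_2) := if i == ord0 then x else y.
  pose c (i : 'I_2) := if i == ord0 then cx else cy.
  have Dz i : D (z i) by rewrite /z; case: ifP.
  have := gauss_mgf_integrableX (gp_mgf0 c Dz) 2.
  congr (_.-integrable _ _); apply/funext => w /=.
  by rewrite !big_ord_recl big_ord0 addr0.
have := integrableZl measurableT (2^-1) (integrableB measurableT (i2 1 1)
   (integrableD measurableT (i2 1 0) (i2 0 1))).
congr (_.-integrable _ _); apply/funext => w /=.
rewrite -!(EFinD,EFinB,EFinM); congr EFin; by field.
Qed.

Lemma gp_gauss_mgf (n : nat) (x : 'I_n -> R) (c : 'I_n -> R) :
  (forall i, D (x i)) ->
  gauss_mgf P (fun w => \sum_i c i * g (x i) w)
    (quad_form (fun i j => K (x i) (x j)) c c).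
Proof.
move=> Dx; have := gp_mgf0 c Dx; congr gauss_mgf.
have ig i j : P.-integrable setT
    (EFin \o (fun w => K (x i) (x j) * 0 + (c i * c j) * (g (x i) w * g (x j) w))).
  have := integrableZl measurableT (c i * c j) (gp_product (Dx i) (Dx j)).1.
  by congr (_.-integrable _ _); apply/funext => w /=; rewrite mulr0 add0r.
transitivity (\int[P]_w \sum_i \sum_j
    (K (x i) (x j) * 0 + (c i * c j) * (g (x i) w * g (x j) w))).
  apply: eq_Rintegral => w _; rewrite expr2 mulr_suml; apply: eq_bigr => i _.
  by rewrite mulr_sumr; apply: eq_bigr => j _; ring.
rewrite Rintegral_sum//; last by move=> i; exact: integrable_sumR.
apply: eq_bigr => i _; rewrite Rintegral_sum//; apply: eq_bigr => j _.
have [i2 e2] := gp_product (Dx i) (Dx j).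
under eq_Rintegral do rewrite mulr0 add0r.
by rewrite RintegralZl// e2 mulrC.
Qed.

End gaussian_process_moments.

(** * Discretisation error of the quadratic functional *)

Section quadratic_functional.
Context {R : realType}.
Variables (a b : R).
Hypothesis ltab : a < b.
Local Notation D := (`[a, b]%classic).
Local Notation mu := (@lebesgue_measure R).
Local Notation L := (b - a).

Let mD : measurable D. Proof. exact: measurable_itv. Qed.
Let L0 : 0 < L. Proof. by rewrite subr_gt0. Qed.

Let ic (c : R) : mu.-integrable D (EFin \o (fun=> c)).
Proof. by apply: (@bounded_integrable _ _ _ ltab _ `|c|); [exact: measurable_cst|]. Qed.

Let le_int (phi H : R -> R) : measurable_fun D phi -> mu.-integrable D (EFin \o H) ->
  (forall x, D x -> `|phi x| <= H x) ->
  mu.-integrable D (EFin \o phi) /\ `|\int[mu]_(x in D) phi x| <= \int[mu]_(x in D) H x.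
Proof.
move=> mphi iH hle.
have iphi : mu.-integrable D (EFin \o phi).
  apply: (@le_integrable _ _ _ mu D mD _ _ _ _ iH); first exact/measurable_EFinP.
  by move=> x Dx /=; rewrite lee_fin (le_trans (hle x Dx))// ler_norm.
split=> //; rewrite (le_trans (@le_normr_Rintegral _ _ _ mu D _ mD iphi))//.
apply: (@le_Rintegral _ _ _ mu) => //.
exact: (@integrable_norm _ _ _ mu D _ iphi).
Qed.

Let int_affine (H : R -> R) (c k e : R) : mu.-integrable D (EFin \o H) ->
  mu.-integrable D (EFin \o (fun x => c * (H x * k + e))) /\
  \int[mu]_(x in D) (c * (H x * k + e)) = c * ((\int[mu]_(x in D) H x) * k + e * L).
Proof.
move=> iH.
have i1 : mu.-integrable D (EFin \o (fun x => H x * k)).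
  have := @integrableZl _ _ _ mu D mD k _ iH.
  by congr (_.-integrable _ _); apply/funext => x /=; rewrite mulrC.
have i2 : mu.-integrable D (EFin \o (fun x => H x * k + e)).
  have := @integrableD _ _ _ mu D mD _ _ i1 (ic e).
  by congr (_.-integrable _ _).
split.
  have := @integrableZl _ _ _ mu D mD c _ i2.
  by congr (_.-integrable _ _).
rewrite (@RintegralZl _ _ _ mu)// (@RintegralD _ _ _ mu)// (@RintegralZr _ _ _ mu)//.
by rewrite (Rintegral_segment_cst ltab).
Qed.

(** H plays two roles: it bounds the difference, and up to c it dominates each integrand so that
    both double integrals can be subtracted. For a path where H has infinite integral the bound is
    trivial, so it holds for every path. *)
Lemma double_integral_dist (phi psi : R -> R -> R) (H : R -> R) (c : R) :
  measurable_fun (D `*` D) (fun p : R * R => phi p.1 p.2) ->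
  measurable_fun (D `*` D) (fun p : R * R => psi p.1 p.2) ->
  measurable_fun D H -> (forall x, 0 <= H x) ->
  (forall x y, D x -> D y -> `|phi x y| <= c * (H x + H y)) ->
  (forall x y, D x -> D y -> `|psi x y| <= c * (H x + H y)) ->
  (forall x y, D x -> D y -> `|phi x y - psi x y| <= H x + H y) ->
  (`|\int[mu]_(y in D) \int[mu]_(x in D) phi x y -
     \int[mu]_(y in D) \int[mu]_(x in D) psi x y|%:E <=
   (2 * L)%:E * \int[mu]_(x in D) (H x)%:E)%E.
Proof.
move=> mphi mpsi mH H0 phiH psiH dH.
have [Hy|Hy] := ltP (\int[mu]_(x in D) (H x)%:E)%E +oo%E; last first.
  move: Hy; rewrite leye_eq => /eqP ->.
  by rewrite gt0_muley ?leey// lte_fin mulr_gt0.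
have iH : mu.-integrable D (EFin \o H).
  apply/integrableP; split; first exact/measurable_EFinP.
  by under eq_integral do rewrite /= ger0_norm//.
have EH : (\int[mu]_(x in D) (H x)%:E = (\int[mu]_(x in D) H x)%:E)%E.
  by rewrite /Rintegral fineK//; exact: (@integrable_fin_num _ _ _ mu D mD _ iH).
rewrite EH -EFinM lee_fin.
have msec (h : R -> R -> R) y : D y -> measurable_fun (D `*` D) (fun p : R * R => h p.1 p.2) ->
    measurable_fun D (h ^~ y).
  move=> Dy mh; apply: (@measurable_comp _ _ _ _ _ _ (D `*` D)
    (fun p : R * R => h p.1 p.2) D (fun x => (x, y))) => //.
  - exact: measurableX.
  - by move=> _ [z Dz <-].
  - by apply: measurable_funTS; exact: measurable_pair2.
have inner (h : R -> R -> R) (k : R) : measurable_fun (D `*` D) (fun p : R * R => h p.1 p.2) ->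
   (forall x y, D x -> D y -> `|h x y| <= k * (H x + H y)) ->
   [/\ forall y, D y -> mu.-integrable D (EFin \o h ^~ y),
      mu.-integrable D (EFin \o (fun y => \int[mu]_(x in D) h x y)) &
      `|\int[mu]_(y in D) \int[mu]_(x in D) h x y| <= k * (2 * L * \int[mu]_(x in D) H x)].
  move=> mh hk.
  have sec y : D y -> mu.-integrable D (EFin \o h ^~ y) /\
     `|\int[mu]_(x in D) h x y| <= k * (H y * L + \int[mu]_(x in D) H x).
    move=> Dy; have [i1 e1] := int_affine k 1 (H y) iH.
    have [] := le_int (msec h y Dy mh) i1.
      by move=> x Dx; rewrite mulr1 hk.
    by rewrite e1 mulr1 [in X in _ -> X]addrC => ih hb; split.
  have [i2 e2] := int_affine k L (\int[mu]_(x in D) H x) iH.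
  have mh2 : measurable_fun D (fun y => \int[mu]_(x in D) h x y).
    exact: (@measurable_fun_Rintegral _ _ _ _ _ mu D D h).
  have [i3 b3] := le_int mh2 i2 (fun y Dy => (sec y Dy).2).
  split=> // [y Dy|]; first exact: (sec y Dy).1.
  by rewrite (le_trans b3)// e2 le_eqVlt; apply/orP; left; apply/eqP; ring.
have [sphi iphi _] := inner phi c mphi phiH.
have [spsi ipsi _] := inner psi c mpsi psiH.
have md : measurable_fun (D `*` D) (fun p : R * R => phi p.1 p.2 - psi p.1 p.2).
  exact: measurable_funB.
have dH1 x y : D x -> D y -> `|phi x y - psi x y| <= 1 * (H x + H y).
  by move=> Dx Dy; rewrite mul1r dH.
have [_ _] := inner (fun x y => phi x y - psi x y) 1 md dH1.
rewrite mul1r => /(le_trans _); apply.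
rewrite -(@RintegralB _ _ _ mu)// le_eqVlt; apply/orP; left; apply/eqP.
congr `|_|; apply: eq_Rintegral => y; rewrite inE => Dy.
by rewrite (@RintegralB _ _ _ mu)//; [exact: sphi|exact: spsi].
Qed.

End quadratic_functional.

Section discretization.
Context {R : realType}.
Variables (a b : R).
Hypothesis ltab : a < b.
Local Notation D := (`[a, b]%classic).
Local Notation mu := (@lebesgue_measure R).
Local Notation L := (b - a).
Let mD : measurable D. Proof. exact: measurable_itv. Qed.
Let L0 : 0 < L. Proof. by rewrite subr_gt0. Qed.

Context {d : measure_display} {T : measurableType d}.
Variables (P : probability T R) (f K : R -> R -> R) (g : R -> T -> R).
Hypothesis gp : gaussian_process P D K g.
Hypothesis cf : continuous_kernel D f.

Definition quadratic_functional (w : T) : R :=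
  \int[mu]_(y in D) \int[mu]_(x in D) (g x w * f x y * g y w).

Local Notation Q := quadratic_functional.

Let mDT : measurable (D `*` [set: T]). Proof. exact: measurableX. Qed.

Let mg := gp_measurable gp.

Lemma measurable_quadratic_functional : measurable_fun setT Q.
Proof.
have comp_g (d' : measure_display) (T' : measurableType d') (B : set T')
    (u : T' -> R) (v : T' -> T) : measurable_fun setT u -> measurable_fun setT v ->
    (forall z, B z -> D (u z)) -> measurable_fun B (fun z => g (u z) (v z)).
  move=> mu_ mv uD; apply: (@measurable_comp _ _ _ _ _ _ (D `*` [set: T])
    (fun p : R * T => g p.1 p.2) B (fun z => (u z, v z))) => //.
  - by move=> _ [z Bz <-]; split => //; exact: uD.
  - by apply: measurable_funTS; exact: measurable_fun_pair.
have mf := continuous_kernel_measurable ltab cf.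
have inner : measurable_fun (D `*` [set: T]) (fun q : R * T =>
    \int[mu]_(x in D) (g x q.2 * f x q.1 * g q.1 q.2)).
  apply: (@measurable_fun_Rintegral _ _ _ _ _ mu D (D `*` [set: T])
    (fun x q => g x q.2 * f x q.1 * g q.1 q.2)) => //.
  have m1 : measurable_fun setT (fun p : R * (R * T) => p.1) by exact: measurable_fst.
  have m2 : measurable_fun setT (fun p : R * (R * T) => p.2.1).
    exact: (measurableT_comp measurable_fst measurable_snd).
  have m3 : measurable_fun setT (fun p : R * (R * T) => p.2.2).
    exact: (measurableT_comp measurable_snd measurable_snd).
  apply: measurable_funM; first apply: measurable_funM.
  - by apply: comp_g => // -[x [y w]] [/= Dx [Dy _]].
  - apply: (@measurable_comp _ _ _ _ _ _ (D `*` D) (fun p : R * R => f p.1 p.2)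
      (D `*` (D `*` [set: T])) (fun p => (p.1, p.2.1))) => //.
    + exact: measurableX.
    + by move=> _ [[x [y w]] [/= Dx [Dy _]] <-].
    + by apply: measurable_funTS; exact: measurable_fun_pair.
  - by apply: comp_g => // -[x [y w]] [/= Dx [Dy _]].
exact: (@measurable_fun_Rintegral _ _ _ _ _ mu D [set: T] (fun y w =>
    \int[mu]_(x in D) (g x w * f x y * g y w))).
Qed.

Variables (N : nat) (idx : R -> 'I_N) (pt : 'I_N -> R).
Hypothesis mI : forall j, measurable (D `&` idx @^-1` [set j]).
Hypothesis ptD : forall j, D (pt j).
Local Notation wt := (cell_weight a b idx).

Definition discrete_kernel (j k : 'I_N) : R := wt j * wt k * f (pt j) (pt k).

Definition discrete_functional (w : T) : R :=
  quad_form discrete_kernel (fun j => g (pt j) w) (fun j => g (pt j) w).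

Local Notation Qn := discrete_functional.

Lemma discrete_functionalE w : Qn w =
  \int[mu]_(y in D) \int[mu]_(x in D)
    (g (pt (idx x)) w * f (pt (idx x)) (pt (idx y)) * g (pt (idx y)) w).
Proof.
pose phi k := \sum_j wt j * (g (pt j) w * f (pt j) (pt k) * g (pt k) w).
transitivity (\int[mu]_(y in D) phi (idx y)); last first.
  apply: eq_Rintegral => y _.
  have [_ ->] := step_integral ltab mI
    (fun j => g (pt j) w * f (pt j) (pt (idx y)) * g (pt (idx y)) w).
  by [].
have [_ ->] := step_integral ltab mI phi.
rewrite /discrete_functional /quad_form exchange_big; apply: eq_bigr => k _.
rewrite /phi mulr_sumr; apply: eq_bigr => j _.
by rewrite /discrete_kernel; ring.
Qed.

Variables (M kappa eta r : R).
Hypothesis boundf : forall x y, D x -> D y -> `|f x y| <= M.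
Hypothesis boundK : forall x y, D x -> D y -> `|K x y| <= kappa.
Hypothesis modf : forall x y, D x -> D y -> `|f x y - f (pt (idx x)) (pt (idx y))| <= eta.
Hypothesis modK : forall x, D x ->
  K x x + K (pt (idx x)) (pt (idx x)) - 2 * K x (pt (idx x)) <= 2 * eta.
Hypotheses (r0 : 0 < r) (r1 : r <= 1) (etar2 : eta <= r ^+ 2).

Let M0 : 0 <= M. Proof. exact: le_trans (boundf (ptD (idx a)) (ptD (idx a))). Qed.

Let etar : eta <= r.
Proof. by rewrite (le_trans etar2)// expr2 ler_piMr// ltW. Qed.

(** Young's inequality with parameter r separates values from increments. An increment has variance
    K x x + K x' x' - 2 K x x' <= 2 eta <= 2 r^2, so even after division by r the mean of H is
    O(r). *)
Let H (x : R) (w : T) : R := (M + 1) *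
  (r * (g x w ^+ 2 + g (pt (idx x)) w ^+ 2) + r^-1 * (g x w - g (pt (idx x)) w) ^+ 2).

Let H0 x w : 0 <= H x w.
Proof.
rewrite /H mulr_ge0 ?addr_ge0// mulr_ge0 ?invr_ge0 ?(ltW r0)//; last exact: sqr_ge0.
by rewrite addr_ge0// sqr_ge0.
Qed.

Let mH : measurable_fun (D `*` [set: T]) (fun p : R * T => H p.1 p.2).
Proof.
have mgh : measurable_fun (D `*` [set: T]) (fun p : R * T => g (pt (idx p.1)) p.2).
  apply: (eq_measurable_fun (fun p : R * T =>
    \sum_j \1_(D `&` idx @^-1` [set j]) p.1 * g (pt j) p.2)).
    move=> [x w]; rewrite inE => -[/= Dx _].
    rewrite (bigD1 (idx x))//= indicE mem_set// mul1r big1 ?addr0//.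
    by move=> j jx; rewrite indicE memNset ?mul0r// => -[_ /= e]; rewrite e eqxx in jx.
  apply: measurable_funTS; apply: measurable_sum => j; apply: measurable_funM.
    apply: (@measurableT_comp _ _ _ _ _ _ (\1_(D `&` idx @^-1` [set j]) : R -> R) _ fst).
      by apply: measurable_indic; exact: mI.
    exact: measurable_fst.
  exact: (measurableT_comp (gp_measurable_sample gp (ptD j)) measurable_snd).
apply: measurable_funM => //; apply: measurable_funD; apply: measurable_funM => //.
  by apply: measurable_funD; exact: measurable_funX.
by apply: measurable_funX; exact: measurable_funB.
Qed.

Let msec (h : R -> T -> R) w :
  measurable_fun (D `*` [set: T]) (fun p : R * T => h p.1 p.2) -> measurable_fun D (h ^~ w).
Proof.
move=> mh; apply: (@measurable_comp _ _ _ _ _ _ (D `*` [set: T])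
    (fun p : R * T => h p.1 p.2) D (fun x => (x, w))) => //.
- by move=> _ [z Dz <-].
- by apply: measurable_funTS; exact: measurable_pair2.
Qed.

Let young (u v c : R) : `|c| <= M -> `|c * u * v| <= M * (r * v ^+ 2 / 2 + r^-1 * u ^+ 2 / 2).
Proof.
move=> cM; rewrite -mulrA normrM ler_pM//.
rewrite normrM -(real_normK (num_real u)) -(real_normK (num_real v)).
move: `|u| `|v| => x y.
rewrite -subr_ge0 (_ : _ - _ = r / 2 * (y - r^-1 * x) ^+ 2); last by field; rewrite gt_eqF.
by rewrite mulr_ge0 ?sqr_ge0// divr_ge0// ltW.
Qed.

Lemma discretization_error w :
  (`|Q w - Qn w|%:E <= (2 * L)%:E * \int[mu]_(x in D) (H x w)%:E)%E.
Proof.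
have mgw : measurable_fun D (g ^~ w) by exact: msec.
have mf := continuous_kernel_measurable ltab cf.
have m1 (u : R -> R) : measurable_fun D u -> measurable_fun (D `*` D) (fun p : R * R => u p.1).
  move=> mu_; apply: (@measurable_comp _ _ _ _ _ _ D u (D `*` D) fst) => //.
  - by move=> _ [p [p1 p2] <-].
  - by apply: measurable_funTS; exact: measurable_fst.
have m2 (u : R -> R) : measurable_fun D u -> measurable_fun (D `*` D) (fun p : R * R => u p.2).
  move=> mu_; apply: (@measurable_comp _ _ _ _ _ _ D u (D `*` D) snd) => //.
  - by move=> _ [p [p1 p2] <-].
  - by apply: measurable_funTS; exact: measurable_snd.
have gf (x : R) (c : R) : `|c| <= M -> forall u v : R,
   `|u * c * v| <= M * (u ^+ 2 / 2 + v ^+ 2 / 2).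
  move=> cM u v; rewrite mulrAC normrM mulrC ler_pM//.
  rewrite normrM -(real_normK (num_real u)) -(real_normK (num_real v)).
  by have := sqr_ge0 (`|u| - `|v|); lra.
have r2 z : 0 <= r^-1 * z ^+ 2 by rewrite mulr_ge0 ?sqr_ge0// invr_ge0 ltW.
have Hg x (z : R) : z ^+ 2 <= g x w ^+ 2 + g (pt (idx x)) w ^+ 2 ->
    (M + 1) * z ^+ 2 <= r^-1 * H x w.
  move=> zle; rewrite /H [leRHS]mulrCA ler_wpM2l ?addr_ge0// mulrDr mulrA mulVf ?gt_eqF// mul1r.
  by rewrite (le_trans zle)// lerDl mulr_ge0 ?invr_ge0 ?(ltW r0).
have gle x : g x w ^+ 2 <= g x w ^+ 2 + g (pt (idx x)) w ^+ 2 by rewrite lerDl sqr_ge0.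
have hle x : g (pt (idx x)) w ^+ 2 <= g x w ^+ 2 + g (pt (idx x)) w ^+ 2 by rewrite lerDr sqr_ge0.
rewrite discrete_functionalE.
(* The factor r^-1 cancels the r in front of the squared values in H, which then dominate both
   integrands. *)
apply: (double_integral_dist ltab (H := H ^~ w) (c := r^-1)).
- by apply: measurable_funM; [apply: measurable_funM => //; exact: (m1 (g ^~ w))|exact: (m2 (g ^~ w))].
- exact: (measurable_step2 mI (fun j k => g (pt j) w * f (pt j) (pt k) * g (pt k) w)).
- exact: msec.
- by [].
- move=> x y Dx Dy; have := gf x _ (boundf Dx Dy) (g x w) (g y w).
  have := Hg x _ (gle x); have := Hg y _ (gle y).
  have := sqr_ge0 (g x w); have := sqr_ge0 (g y w).
  move: (g x w ^+ 2) (g y w ^+ 2) => X Y X0 Y0 h1 h2 h3; rewrite mulrDr.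
  by have := mulr_ge0 M0 X0; have := mulr_ge0 M0 Y0; lra.
- move=> x y Dx Dy.
  have := gf x _ (boundf (ptD (idx x)) (ptD (idx y))) (g (pt (idx x)) w) (g (pt (idx y)) w).
  have := Hg x _ (hle x); have := Hg y _ (hle y).
  have := sqr_ge0 (g (pt (idx x)) w); have := sqr_ge0 (g (pt (idx y)) w).
  move: (g (pt (idx x)) w ^+ 2) (g (pt (idx y)) w ^+ 2) => X Y X0 Y0 h1 h2 h3; rewrite mulrDr.
  by have := mulr_ge0 M0 X0; have := mulr_ge0 M0 Y0; lra.
move=> x y Dx Dy.
set u := g x w; set v := g y w; set u' := g (pt (idx x)) w; set v' := g (pt (idx y)) w.
set c := f x y; set c' := f (pt (idx x)) (pt (idx y)).
(* Telescoping: the first term uses the modulus of f, the other two pair one increment with one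
   value and go through [young]. *)
have -> : u * c * v - u' * c' * v' = u * (c - c') * v + c' * (u - u') * v + c' * (v - v') * u' by ring.
have h1 : `|u * (c - c') * v| <= r * (u ^+ 2 / 2 + v ^+ 2 / 2).
  rewrite mulrAC normrM mulrC ler_pM//; first exact: le_trans (modf Dx Dy) etar.
  rewrite normrM -(real_normK (num_real u)) -(real_normK (num_real v)).
  by have := sqr_ge0 (`|u| - `|v|); lra.
have c'M : `|c'| <= M by exact: boundf.
have h2 := young (u - u') v c'M; have h3 := young (v - v') u' c'M.
rewrite (le_trans (ler_normD _ _))// (le_trans (lerD (ler_normD _ _) (lexx _)))//.
rewrite (le_trans (lerD (lerD h1 h2) h3))// /H -/u -/v -/u' -/v'.
have ru := mulr_ge0 (ltW r0) (sqr_ge0 u); have rv := mulr_ge0 (ltW r0) (sqr_ge0 v).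
have ru' := mulr_ge0 (ltW r0) (sqr_ge0 u'); have rv' := mulr_ge0 (ltW r0) (sqr_ge0 v').
have Mru := mulr_ge0 M0 ru; have Mrv := mulr_ge0 M0 rv.
have Mru' := mulr_ge0 M0 ru'; have Mrv' := mulr_ge0 M0 rv'.
have d1 := r2 (u - u'); have d2 := r2 (v - v').
have Md1 := mulr_ge0 M0 d1; have Md2 := mulr_ge0 M0 d2.
move: ru rv ru' rv' Mru Mrv Mru' Mrv' d1 d2 Md1 Md2.
rewrite !mulrDr !mulrDl !mul1r.
move: (u ^+ 2) (v ^+ 2) (u' ^+ 2) (v' ^+ 2) => U V U' V'.
by lra.
Qed.

Let EH x : D x -> (\int[P]_w (H x w)%:E <= ((M + 1) * (2 * kappa + 2) * r)%:E)%E.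
Proof.
move=> Dx; set x' := pt (idx x); have Dx' : D x' by exact: ptD.
have [i1 e1] := gp_product gp Dx Dx; have [i2 e2] := gp_product gp Dx' Dx'.
have [i3 e3] := gp_product gp Dx Dx'.
have iZ (c : R) (h : T -> R) : P.-integrable setT (EFin \o h) ->
    P.-integrable setT (EFin \o (fun w => c * h w)).
  move=> ih; have := integrableZl measurableT c ih.
  by congr (_.-integrable _ _).
pose c1 := (M + 1) * (r + r^-1); pose c3 := (M + 1) * (- 2 * r^-1).
have HE w : H x w = (c1 * (g x w * g x w) + c1 * (g x' w * g x' w)) + c3 * (g x w * g x' w).
  by rewrite /H -/x' /c1 /c3; ring.
have i12 : P.-integrable setT (EFin \o (fun w => c1 * (g x w * g x w) + c1 * (g x' w * g x' w))).
  have := integrableD measurableT (iZ c1 _ i1) (iZ c1 _ i2).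
  by congr (_.-integrable _ _).
have iHx : P.-integrable setT (EFin \o H x).
  have := integrableD measurableT i12 (iZ c3 _ i3).
  by congr (_.-integrable _ _); apply/funext => w /=; rewrite HE.
rewrite -EFin_Rintegral// lee_fin; under eq_Rintegral do rewrite HE.
rewrite (RintegralD measurableT i12 (iZ c3 _ i3)).
rewrite (RintegralD measurableT (iZ c1 _ i1) (iZ c1 _ i2)).
rewrite !RintegralZl// e1 e2 e3.
have -> : c1 * K x x + c1 * K x' x' + c3 * K x x' = (M + 1) *
    (r * (K x x + K x' x') + r^-1 * (K x x + K x' x' - 2 * K x x')).
  by rewrite /c1 /c3; ring.
rewrite -[leRHS]mulrA ler_wpM2l ?addr_ge0// [leRHS]mulrDl lerD//.
  rewrite mulrC ler_wpM2r ?(ltW r0)// mulr_natl mulr2n lerD//;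
  by rewrite (le_trans (ler_norm _))// boundK.
rewrite mulrC ler_pdivrMr// (le_trans (modK Dx))// -mulrA ler_wpM2l//.
Qed.

Lemma mean_discretization_error :
  (\int[P]_w `|Q w - Qn w|%:E <= (2 * L ^+ 2 * ((M + 1) * (2 * kappa + 2) * r))%:E)%E.
Proof.
have mQn : measurable_fun setT Qn.
  apply: measurable_sum => j; apply: measurable_sum => k; apply: measurable_funM => //.
  by apply: measurable_funM; exact: (gp_measurable_sample gp (ptD _)).
pose F (p : measurableTypeR R * T) : \bar R := ((fun p : R * T => (H p.1 p.2)%:E) \_ (D `*` setT))%E p.
have mF : measurable_fun setT F.
  by apply/(measurable_restrictT _ mDT)/measurable_EFinP.
have F0 p : (0 <= F p)%E by rewrite /F patchE; case: ifP => // _; rewrite lee_fin.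
have FE w : (\int[mu]_(x in D) (H x w)%:E = \int[mu]_x F (x, w))%E.
  rewrite integral_mkcond; apply: eq_integral => x _; rewrite /F !patchE.
  case: ifPn; case: ifPn => //; rewrite !inE ?notin_setE/=; last by move=> [].
  by move=> nD Dx; case: nD.
have FE2 x : D x -> (\int[P]_w F (x, w) = \int[P]_w (H x w)%:E)%E.
  by move=> Dx; apply: eq_integral => w _; rewrite /F patchE mem_set.
have mG := @measurable_fun_fubini_tonelli_G _ _ _ _ _ mu F mF F0.
apply: (@le_trans _ _ (\int[P]_w ((2 * L)%:E * \int[mu]_x F (x, w)))%E).
  apply: ge0_le_integral => //=.
  - apply/measurable_EFinP; apply: measurableT_comp => //.
    by apply: measurable_funB => //; exact: measurable_quadratic_functional.
  - by apply: emeasurable_funM.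
  - by move=> w _; rewrite -FE; exact: discretization_error.
rewrite ge0_integralZl//=; last first.
- by rewrite lee_fin mulr_ge0// ltW.
- by move=> w _; exact: integral_ge0.
rewrite -(@fubini_tonelli _ _ _ _ _ mu P F mF F0).
rewrite (_ : 2 * L ^+ 2 * _ = (2 * L) * ((M + 1) * (2 * kappa + 2) * r * L)); last by ring.
rewrite [leRHS]EFinM; apply: lee_wpmul2l; first by rewrite lee_fin mulr_ge0// ltW.
apply: (@le_trans _ _ (\int[mu]_(x in D) ((M + 1) * (2 * kappa + 2) * r)%:E)%E); last first.
  by rewrite integral_cst// [X in (_ * X)%E](lebesgue_measure_segment ltab) EFinM.
rewrite [leRHS]integral_mkcond; apply: ge0_le_integral => //=.
- by move=> x _; exact: integral_ge0.
- exact: (@measurable_fun_fubini_tonelli_F _ _ _ _ _ P F mF F0).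
- by apply/(measurable_restrictT _ mD); exact: measurable_cst.
move=> x _; rewrite patchE; case: ifPn; rewrite ?inE ?notin_setE => Dx.
  by rewrite FE2//; exact: EH.
rewrite integral0_eq// => w _; rewrite /F patchE memNset//.
by move=> -[].
Qed.

End discretization.

(** * Discrete functionals as events of one process, and finiteness of the kernel norm *)

Section process_sigma_algebra.
Context {d : measure_display} {T : measurableType d} {R : realType}.
Variables (P : probability T R) (D : set R) (K : R -> R -> R) (g : R -> T -> R).
Hypothesis gp : gaussian_process P D K g.

Lemma process_sigma_measurable A : process_sigma D g A -> measurable A.
Proof.
apply: smallest_sub; first exact: sigma_algebra_measurable.
move=> _ [x [B [Dx mB ->]]].
by rewrite -[X in measurable X]setTI; exact: (gp_measurable_sample gp Dx).
Qed.

Let gen : set (set T) := [set A | exists x, exists B : set R,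
  [/\ D x, measurable B & A = (g x @^-1` B)]].

(** The generators make each sampled value measurable, hence any polynomial in finitely many of
    them. This brings the Chernoff argument within reach of the independence hypothesis. *)
Lemma process_sigma_quad_form (n : nat) (A : 'I_n -> 'I_n -> R) (x : 'I_n -> R)
    (u c s : R) : (forall i, D (x i)) ->
  process_sigma D g [set w | s < expR
    (u * (quad_form A (fun i => g (x i) w) (fun i => g (x i) w) - c))].
Proof.
move=> Dx; pose TG := g_sigma_algebraType gen.
have mg i : measurable_fun (setT : set TG) (g (x i) : TG -> R).
  move=> _ B mB; rewrite setTI; apply: sub_sigma_algebra.
  by exists (x i), B.
have mY : measurable_fun (setT : set TG) (fun w : TG => expR
    (u * (quad_form A (fun i => g (x i) w) (fun i => g (x i) w) - c))).
  apply: measurableT_comp => //; apply: measurable_funM => //.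
  apply: measurable_funB => //; apply: measurable_sum => i; apply: measurable_sum => j.
  by apply: measurable_funM => //; exact: measurable_funM.
exact: measurable_gtr_set mY.
Qed.

End process_sigma_algebra.

Section kernel_norm.
Context {R : realType}.
Variables (a b : R).
Hypothesis ltab : a < b.
Local Notation D := (`[a, b]%classic).
Local Notation mu := (@lebesgue_measure R).
Local Notation L := (b - a).

Lemma kernel_L2norm_fin_num (f : R -> R -> R) (M : R) : continuous_kernel D f ->
  (forall x y, D x -> D y -> `|f x y| <= M) -> kernel_L2norm D f \is a fin_num.
Proof.
move=> cf fM.
have Da : D a by rewrite /= in_itv/= lexx ltW.
have M0 : 0 <= M by exact: le_trans (fM a a Da Da).
have ML : 0 <= M * L by rewrite mulr_ge0// subr_ge0 ltW.
have n0 : (0 <= kernel_L2norm D f)%E by exact: Lnorm_ge0.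
suff : (kernel_L2norm D f <= (M * L)%:E)%E.
  by move=> h; rewrite fin_numElt (lt_le_trans (ltNyr 0) n0)/= (le_lt_trans h)// ltry.
have mD : measurable D by exact: measurable_itv.
have mDD : measurable (D `*` D) by exact: measurableX.
have [_ h] := @Lnorm2_le _ _ R (mu \x mu)%E (D `*` D) (fun p => f p.1 p.2) (M * L) ML.
apply: h; apply: (@le_trans _ _ (\int[(mu \x mu)%E]_(p in D `*` D) (M ^+ 2)%:E)%E).
  apply: (@ge0_le_integral _ _ _ (mu \x mu)%E) => //=.
  - by move=> p _; rewrite lee_fin sqr_ge0.
  - apply/measurable_EFinP; apply: measurable_funX.
    exact: (continuous_kernel_measurable ltab cf).
  - move=> p [p1 p2]; rewrite lee_fin -(real_normK (num_real _)).
    by rewrite lerXn2r ?nnegrE// fM.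
rewrite integral_cst//; have := @product_measure1E _ _ _ _ R mu mu D D mD mD.
move=> /= ->; rewrite [X in (_ * (X * _))%E](lebesgue_measure_segment ltab).
rewrite [X in (_ * (_ * X))%E](lebesgue_measure_segment ltab).
by rewrite -!EFinM lee_fin exprMn [in leRHS]expr2.
Qed.

End kernel_norm.

(** * Concentration of the average over the probes *)

Section concentration.
Context {R : realType} {d : measure_display} {T : measurableType d}.
Variables (delta a b : R) (f K : R -> R -> R) (m : nat).
Variables (P : probability T R) (g : 'I_m -> R -> T -> R).
Hypotheses (delta_gt0 : 0 < delta) (delta_lt1 : delta < 1) (ltab : a < b).
Local Notation D := (`[a, b]%classic).
Hypothesis f_cont : continuous_kernel D f.
Hypothesis f_sym : forall x y, D x -> D y -> f x y = f y x.
Hypothesis m_ge : 96 * ln (4 / delta) <= m%:R.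
Hypothesis K_cont : continuous_kernel D K.
Hypothesis K_sym : forall x y, D x -> D y -> K x y = K y x.
Hypothesis g_gp : forall i, gaussian_process P D K (g i).
Hypothesis g_indep : independent_processes P D g.

Local Notation L := (b - a).
Local Notation H := (hutchinson D g f).
Local Notation op := (fine (op_norm D K)).
Local Notation fn := (fine (kernel_L2norm D f)).
Let c := Num.sqrt (96 * ln (4 / delta) / m%:R).

Let L0 : 0 < L. Proof. by rewrite subr_gt0. Qed.

Let ln_gt0 : 0 < ln (4 / delta).
Proof.
by apply: ln_gt0; rewrite ltr_pdivlMr// mul1r (lt_trans delta_lt1)// ltr1n.
Qed.

Let m0 : 0 < m%:R :> R.
Proof. by apply: lt_le_trans m_ge; rewrite mulr_gt0. Qed.

Let c_sq : c ^+ 2 = 96 * ln (4 / delta) / m%:R.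
Proof. by rewrite sqr_sqrtr// divr_ge0 ?(ltW m0)// mulr_ge0// ltW. Qed.

Let c0 : 0 < c. Proof. by rewrite sqrtr_gt0 divr_gt0// mulr_gt0. Qed.

Let c_sq_le1 : c ^+ 2 <= 1. Proof. by rewrite c_sq ler_pdivrMr// mul1r. Qed.

Let cD : compact D. Proof. exact: segment_compact. Qed.

Lemma measurable_hutchinson : measurable_fun setT H.
Proof.
apply: measurable_funM => //; apply: measurable_sum => i.
exact: (measurable_quadratic_functional ltab (g_gp i) f_cont).
Qed.

(** One partition serves all probes, as it depends only on f, K and the tolerances. The strict
    inequality on B leaves a gap that absorbs the error of [trace_bound]. *)
Let discretization (B e : R) : op * fn < B -> 0 < e ->
  exists (Q : 'I_m -> T -> R) (mean : 'I_m -> R),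
  [/\ forall i, P.-integrable setT (EFin \o Q i) /\ \int[P]_w Q i w = mean i,
      forall i, (\int[P]_w `|quadratic_functional a b f (g i) w - Q i w|%:E <= e%:E)%E,
      forall i t, 8 * t ^+ 2 * B ^+ 2 <= 1 ->
        (\int[P]_w (expR (t * (Q i w - mean i)))%:E <= (expR (8 * t ^+ 2 * B ^+ 2))%:E)%E &
      forall i u s, process_sigma D (g i) [set w | s < expR (u * (Q i w - mean i))]].
Proof.
move=> hB e0.
have [M M1 fM] := kernel_bounded cD f_cont.
have [kappa k1 KM] := kernel_bounded cD K_cont.
have op_fin := op_norm_fin_num ltab K_cont K_sym KM.
have fn_fin := kernel_L2norm_fin_num ltab f_cont fM.
have op0 : 0 <= op by rewrite fine_ge0// op_norm_ge0.
have fn0 : 0 <= fn by rewrite fine_ge0// Lnorm_ge0.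
have B0 : 0 < B by rewrite (le_lt_trans _ hB)// mulr_ge0.
pose C1 := op ^+ 2 * (2 * M * L ^+ 2 + L) + 2 * kappa * M ^+ 2 * L ^+ 4 + 1.
pose C2 := 2 * L ^+ 2 * ((M + 1) * (2 * kappa + 2)) + 1.
have M0 : 0 <= M by rewrite (le_trans ler01).
have ka0 : 0 <= kappa by rewrite (le_trans ler01).
have C1_gt0 : 0 < C1.
  rewrite ltr_wpDl// addr_ge0// mulr_ge0 ?sqr_ge0//.
  - by rewrite addr_ge0 ?(ltW L0)// mulr_ge0 ?sqr_ge0// mulr_ge0.
  - by rewrite mulr_ge0 ?sqr_ge0// mulr_ge0.
  - by rewrite exprn_ge0// ltW.
have C2_gt0 : 0 < C2.
  rewrite ltr_wpDl// !mulr_ge0 ?exprn_ge0 ?(ltW L0)//; by rewrite addr_ge0// mulr_ge0.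
have gap : 0 < B ^+ 2 - (op * fn) ^+ 2.
  by rewrite subr_gt0 ltrXn2r ?nnegrE ?mulr_ge0// (ltW B0).
pose r := Num.min 1 (e / C2).
have r0 : 0 < r by rewrite lt_min ltr01 divr_gt0.
have r1 : r <= 1 by rewrite ge_min lexx.
(* The first bound serves Young's inequality, the second makes eta C1 at most half the gap; r itself
   was chosen so that the mean error C2 r is at most e. *)
pose eta := Num.min (r ^+ 2) ((B ^+ 2 - (op * fn) ^+ 2) / (2 * C1)).
have eta0 : 0 < eta by rewrite lt_min exprn_gt0// divr_gt0// mulr_gt0.
have [d1 d1_gt0 fdel] := kernel_unif_continuous cD f_cont eta0.
have [d2 d2_gt0 Kdel] := kernel_unif_continuous cD K_cont eta0.
have h0 : 0 < Num.min d1 d2 by rewrite lt_min d1_gt0.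
have [N [idx [pt [ptD ptx mI]]]] := fine_partition ltab h0.
have ptx1 x : D x -> `|x - pt (idx x)| < d1.
  by move=> Dx; have := ptx x Dx; rewrite lt_min => /andP[].
have ptx2 x : D x -> `|x - pt (idx x)| < d2.
  by move=> Dx; have := ptx x Dx; rewrite lt_min => /andP[].
have modf x y : D x -> D y -> `|f x y - f (pt (idx x)) (pt (idx y))| <= eta.
  by move=> Dx Dy; apply/ltW/fdel => //; exact: ptx1.
have modK x y : D x -> D y -> `|K x y - K (pt (idx x)) (pt (idx y))| <= eta.
  by move=> Dx Dy; apply/ltW/Kdel => //; exact: ptx2.
have modKd x : D x -> K x x + K (pt (idx x)) (pt (idx x)) - 2 * K x (pt (idx x)) <= 2 * eta.
  move=> Dx; have Dx' := ptD (idx x).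
  have h1 : `|K x x - K x (pt (idx x))| < eta.
    by apply: Kdel => //; [rewrite subrr normr0|exact: ptx2].
  have h2 : `|K (pt (idx x)) (pt (idx x)) - K x (pt (idx x))| < eta.
    by apply: Kdel => //; [rewrite distrC; exact: ptx2|rewrite subrr normr0].
  have := ler_norm (K x x - K x (pt (idx x))).
  have := ler_norm (K (pt (idx x)) (pt (idx x)) - K x (pt (idx x))); lra.
have etar : eta <= r ^+ 2 by rewrite ge_min lexx.
pose A := discrete_kernel a b f idx pt.
pose S (i j : 'I_N) := K (pt i) (pt j).
pose Q i w := discrete_functional a b f (g i) idx pt w.
pose w_ := cell_weight a b idx.
have symA j k : A j k = A k j.
  by rewrite /A /discrete_kernel (f_sym (ptD j) (ptD k)) [X in X * _]mulrC.
have gv i (x : 'I_N -> R) := gp_gauss_mgf (g_gp i) x ptD.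
have covS i j k := gp_product (g_gp i) (ptD j) (ptD k).
exists Q, (fun i => \int[P]_w Q i w); split => //.
- move=> i; split=> //; apply: integrable_sumR => // j; apply: integrable_sumR => // k.
  have := integrableZl measurableT (A j k) (covS i j k).1.
  by congr (_.-integrable _ _).
- move=> i; have := mean_discretization_error ltab (g_gp i) f_cont mI ptD fM KM modf modKd r0 r1 etar.
  move=> /le_trans; apply; rewrite lee_fin.
  apply: (@le_trans _ _ (C2 * r)).
    by rewrite -subr_ge0 (_ : _ - _ = r) ?(ltW r0)// /C2; ring.
  by rewrite mulrC -ler_pdivlMr// ge_min lexx orbT.
- move=> i t ht; apply: (quadratic_chernoff_mgf (gv i) (covS i) symA) => //.
  pose U j k := \sum_l w_ l * (f (pt j) (pt l) * K (pt l) (pt k)).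
  have AS j k : \sum_l A j l * S l k = w_ j * U j k.
    by rewrite /U mulr_sumr; apply: eq_bigr => l _; rewrite /A /discrete_kernel /S -/w_; ring.
  have := trace_bound ltab mI ptD f_cont K_cont K_sym fM KM modf modK eta0 op0 fn0.
  rewrite !fineK// => /(_ (lexx _) (lexx _)) tb.
  apply: (@le_lt_trans _ _ (\sum_j \sum_k w_ j * w_ k * U j k ^+ 2)).
    (* tr(ASAS) pairs U j k with U k j, and 2xy <= x^2 + y^2 turns it into the weighted sum of
       squares bounded by [trace_bound]. *)
    apply: (@le_trans _ _ (\sum_j \sum_k (w_ j * w_ k * U j k ^+ 2 / 2 +
        w_ k * w_ j * U k j ^+ 2 / 2))).
      apply: ler_sum => j _; apply: ler_sum => k _; rewrite !AS.
      have ww : 0 <= w_ j * w_ k by rewrite mulr_ge0 ?cell_weight_ge0.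
      have := mulr_ge0 ww (sqr_ge0 (U j k - U k j)).
      rewrite (_ : w_ j * U j k * (w_ k * U k j) = w_ j * w_ k * (U j k * U k j)); last by ring.
      rewrite (mulrC (w_ k) (w_ j)); move: (w_ j * w_ k) => z; nra.
    rewrite le_eqVlt; apply/orP; left; apply/eqP.
    under eq_bigr do rewrite big_split/=.
    rewrite big_split/= [X in _ + X]exchange_big/= -big_split/=.
    by apply: eq_bigr => j _; rewrite -big_split/=; apply: eq_bigr => k _; field.
  apply: (le_lt_trans tb); rewrite -exprMn.
  have : eta * C1 <= (B ^+ 2 - (op * fn) ^+ 2) / 2.
    rewrite -ler_pdivlMr// (@le_trans _ _ ((B ^+ 2 - (op * fn) ^+ 2) / (2 * C1)))//.
      by rewrite ge_min lexx orbT.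
    by rewrite invfM mulrA.
  by rewrite /C1 !mulrDr; lra.
- move=> i u s; exact: (@process_sigma_quad_form _ _ _ D (g i) N A pt u (\int[P]_w Q i w) s ptD).
Qed.

Let mqf i : measurable_fun setT (quadratic_functional a b f (g i)).
Proof. exact: (measurable_quadratic_functional ltab (g_gp i) f_cont). Qed.

Let diff_integrable (Q : 'I_m -> T -> R) (e : R) i :
  P.-integrable setT (EFin \o Q i) ->
  (\int[P]_w `|quadratic_functional a b f (g i) w - Q i w|%:E <= e%:E)%E ->
  P.-integrable setT (EFin \o (fun w => `|quadratic_functional a b f (g i) w - Q i w|)).
Proof.
move=> iQ hQ; have mQ : measurable_fun setT (Q i).
  by apply/measurable_EFinP; exact: measurable_int iQ.
apply: ge0_integrable_lty => //; last by apply: le_lt_trans hQ _; rewrite ltry.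
by apply: measurableT_comp => //; exact: measurable_funB.
Qed.

(** A single crude discretisation is enough: each functional lies at integrable distance from an
    integrable quadratic form. *)
Lemma integrable_hutchinson : P.-integrable setT (EFin \o H).
Proof.
have hB : op * fn < op * fn + 1 by rewrite ltrDl.
have [Q [mean [iQ dQ _ _]]] := discretization hB ltr01.
have iq i : P.-integrable setT (EFin \o quadratic_functional a b f (g i)).
  apply: (integrable_le (g := fun w => `|quadratic_functional a b f (g i) w - Q i w| + `|Q i w|)) => //.
    have := integrableD measurableT (diff_integrable (iQ i).1 (dQ i)) (integrable_norm (iQ i).1).
    by congr (_.-integrable _ _).
  by move=> w; rewrite -[X in `|X| <= _](subrK (Q i w)) ler_normD.
have := integrableZl measurableT m%:R^-1
  (@integrable_sumR _ _ _ P _ (index_enum 'I_m) _ setT measurableT iq).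
by congr (_.-integrable _ _).
Qed.

Lemma hutchinson_tail (B : R) : op * fn < B ->
  (P [set w | B * c <= `|H w - \int[P]_w H w|]%R <= delta%:E)%E.
Proof.
move=> hB; have iH := integrable_hutchinson.
have op0 : 0 <= op by rewrite fine_ge0// op_norm_ge0.
have fn0 : 0 <= fn by rewrite fine_ge0// Lnorm_ge0.
(* Chernoff is run at the midpoint B1, and the slack xi covers the discretisation. With this e,
   Markov at level xi/2 costs delta/2, and the shift of the mean is at most xi/2. *)
pose B1 := (op * fn + B) / 2; pose xi := (B - B1) * c; pose e := xi * delta / 4.
have hB1 : op * fn < B1 by rewrite /B1; lra.
have B1_gt0 : 0 < B1 by rewrite (le_lt_trans _ hB1)// mulr_ge0.
have xi0 : 0 < xi by rewrite mulr_gt0// /B1; lra.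
have e0 : 0 < e by rewrite divr_gt0// mulr_gt0.
have [Q [mean [iQ dQ mgfQ sQ]]] := discretization hB1 e0.
pose Hn w := m%:R^-1 * \sum_i Q i w; pose mun := m%:R^-1 * \sum_i mean i.
have mQ i : measurable_fun setT (Q i).
  by apply/measurable_EFinP; exact: measurable_int (iQ i).1.
have mHn : measurable_fun setT Hn by apply: measurable_funM => //; exact: measurable_sum.
have mH := measurable_hutchinson.
have iHn : P.-integrable setT (EFin \o Hn).
  have := integrableZl measurableT m%:R^-1
    (@integrable_sumR _ _ _ P _ (index_enum 'I_m) _ setT measurableT (fun i => (iQ i).1)).
  by congr (_.-integrable _ _).
have EHn : \int[P]_w Hn w = mun.
  rewrite RintegralZl//; last by apply: integrable_sumR => // i; exact: (iQ i).1.
  by rewrite Rintegral_sum//; [congr (_ * _); apply: eq_bigr => i _; exact: (iQ i).2|move=> i; exact: (iQ i).1].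
have iD : P.-integrable setT (EFin \o (fun w => `|H w - Hn w|)).
  have := integrable_norm (integrableB measurableT iH iHn).
  by congr (_.-integrable _ _).
have ED : \int[P]_w `|H w - Hn w| <= e.
  pose dif w := m%:R^-1 * \sum_i `|quadratic_functional a b f (g i) w - Q i w|.
  have idi i := diff_integrable (iQ i).1 (dQ i).
  have ids := @integrable_sumR _ _ _ P _ (index_enum 'I_m) _ setT measurableT idi.
  apply: (@le_trans _ _ (\int[P]_w dif w)).
    apply: le_Rintegral => //.
      have := integrableZl measurableT m%:R^-1 ids.
      by congr (_.-integrable _ _).
    move=> w _; rewrite /dif /hutchinson /Hn -mulrBr normrM ger0_norm ?invr_ge0 ?(ltW m0)//.
    rewrite ler_wpM2l ?invr_ge0 ?(ltW m0)// -sumrB.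
    exact: ler_norm_sum.
  rewrite RintegralZl// Rintegral_sum// mulrC ler_pdivrMr//.
  have -> : e * m%:R = \sum_(i < m) e by rewrite sumr_const card_ord mulr_natr.
  by apply: ler_sum => i _; rewrite -lee_fin EFin_Rintegral.
have EHmun : `|\int[P]_w H w - mun| <= e.
  rewrite -EHn -RintegralB//; apply: le_trans ED.
  apply: le_normr_Rintegral => //.
  have := integrableB measurableT iH iHn.
  by congr (_.-integrable _ _).
pose A1 := [set w | m%:R * B1 * c <= `|\sum_i (Q i w - mean i)|].
pose A2 := [set w | xi / 2 <= `|H w - Hn w|].
have mA (Z : T -> R) (k : R) : measurable_fun setT Z -> measurable [set w | k <= `|Z w|].
  move=> mZ; have : measurable_fun setT (fun w => k <= `|Z w|).
    by apply: measurable_fun_ler => //; exact: measurableT_comp.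
  by move=> /(_ measurableT [set true]); rewrite setTI; exact.
have mY i : measurable_fun setT (fun w => Q i w - mean i) by exact: measurable_funB.
have mA1 : measurable A1 by apply: mA; exact: measurable_sum.
have mA2 : measurable A2 by apply: mA; exact: measurable_funB.
have PA1 : (P A1 <= (delta / 2)%:E)%E.
  (* The minimiser of 8 t^2 B1^2 - t B1 c. *)
  pose t := c / (16 * B1).
  have t0 : 0 < t by rewrite divr_gt0// mulr_gt0.
  have tB : 8 * t ^+ 2 * B1 ^+ 2 = c ^+ 2 / 32.
    by rewrite /t; field; rewrite gt_eqF.
  have tle : 8 * t ^+ 2 * B1 ^+ 2 <= 1 by rewrite tB; have := c_sq_le1; have := sqr_ge0 c; lra.
  have tleN : 8 * (- t) ^+ 2 * B1 ^+ 2 <= 1 by rewrite sqrrN.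
  have indep (A : 'I_m -> set T) : (forall i, process_sigma D (g i) (A i)) ->
      P (\bigcap_i A i) = (\prod_i P (A i))%E.
    move=> sA; have := g_indep (J := finset.setT) (A := A) (fun i _ => sA i).
    rewrite (_ : [set` finset.setT] = setT); last first.
      by apply/seteqP; split => i //= _; rewrite finset.in_setT.
    by move=> ->; apply: eq_bigl => i; rewrite finset.in_setT.
  have GT i : process_sigma D (g i) setT.
    by rewrite /process_sigma; exact: (@measurableT _ (g_sigma_algebraType _)).
  have := @indep_two_sided_tail _ _ _ P m (fun i => process_sigma D (g i))
    (fun i w => Q i w - mean i) t (8 * t ^+ 2 * B1 ^+ 2) (m%:R * B1 * c)
    (fun i => process_sigma_measurable (g_gp i)) indep GT mY sQ
    (fun i => mgfQ i t tle).
  move=> /(_ _ t0)/le_trans; apply.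
    by move=> i; have := mgfQ i (- t) tleN; rewrite sqrrN.
  rewrite lee_fin tB.
  have -> : m%:R * (c ^+ 2 / 32) - t * (m%:R * B1 * c) = - (3 * ln (4 / delta)).
    rewrite (_ : t * _ = m%:R * c ^+ 2 / 16); last by rewrite /t; field; rewrite gt_eqF.
    by rewrite c_sq; field; rewrite gt_eqF.
  rewrite expRN -[3]/(3%:R) expRM_natl lnK ?posrE ?divr_gt0//.
  rewrite -exprVn invf_div.
  have d4 : 0 <= delta / 4 by rewrite divr_ge0// ltW.
  (* The tail is 2 (delta/4)^3, and (delta/4)^2 <= 1. *)
  rewrite (_ : 2 * _ = (delta / 4) ^+ 2 * (delta / 2)); last by field.
  by rewrite ler_piMl ?divr_ge0 ?(ltW delta_gt0)// exprn_ile1//; have := delta_lt1; lra.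
have PA2 : (P A2 <= (delta / 2)%:E)%E.
  have : ((xi / 2)%:E * P A2 <= e%:E)%E.
    apply: (@le_trans _ _ (\int[P]_w `|H w - Hn w|%:E)%E); last first.
      by rewrite -EFin_Rintegral// lee_fin.
    rewrite -integral_cst//; apply: (@le_trans _ _ (\int[P]_(w in A2) `|H w - Hn w|%:E)%E).
      apply: ge0_le_integral => //=.
      - by move=> w _; rewrite lee_fin divr_ge0// ltW.
      - apply: measurable_funTS; apply/measurable_EFinP; apply: measurableT_comp => //.
        exact: measurable_funB.
    apply: ge0_subset_integral => //=.
    apply/measurable_EFinP; apply: measurableT_comp => //.
    exact: measurable_funB.
  rewrite -[P A2]fineK ?fin_num_measure// -EFinM !lee_fin.
  rewrite mulrC -ler_pdivlMr ?divr_gt0// => /le_trans; apply.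
  by rewrite /e le_eqVlt; apply/orP; left; apply/eqP; field; rewrite gt_eqF.
apply: (@le_trans _ _ (P (A1 `|` A2))).
  rewrite le_measure ?inE//.
  - by apply: mA; exact: measurable_funB.
  - exact: measurableU.
  (* Off A1 and A2 the deviation is below xi/2 + B1 c + xi/2 = B c. *)
  move=> w /= hw; apply: contrapT => /not_orP[/negP h1 /negP h2].
  rewrite -ltNge in h1; rewrite -ltNge in h2.
  have HnE : `|Hn w - mun| < B1 * c.
    rewrite /Hn /mun -mulrBr -sumrB normrM ger0_norm ?invr_ge0 ?(ltW m0)//.
    by rewrite mulrC ltr_pdivrMr// mulrC mulrA.
  have tri : `|H w - \int[P]_w H w| <= `|H w - Hn w| + `|Hn w - mun| + `|\int[P]_w H w - mun|.
    rewrite (_ : H w - _ = (H w - Hn w) + (Hn w - mun) - (\int[P]_w H w - mun)); last by ring.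
    by rewrite (le_trans (ler_normB _ _))// lerD2r ler_normD.
  have exi : e <= xi / 2.
    rewrite /e -mulrA ler_wpM2l ?(ltW xi0)//; have := delta_lt1; lra.
  have : B * c = B1 * c + xi by rewrite /xi; ring.
  by move: h2; rewrite -/(Hn w) => h2; lra.
apply: (@le_trans _ _ (P A1 + P A2)%E); first exact: measureU2.
by rewrite [delta in leRHS](splitr delta) EFinD leeD.
Qed.

End concentration.

(** * Passage to the exact threshold *)

Unset Implicit Arguments.

Theorem theorem4p4 (R : realType) (delta a b : R)
    (f K : R -> R -> R) (m : nat)
    (d : measure_display) (T : measurableType d) (P : probability T R)
    (g : 'I_m -> R -> T -> R)
    (delta_gt0 : 0 < delta) (delta_lt1 : delta < 1) (ltab : a < b)
    (f_cont : continuous_kernel `[a, b] f)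
    (f_decomp : exists f1 f2 : R -> R -> R,
       [/\ continuous_kernel `[a, b] f1 /\ psd_kernel `[a, b] f1,
           continuous_kernel `[a, b] f2 /\ psd_kernel `[a, b] f2
         & forall x y, x \in `[a, b] -> y \in `[a, b] -> f x y = f1 x y - f2 x y])
    (m_ge : 96 * ln (4 / delta) <= m%:R)
    (K_cont : continuous_kernel `[a, b] K)
    (K_psd : psd_kernel `[a, b] K)
    (g_gp : forall i, gaussian_process P `[a, b] K (g i))
    (g_indep : independent_processes P `[a, b] g) :
  let H := hutchinson `[a, b] g f in
  (P [set w | `|(H w)%:E - 'E_P[H]| <=
              op_norm `[a, b] K * kernel_L2norm `[a, b] f *
              (Num.sqrt (96 * ln (4 / delta) / m%:R))%:E]
   >= (1 - delta)%:E)%E.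
Proof.
cbv zeta; set H := hutchinson _ _ _.
(* A difference of positive semidefinite kernels is symmetric, as decoupling requires. *)
have f_sym x y : `[a, b]%classic x -> `[a, b]%classic y -> f x y = f y x.
  move=> Dx Dy; have [f1 [f2 [[_ p1] [_ p2] fE]]] := f_decomp.
  have fE' u v : `[a, b]%classic u -> `[a, b]%classic v -> f u v = f1 u v - f2 u v.
    by move=> Du Dv; apply: fE.
  by rewrite !fE'// (psd_kernel_sym p1 Dx Dy) (psd_kernel_sym p2 Dx Dy).
have K_sym := psd_kernel_sym K_psd.
have cD : compact `[a, b]%classic by exact: segment_compact.
have [M _ fM] := kernel_bounded cD f_cont.
have [kappa _ KM] := kernel_bounded cD K_cont.
have op_fin := op_norm_fin_num ltab K_cont K_sym KM.
have fn_fin := kernel_L2norm_fin_num ltab f_cont fM.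
have iH := integrable_hutchinson ltab f_cont f_sym K_cont K_sym g_gp.
have mH : measurable_fun setT H by exact: (measurable_hutchinson ltab f_cont g_gp).
have EH : ('E_P[H])%E = (\int[P]_w H w)%:E by rewrite unlock EFin_Rintegral.
set c := Num.sqrt _.
pose B := fine (op_norm `[a, b] K) * fine (kernel_L2norm `[a, b] f).
have setE : [set w | (`|(H w)%:E - 'E_P[H]| <=
    op_norm `[a, b] K * kernel_L2norm `[a, b] f * c%:E)%E] =
    [set w | `|H w - \int[P]_w H w| <= B * c].
  apply/seteqP; split => w /=; rewrite EH -(fineK op_fin) -(fineK fn_fin).
    by rewrite -!EFinM lee_fin.
  by rewrite -!EFinM lee_fin.
rewrite setE.
(* The tail bound needs a constant strictly above the product of the norms. The sets A n increase to
   cover the failure event, so continuity from below keeps the bound delta. *)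
pose A (n : nat) := [set w | (B + n.+1%:R^-1) * c <= `|H w - \int[P]_w H w|].
have mD : measurable_fun setT (fun w => `|H w - \int[P]_w H w|).
  by apply: measurableT_comp => //; exact: measurable_funB.
have mA n : measurable (A n).
  have : measurable_fun setT (fun w => (B + n.+1%:R^-1) * c <= `|H w - \int[P]_w H w|).
    exact: measurable_fun_ler.
  by move=> /(_ measurableT [set true]); rewrite setTI; exact.
have PA n : (P (A n) <= delta%:E)%E.
  apply: (hutchinson_tail delta_gt0 delta_lt1 ltab f_cont f_sym m_ge K_cont K_sym g_gp g_indep).
  by rewrite ltrDl invr_gt0.
have c0 : 0 <= c by exact: sqrtr_ge0.
have complE : ~` [set w | `|H w - \int[P]_w H w| <= B * c] `<=` \bigcup_n A n.
  move=> w /= /negP; rewrite -ltNge => hw.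
  pose gap := `|H w - \int[P]_w H w| - B * c.
  have gap0 : 0 < gap by rewrite subr_gt0.
  (* Dividing by c + 1 gives a positive threshold from c >= 0 alone, and still implies c / (n+1) <=
     gap. *)
  have e0 : 0 < gap / (c + 1) by rewrite divr_gt0// ltr_wpDl.
  have [n _ hn] := near_infty_natSinv_lt (PosNum e0).
  exists n => //; rewrite /A /= mulrDl -lerBrDl -/gap.
  have {}hn : n.+1%:R^-1 < gap / (c + 1) by exact: hn n (leqnn n).
  have c1 : 0 < c + 1 by rewrite ltr_wpDl.
  move: hn; rewrite ltr_pdivlMr// => hn; rewrite (le_trans _ (ltW hn))//.
  by rewrite ler_wpM2l ?invr_ge0// lerDl.
have PU : (P (\bigcup_n A n) <= delta%:E)%E.
  have cvgA : P (A n) @[n --> \oo] --> P (\bigcup_n A n).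
    apply: nondecreasing_cvg_mu => //; first exact: bigcupT_measurable.
    move=> n k nk; apply/subsetPset => w; rewrite /A /=; apply: le_trans.
    by rewrite ler_wpM2r// lerD2l lef_pV2 ?posrE// ler_nat ltnS.
  rewrite -(cvg_lim _ cvgA)//; apply: lime_le; first by apply/cvg_ex; eexists; exact: cvgA.
  exact: nearW.
have mE : measurable [set w | `|H w - \int[P]_w H w| <= B * c].
  have : measurable_fun setT (fun w => `|H w - \int[P]_w H w| <= B * c).
    exact: measurable_fun_ler.
  by move=> /(_ measurableT [set true]); rewrite setTI; exact.
have : (P (~` [set w | (`|H w - \int[P]_w H w| <= B * c)%R]) <= delta%:E)%E.
  apply: le_trans PU; rewrite le_measure ?inE//; first exact: measurableC.
  exact: bigcupT_measurable.
rewrite probability_setC// -[P _]fineK ?fin_num_measure//.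
by rewrite -EFinB !lee_fin => h; lra.
Qed.
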